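(* Let $F|k$ be an extension of algebraically closed fields of characteristic zero of transcendence degree $n$, $1\le n\le\infty$, and $G=G_{F|k}$. For any pair of distinct $v,v'\in{\mathcal P}^1_F$, the subgroup $H$ of $G$ generated by $G_v$ and $G_{v'}$ acts transitively on the set $\{L\stackrel{/k}{\hookrightarrow}F\}$ of field embeddings over $k$ for every finitely generated field extension $L$ of $k$; equivalently, $H$ is dense in $G$.
   Context: $n=\infty$ means countably infinite transcendence degree. $G_{F|k}$ is the group of field automorphisms of $F$ over $k$, with the topology in which the stabilizers of finite subsets of $F$ form a base of open subgroups. ${\mathcal P}^1_F$ is the set of valuation rings ${\mathcal O}_v$ in $F$ (identified with their valuations $v$) containing $k$ that are discrete of rank $1$: the value group $\Gamma=F^{\times}/{\mathcal O}_v^{\times}$ satisfies $\dim_{\mathbb Q}\Gamma=1$ and $F$ is algebraic over the subfield generated over $k$ by some lift to ${\mathcal O}_v$ of a transcendence base of the residue field over $k$ and a lift to $F^\times$ of a basis of $\Gamma$. $G_v=\{\sigma\in G\mid\sigma({\mathcal O}_v)={\mathcal O}_v\}$. *)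

(* Defs.v *)
From HB Require Import structures.
From mathcomp Require Import all_boot all_order all_algebra.
From mathcomp Require Import boolp classical_sets functions cardinality.
From mathcomp Require Import topology.
From mathcomp Require mpoly.

Set Implicit Arguments.
Unset Strict Implicit.
Unset Printing Implicit Defensive.

Import GRing.Theory.
Local Open Scope classical_set_scope.
Local Open Scope ring_scope.

(* An extension K of a field k is given by a map j : k -> K, a ring morphism in
   all uses below; k is identified with its image range j. *)

(* mpoly is imported only inside this section because its notations clash with
   those of classical_sets. *)
Section AlgebraicIndependence.
Import mpoly.

Definition alg_indep {k K : fieldType} (j : k -> K) (B : set K) :=
  forall (m : nat) (x : 'I_m -> K), injective x -> (forall i, B (x i)) ->
  forall p : {mpoly k[m]}, mmap j x p = 0 -> p = 0.

End AlgebraicIndependence.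

Section Extensions.
Context {k K : fieldType}.
Implicit Types (j : k -> K) (X B : set K).

Definition field_gen j X : set K :=
  smallest (fun S : set K => divring_closed [in S]) (range j `|` X).

Definition algebraic_over (S : set K) (x : K) :=
  exists p : {poly K}, [/\ p \is a polyOver [in S], p != 0 & root p x].

Definition transcendence_basis j B :=
  alg_indep j B /\ forall x, algebraic_over (field_gen j B) x.

(* [Some m] is the finite cardinal m, [None] is the countably infinite one. *)
Definition has_trdeg j (n : option nat) :=
  exists2 B, transcendence_basis j B &
    (B #= if n is Some m then `I_m else [set: nat])%card.

Definition finitely_generated j :=
  exists2 X : set K, finite_set X & field_gen j X = setT.

End Extensions.

Section Automorphisms.
Context {k F : fieldType} (iota : {rmorphism k -> F}).

Definition is_aut (f : F -> F) :=
  [/\ zmod_morphism f, monoid_morphism f, bijective f &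
      forall a, f (iota a) = iota a].

Definition autgroup : Type := set_type [set f | is_aut f].

HB.instance Definition _ := Choice.on autgroup.

Definition aut_fun (s : autgroup) : F -> F := val s.
Coercion aut_fun : autgroup >-> Funclass.

Lemma autP (s : autgroup) : is_aut s.
Proof. exact: set_mem (valP s). Qed.

Lemma aut_eq (s t : autgroup) : s =1 t -> s = t.
Proof. by move=> st; apply/val_inj/funext. Qed.

Definition mk_aut (f : F -> F) (fP : is_aut f) : autgroup :=
  exist _ f (mem_set fP).

Lemma is_aut_id : is_aut id.
Proof. by split=> //; exists id. Qed.

Lemma is_aut_comp (f g : F -> F) : is_aut f -> is_aut g -> is_aut (f \o g).
Proof.
move=> [fB [f1 fM] fb fi] [gB [g1 gM] gb gi]; split; last 2 first.
- exact: bij_comp.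
- by move=> a /=; rewrite gi fi.
- by move=> x y /=; rewrite gB fB.
- by split=> [|x y] /=; rewrite ?g1 ?gM.
Qed.

Lemma aut_inv_subproof (s : autgroup) :
  exists g, [/\ is_aut g, cancel s g & cancel g s].
Proof.
have [sB [s1 sM] [g sK gK] si] := autP s; exists g; split=> //; split.
- by move=> x y; apply: (can_inj sK); rewrite sB !gK.
- split=> [|x y]; apply: (can_inj sK); first by rewrite gK s1.
  by rewrite sM !gK.
- by exists s.
- by move=> a; rewrite -{1}[iota a]si sK.
Qed.

Definition aut_one := mk_aut is_aut_id.
Definition aut_mul (s t : autgroup) := mk_aut (is_aut_comp (autP s) (autP t)).
Definition aut_inv (s : autgroup) : autgroup :=
  let: exist _ h := cid (aut_inv_subproof s) in
  let: And3 gP _ _ := h in mk_aut gP.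

Lemma aut_mulA : associative aut_mul.
Proof. by move=> s t u; apply: aut_eq. Qed.
Lemma aut_mul1g : left_id aut_one aut_mul.
Proof. by move=> s; apply: aut_eq. Qed.
Lemma aut_mulg1 : right_id aut_one aut_mul.
Proof. by move=> s; apply: aut_eq. Qed.
Lemma aut_mulVg : left_inverse aut_one aut_inv aut_mul.
Proof.
by move=> s; apply: aut_eq => x; rewrite /aut_inv; case: cid => g [gP sK gK];
   apply: sK.
Qed.
Lemma aut_mulgV : right_inverse aut_one aut_inv aut_mul.
Proof.
by move=> s; apply: aut_eq => x; rewrite /aut_inv; case: cid => g [gP sK gK];
   apply: gK.
Qed.

HB.instance Definition _ := isGroup.Build autgroup
  aut_mulA aut_mul1g aut_mulg1 aut_mulVg aut_mulgV.

Definition stabilizer (X : set F) : set autgroup :=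
  [set t | forall x, X x -> t x = x].

(* The group topology in which the (pointwise) stabilizers of the finite subsets
   of F form a neighbourhood base at 1. *)
Definition aut_open (U : set autgroup) :=
  forall s, U s -> exists2 X : set F, finite_set X &
    forall t, stabilizer X t -> U (s * t)%g.

Lemma aut_openT : aut_open setT.
Proof. by move=> s _; exists set0. Qed.

Lemma aut_openI : setI_closed aut_open.
Proof.
move=> U V oU oV s [/oU[X fX XU] /oV[Y fY YV]].
exists (X `|` Y); first by rewrite finite_setU.
by move=> t tXY; split; [apply: XU|apply: YV] => x xX; apply: tXY;
  [left|right].
Qed.

Lemma aut_open_bigU (I : Type) (f : I -> set autgroup) :
  (forall i, aut_open (f i)) -> aut_open (\bigcup_i f i).
Proof.
move=> of_ s [i _ /of_[X fX Xf]]; exists X => // t tX.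
by exists i => //; apply: Xf.
Qed.

HB.instance Definition _ := isOpenTopological.Build autgroup
  aut_openT aut_openI aut_open_bigU.

Definition gen_subgroup (A : set autgroup) : set autgroup :=
  smallest (fun S : set autgroup => group_closed [in S]) A.

Definition decomposition_group (O : set F) : set autgroup :=
  [set s : autgroup | s @` O = O].

Definition is_embedding_over {L : fieldType} (j : k -> L)
    (f : {rmorphism L -> F}) :=
  forall a, f (j a) = iota a.

Definition transitive_on_embeddings {L : fieldType} (j : k -> L)
    (H : set autgroup) :=
  forall f g : {rmorphism L -> F},
    is_embedding_over j f -> is_embedding_over j g ->
    exists2 s, H s & forall x, s (f x) = g x.

End Automorphisms.

Arguments decomposition_group {k F} iota O.
Arguments transitive_on_embeddings {k F} iota {L} j H.

Section Valuations.
Context {k F : fieldType} (iota : {rmorphism k -> F}).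
Implicit Types O : set F.

Definition valuation_ring O :=
  subring_closed [in O] /\ forall x, x != 0 -> O x \/ O x^-1.

Definition val_units O : set F := [set x | [/\ x != 0, O x & O x^-1]].

(* rho restricts to a surjective ring morphism O -> kappa whose kernel is the
   maximal ideal of O, i.e. it presents kappa as the residue field of O; the
   values of rho outside O are irrelevant. *)
Definition residue_map O (kappa : fieldType) (rho : F -> kappa) :=
  [/\ rho 1 = 1,
      {in O &, {morph rho : x y / x - y}},
      {in O &, {morph rho : x y / x * y}},
      rho @` O = setT &
      forall x, O x -> (rho x = 0 <-> ~ val_units O x)].

(* w restricts to a surjective group morphism from the multiplicative group
   of F to Gamma with kernel the units of O, i.e. it presents Gamma as the value
   group of O; the value w 0 is irrelevant. *)
Definition value_map O (Gamma : zmodType) (w : F -> Gamma) :=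
  [/\ forall x y, x != 0 -> y != 0 -> w (x * y) = w x + w y,
      w @` [set x | x != 0] = setT &
      forall x, x != 0 -> (w x = 0 <-> val_units O x)].

(* The residue field and the value group are quantified existentially, being
   unique up to isomorphism; so is the Q-linear structure of the value group,
   of which an abelian group has at most one. *)
Definition P1 O :=
  [/\ valuation_ring O, range iota `<=` O &
    exists (kappa : fieldType) (rho : F -> kappa)
           (Gamma : vectType rat) (w : F -> Gamma),
      [/\ residue_map O rho, value_map O w, \dim {:Gamma} = 1%N &
        exists (B : set F) (Bbar : set kappa) (t : F),
          [/\ B `<=` O /\ set_bij B Bbar rho,
              transcendence_basis (rho \o iota) Bbar,
              t != 0 /\ basis_of {:Gamma} [:: w t] &
              forall x, algebraic_over (field_gen iota (B `|` [set t])) x]]].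

End Valuations.

(* Main.v *)
(* An automorphism tau lies in G_v up to an automorphism fixing a subfield E(y)
   as soon as F is algebraic over E(y), E and its preimage under tau lie in O_v,
   and y and its preimage lie in the maximal ideal: v and its transport by tau
   are then both the Gauss valuation on E(y), and extensions of a valuation to an
   algebraic extension are conjugate. With weak approximation this gives elements
   of G_v that move a lift B of a transcendence basis of the residue field of v,
   and a uniformizer t, to prescribed residues at v'.

   Density means that a k-isomorphism between finitely generated subfields is
   induced by an element of H.

   If B is infinite, the isomorphism is conjugated by H into the algebraic closure
   C of k(s'), where s' is a finite part of a lift B' at v'. It extends to an
   automorphism preserving C and fixing t' and the rest of B', and this one can be
   corrected to lie in G_v'.

   If B is finite, extend the isomorphism to an automorphism sigma and let W be
   the preimage of O_v. For a suitable perturbation X of B, F is a function field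
   of one variable over the algebraic closure of k(X), on which v and W are
   places. Over a subfield L containing the given finitely generated one there is
   a function u that vanishes at both places and has a single pole. Elements p and
   q of G_v send u and sigma(u) to poles at v', so that the preimages of O_v'
   under p and q sigma agree on L. Hence an automorphism h fixing L makes
   q sigma h p^-1 an element of G_v', and sigma h induces the isomorphism. *)

Require Import Defs.
From HB Require Import structures.
From mathcomp Require Import all_boot all_order all_algebra.
From mathcomp Require Import boolp classical_sets functions cardinality.
From mathcomp Require Import topology ring separable.
From mathcomp Require mpoly.

Set Implicit Arguments.
Unset Strict Implicit.
Unset Printing Implicit Defensive.

Import GRing.Theory.
Local Open Scope classical_set_scope.
Local Open Scope ring_scope.

(** * Generated subfields and relative algebraic closure *)

(** The two cases differ by the room available. The valuation is trivial on the algebraic closure of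
    k(B), but t lies outside it, and a finitely generated field may involve t. If B is infinite, a
    spare element of B' takes the place of t, so all data can be moved to where O' is trivial. If B
    is finite, the data may already have full transcendence degree, and the isomorphism has to be
    matched with a valuation that is non-trivial on it. Moves from G_v can easily achieve two
    things: a transported O' is trivial on the constants [acl X], and it has a pole at a given u
    from the maximal ideal of O. A function u with a single pole is one for which these two
    conditions already determine the valuation on L; this is why such a u is constructed. The moves
    are needed for u and for sigma(u), so X has to lift a residue basis at O and at W
    simultaneously, whence the perturbation of B. Rank one is used in the form of the Archimedean
    property. Characteristic zero enters through primitive elements and through the separability of
    a plane equation. *)

Section SubfieldType.
Variables (F : fieldType) (S : set F) (hS : divring_closed [in S]).
Definition subfield_pred : {pred F} := let _ := hS in [in S].
HB.instance Definition _ := GRing.isDivringClosed.Build F subfield_pred hS.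
Record subfield := Subfield { subfield_val :> F; _ : subfield_val \in subfield_pred }.
HB.instance Definition _ := [isSub for subfield_val].
HB.instance Definition _ := [Choice of subfield by <:].
HB.instance Definition _ := [SubChoice_isSubUnitRing of subfield by <:].
HB.instance Definition _ := [SubNzRing_isSubComNzRing of subfield by <:].
HB.instance Definition _ := [SubComUnitRing_isSubIntegralDomain of subfield by <:].
HB.instance Definition _ := [SubIntegralDomain_isSubField of subfield by <:].
End SubfieldType.

(** Polynomials need a field type of coefficients, so a subfield of F is always replaced by the
    range of a morphism from such a type. *)
Lemma subfield_type (F : fieldType) (S : set F) : divring_closed [in S] ->
  exists (E : fieldType) (v : {rmorphism E -> F}), range v = S.
Proof.
move=> hS; exists (subfield hS), (val : {rmorphism _ -> _}).
apply/seteqP; split=> [_ [x _ <-]|x Sx]; first exact: set_mem (valP x).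
by exists (Subfield (mem_set Sx : x \in subfield_pred hS)).
Qed.

Lemma divring_closedP (R : unitRingType) (S : set R) :
  divring_closed [in S] <-> [/\ S 1, forall x y, S x -> S y -> S (x - y)
    & forall x y, S x -> S y -> S (x / y)].
Proof.
split=> [] [S1 SB SV]; split=> [|x y|x y].
- by have := S1; rewrite !inE.
- by have := SB x y; rewrite !inE; apply.
- by have := SV x y; rewrite !inE; apply.
- by rewrite !inE.
- by rewrite !inE; apply: SB.
- by rewrite !inE; apply: SV.
Qed.

Lemma range_divring (E F : fieldType) (v : {rmorphism E -> F}) :
  divring_closed [in range v].
Proof.
apply/divring_closedP; split=> [|_ _ [x _ <-] [y _ <-]|_ _ [x _ <-] [y _ <-]].
- by exists 1; rewrite ?rmorph1.
- by exists (x - y); rewrite ?rmorphB.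
- by exists (x / y); rewrite ?fmorph_div.
Qed.

Section FieldGen.
Variables (k F : fieldType).
Implicit Types (j : k -> F) (D : set F).

Lemma field_gen_closed j D : divring_closed [in field_gen j D].
Proof.
apply/divring_closedP; split=> [S [] /divring_closedP[] //|x y Sx Sy S SP|x y Sx Sy S SP].
  by have [/divring_closedP[_ + _] _] := SP; apply; [apply: Sx|apply: Sy].
by have [/divring_closedP[_ _ +] _] := SP; apply; [apply: Sx|apply: Sy].
Qed.

Lemma field_gen_base j D a : field_gen j D (j a).
Proof. by move=> S [_]; apply; left; exists a. Qed.

Lemma sub_field_gen j D : D `<=` field_gen j D.
Proof. by move=> x Dx S [_]; apply; right. Qed.

Lemma field_gen_min j D S : divring_closed [in S] -> range j `<=` S -> D `<=` S ->
  field_gen j D `<=` S.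
Proof. by move=> cS jS DS x; apply; split=> // y [/jS|/DS]. Qed.

Lemma field_gen_sub j D D' : D `<=` field_gen j D' -> field_gen j D `<=` field_gen j D'.
Proof.
move=> DD'; apply: field_gen_min => //; first exact: field_gen_closed.
by move=> _ [a _ <-]; apply: field_gen_base.
Qed.

Lemma field_gen_type j D :
  exists (E : fieldType) (v : {rmorphism E -> F}), range v = field_gen j D.
Proof. exact/subfield_type/field_gen_closed. Qed.

Lemma field_gen_frac (E : fieldType) (v : {rmorphism E -> F}) j D z :
  range v = field_gen j D -> forall x, field_gen j (D `|` [set z]) x ->
  exists a b : {poly E}, (map_poly v b).[z] != 0 /\
    x = (map_poly v a).[z] / (map_poly v b).[z].
Proof.
move=> vE; apply: field_gen_min.
- apply/divring_closedP; split.
  + by exists 1, 1; rewrite rmorph1 hornerC oner_neq0 divr1.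
  + move=> _ _ [a [b [b0 ->]]] [c [d [d0 ->]]]; exists (a * d - c * b), (b * d).
    by rewrite rmorphB !rmorphM /= !hornerE mulf_neq0 // -mulNr addf_div // mulNr.
  + move=> _ _ [a [b [b0 ->]]] [c [d [d0 ->]]].
    (* Since 0^-1 = 0, a vanishing divisor gives the quotient 0, which needs its own witness 0/1. *)
    have [c0|c0] := eqVneq (map_poly v c).[z] 0.
      by exists 0, 1; rewrite rmorph1 rmorph0 hornerC oner_neq0 c0 mul0r invr0 mulr0 horner0 mul0r.
    exists (a * d), (b * c).
    by rewrite !rmorphM /= !hornerE mulf_neq0 // invf_div mulf_div.
- move=> _ [a _ <-].
  have : range v (j a) by rewrite vE; apply: field_gen_base.
  by move=> [e _ <-]; exists e%:P, 1; rewrite rmorph1 map_polyC !hornerC oner_neq0 divr1.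
- move=> x [Dx|->].
  + have : range v x by rewrite vE; apply: sub_field_gen.
    by move=> [e _ <-]; exists e%:P, 1; rewrite rmorph1 map_polyC !hornerC oner_neq0 divr1.
  + by exists 'X, 1; rewrite rmorph1 map_polyX hornerX hornerC oner_neq0 divr1.
Qed.

Lemma field_gen_finite j D x : field_gen j D x ->
  exists2 s : seq F, {subset s <= D} & field_gen j [set` s] x.
Proof.
move: x; apply: field_gen_min.
- apply/divring_closedP; split.
  + by exists [::] => //; have /divring_closedP[] := field_gen_closed j [set` [::]].
  + move=> x y [s sD sx] [t tD ty]; exists (s ++ t).
      by move=> u; rewrite mem_cat => /orP[/sD|/tD].
    have /divring_closedP[_ + _] := field_gen_closed j [set` s ++ t].
    by apply; [move: sx|move: ty]; apply: field_gen_sub => u /= us;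
      apply: sub_field_gen; rewrite /= mem_cat us ?orbT.
  + move=> x y [s sD sx] [t tD ty]; exists (s ++ t).
      by move=> u; rewrite mem_cat => /orP[/sD|/tD].
    have /divring_closedP[_ _ +] := field_gen_closed j [set` s ++ t].
    by apply; [move: sx|move: ty]; apply: field_gen_sub => u /= us;
      apply: sub_field_gen; rewrite /= mem_cat us ?orbT.
- by move=> _ [a _ <-]; exists [::] => //; apply: field_gen_base.
- move=> x Dx; exists [:: x] => [y|]; first by rewrite !inE => /eqP ->.
  by apply: sub_field_gen; rewrite /= inE.
Qed.

End FieldGen.

Lemma polyOver_setP (F : fieldType) (S : set F) (p : {poly F}) : S 0 ->
  p \is a polyOver [in S] <-> forall i, S p`_i.
Proof.
move=> S0; split=> [/allP pS i|pS].
  have [lt|le] := ltnP i (size p); last by rewrite nth_default.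
  by have := pS _ (mem_nth 0 lt); rewrite !inE.
by apply/allP => _ /(nthP 0)[i _ <-]; rewrite !inE.
Qed.

Lemma divring_closed0 (R : unitRingType) (S : set R) : divring_closed [in S] -> S 0.
Proof. by move=> /divring_closedP[S1 SB _]; rewrite -(subrr 1); apply: SB. Qed.

Section Algebraic.
Variables (E F : fieldType) (v : {rmorphism E -> F}).

Lemma polyOver_range (p : {poly F}) : p \is a polyOver [in range v] ->
  exists q, p = map_poly v q.
Proof.
move=> pR; have pv i : exists e, v e = p`_i.
  by have [e _ <-] := (polyOver_setP p (divring_closed0 (range_divring v))).1 pR i; exists e.
have [f fP] := choice pv.
exists (\poly_(i < size p) f i); apply/polyP => i.
rewrite coef_map coef_poly /=; case: ltnP => [_|le]; first by rewrite fP.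
by rewrite rmorph0 nth_default.
Qed.

Lemma map_polyOver_range (q : {poly E}) : map_poly v q \is a polyOver [in range v].
Proof.
apply/polyOver_setP => [|i]; first exact: divring_closed0 (range_divring v).
by exists q`_i; rewrite ?coef_map.
Qed.

Lemma algebraic_rangeP x : algebraic_over (range v) x <-> algebraicOver v x.
Proof.
split=> [[p [/polyOver_range[q ->] q0 qx]]|[q q0 qx]].
  by exists q => //; rewrite map_poly_eq0 in q0.
by exists (map_poly v q); split=> //; rewrite ?map_poly_eq0 ?map_polyOver_range.
Qed.

Lemma algebraic_trans x (p : {poly F}) : p != 0 -> root p x ->
  (forall i, algebraicOver v p`_i) -> algebraicOver v x.
Proof.
move=> p0 px pv; apply/integral_algebraic/(integral_root p0 px) => _ /(nthP 0)[i _ <-].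
exact/integral_algebraic.
Qed.

End Algebraic.

Section Acl.
Variables (k F : fieldType).
Implicit Types (j : k -> F) (D : set F).

(** The closure operator of a pregeometry: idempotent by [acl_sub], finitary by [acl_finite], with
    exchange by [acl_exchange]. Transcendence bases are handled through it. *)
Definition acl j D : set F := [set x | algebraic_over (field_gen j D) x].

Lemma algebraic_over_sub (S S' : set F) x : S `<=` S' ->
  algebraic_over S x -> algebraic_over S' x.
Proof.
move=> SS' [p [/allP pS p0 px]]; exists p; split=> //.
by apply/allP => c /pS; rewrite !inE; apply: SS'.
Qed.

Lemma aclP (E : fieldType) (v : {rmorphism E -> F}) j D x :
  range v = field_gen j D -> acl j D x <-> algebraicOver v x.
Proof. by move=> vE; rewrite /acl -vE; exact: algebraic_rangeP. Qed.

Lemma acl_closed j D : divring_closed [in acl j D].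
Proof.
have [E [v vE]] := field_gen_type j D.
apply/divring_closedP; split=> [|x y|x y]; rewrite !(aclP _ vE).
- exact: algebraic1.
- exact: algebraic_sub.
- exact: algebraic_div.
Qed.

Lemma field_gen_acl j D : field_gen j D `<=` acl j D.
Proof.
have [E [v vE]] := field_gen_type j D.
by rewrite -vE => _ [e _ <-]; apply/(aclP _ vE)/algebraic_id.
Qed.

Lemma sub_acl j D : D `<=` acl j D.
Proof. by move=> x /(@sub_field_gen _ _ j)/field_gen_acl. Qed.

Lemma acl_base j D a : acl j D (j a).
Proof. by apply: field_gen_acl; apply: field_gen_base. Qed.

Lemma algebraic_over_acl j D x : algebraic_over (acl j D) x -> acl j D x.
Proof.
have [E [v vE]] := field_gen_type j D.
move=> -[p [/(polyOver_setP p (divring_closed0 (acl_closed j D))) pv p0 px]].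
by apply/(aclP _ vE)/(algebraic_trans p0 px) => i; apply/(aclP _ vE).
Qed.

Lemma acl_sub j D D' : D `<=` acl j D' -> acl j D `<=` acl j D'.
Proof.
move=> DD' x ax; apply: algebraic_over_acl; apply: algebraic_over_sub ax.
apply: field_gen_min => //; first exact: acl_closed.
by move=> _ [a _ <-]; apply: acl_base.
Qed.

Lemma acl_mono j D D' : D `<=` D' -> acl j D `<=` acl j D'.
Proof. by move=> DD'; apply: acl_sub => x /DD'/(@sub_acl j). Qed.

Lemma acl_finite j D x : acl j D x ->
  exists2 s : seq F, {subset s <= D} & acl j [set` s] x.
Proof.
move=> [p [/(polyOver_setP p (divring_closed0 (field_gen_closed j D))) pD p0 px]].
have /choice[s sP] i : exists s : seq F, {subset s <= D} /\ field_gen j [set` s] p`_i.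
  by have /field_gen_finite[s ? ?] := pD i; exists s.
exists (flatten (mkseq s (size p))).
  by move=> y /flattenP[t /mapP[i _ ->] /(sP i).1].
have gen0 := divring_closed0 (field_gen_closed j [set` flatten (mkseq s (size p))]).
exists p; split=> //; apply/polyOver_setP => // i.
have [lt|le] := ltnP i (size p); last by rewrite nth_default.
have [_] := sP i; apply: field_gen_sub => y /= ys; apply: sub_field_gen => /=.
by apply/flattenP; exists (s i) => //; apply/mapP; exists i; rewrite ?mem_iota.
Qed.

End Acl.

Section Eval.
Variables (E F : fieldType) (v : {rmorphism E -> F}).

Definition eval1 (z : F) : {poly E} -> F := horner_eval z \o map_poly v.
HB.instance Definition _ z := GRing.RMorphism.on (eval1 z).

Lemma eval1E z p : eval1 z p = (map_poly v p).[z]. Proof. by []. Qed.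
Lemma eval1C z c : eval1 z c%:P = v c. Proof. by rewrite eval1E map_polyC hornerC. Qed.
Lemma eval1X z : eval1 z 'X = z. Proof. by rewrite eval1E map_polyX hornerX. Qed.

Definition eval2 (z y : F) : {poly {poly E}} -> F := horner_eval y \o map_poly (eval1 z).
HB.instance Definition _ z y := GRing.RMorphism.on (eval2 z y).

Lemma eval2E z y g : eval2 z y g = (map_poly (eval1 z) g).[y]. Proof. by []. Qed.
Lemma eval2C z y c : eval2 z y c%:P = eval1 z c.
Proof. by rewrite eval2E map_polyC hornerC. Qed.
Lemma eval2X z y : eval2 z y 'X = y. Proof. by rewrite eval2E map_polyX hornerX. Qed.

Lemma eval2_swap z y g : eval2 y z (swapXY g) = eval2 z y g.
Proof.
have e2 a b h : eval2 a b h = (swapXY (map_poly (map_poly v) h)).[a%:P].[b].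
  by rewrite horner_swapXY -map_poly_comp.
by rewrite !e2 -swapXY_map swapXYK horner2_swapXY.
Qed.

Lemma clear_denominators (k : fieldType) (j : k -> F) (D : set F) z (p : {poly F}) :
  range v = field_gen j D -> p \is a polyOver [in field_gen j (D `|` [set z])] ->
  exists (b : {poly E}) (g : {poly {poly E}}), eval1 z b != 0 /\
    eval1 z b *: p = map_poly (eval1 z) g.
Proof.
move=> vE /(polyOver_setP p (divring_closed0 (field_gen_closed _ _))) pD.
have /choice[ab abP] i : exists ab : {poly E} * {poly E}, eval1 z ab.2 != 0 /\
    p`_i = eval1 z ab.1 / eval1 z ab.2.
  by have [a [b [b0 ->]]] := field_gen_frac vE (pD i); exists (a, b).
exists (\prod_(i < size p) (ab i).2).
exists (\poly_(i < size p) ((ab i).1 * \prod_(l < size p | l != i :> nat) (ab l).2)).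
split; first by rewrite rmorph_prod; apply/prodf_neq0 => i _; have [] := abP i.
apply/polyP => i; rewrite coefZ coef_map coef_poly.
case: ltnP => [lt|le]; last by rewrite raddf0 nth_default // mulr0.
have [bi0 ->] := abP i.
rewrite (bigD1 (Ordinal lt)) //= 2!rmorphM mulrAC [_ * (_ / _)]mulrC divfK //.
Qed.

End Eval.

(** * Exchange property and independent sequences *)

Section Exchange.
Variables (k F : fieldType) (j : k -> F).
Implicit Types D : set F.
Notation acl := (acl j).

(** With denominators cleared, the equation of y over D(x) is a relation g(x, y) = 0 in two
    variables; [swapXY] reads it as an equation for x over D(y). It does not degenerate: a non-zero
    coefficient that vanished at y would make y algebraic over D. *)
Lemma acl_exchange D x y : acl (D `|` [set x]) y -> ~ acl D y -> acl (D `|` [set y]) x.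
Proof.
move=> [p [pD p0 py]] aDy.
have [E [v vE]] := field_gen_type j D.
have [b [g [b0 bg]]] := clear_denominators vE pD.
have g0 : map_poly (eval1 v x) g != 0 by rewrite -bg scaler_eq0 negb_or b0.
have gy : eval2 v y x (swapXY g) = 0.
  by rewrite eval2_swap eval2E -bg hornerZ (rootP py) mulr0.
exists (map_poly (eval1 v y) (swapXY g)); split.
- apply/(polyOver_setP _ (divring_closed0 (field_gen_closed _ _))) => i.
  rewrite coef_map /=; move: (swapXY g)`_i => q.
  have [E' [v' vE']] := field_gen_type j (D `|` [set y]).
  rewrite eval1E horner_coef -vE'.
  have [e ->] : exists e, y = v' e.
    have [e _ <-] : range v' y by rewrite vE'; apply: sub_field_gen; right.
    by exists e.
  have /choice[f fP] l : exists e', v q`_l = v' e'.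
    have [e' _ <-] : range v' (v q`_l); last by exists e'.
    rewrite vE'; have : range v (v q`_l) by exists q`_l.
    by rewrite vE; apply: field_gen_sub => u Du; apply: sub_field_gen; left.
  exists (\sum_(l < size (map_poly v q)) f l * e ^+ l) => //.
  by rewrite rmorph_sum; apply: eq_bigr => l _; rewrite rmorphM rmorphXn coef_map /= fP.
- apply: contraNneq g0 => sg0; apply/eqP/polyP => i; rewrite coef0 coef_map.
  suff -> : g = 0 by rewrite coef0 raddf0.
  apply/eqP; rewrite -swapXY_eq0; apply/eqP/polyP => l; rewrite coef0.
  apply: contra_notP aDy => /eqP l0; apply/(aclP _ vE); exists (swapXY g)`_l => //.
  by rewrite /root -eval1E; have /polyP/(_ l) := sg0; rewrite coef_map coef0 => ->.
- by rewrite /root -eval2E gy.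
Qed.

(** The recursive form lets elements be adjoined one at a time. A repetition is excluded
    automatically, as a lies in [acl] of D with a adjoined. *)
Fixpoint indep D (s : seq F) : Prop :=
  if s is a :: s' then ~ acl D a /\ indep (D `|` [set a]) s' else True.

Lemma set_seq_cons (a : F) s : [set` a :: s] = [set a] `|` [set` s].
Proof.
apply/seteqP; split=> x /=; rewrite inE.
  by case/orP=> [/eqP->|]; [left|right].
by move=> [->|xs]; apply/orP; [left|right].
Qed.

Lemma indep_cat D s u : indep D (s ++ u) <-> indep D s /\ indep (D `|` [set` s]) u.
Proof.
elim: s D => [|a s IHs] D /=.
  have -> : D `|` [set` [::]] = D.
    by apply/seteqP; split=> [x []|x]; [|rewrite /= in_nil|left].
  by split=> [|[]].
by rewrite IHs set_seq_cons setUA; split=> [[? []]|[[? ?] ?]].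
Qed.

(** The head a of s is exchanged against an element c of u, namely the last one of the shortest
    prefix of u on which a depends over D. The rest of s is then handled over D with a adjoined. *)
Lemma steinitz D s u : indep D s -> [set` s] `<=` acl (D `|` [set` u]) ->
  (size s <= size u)%N /\ (size s = size u -> [set` u] `<=` acl (D `|` [set` s])).
Proof.
elim: s D u => [|a s IHs] D u /=.
  by move=> _ _; split=> // /esym/size0nil ->.
move=> [Da Ds] sDu.
have /sDu Dua : [set` a :: s] a by rewrite /= inE eqxx.
have [u1 [c [u2 [uE cD]]]] : exists u1 c u2, u = u1 ++ c :: u2 /\
    acl (D `|` [set a] `|` [set` u1 ++ u2]) c.
  elim/last_ind: u Dua {sDu} => [|u c IHu] Dua.
    case: Da; move: Dua; congr (acl _ a).
    by apply/seteqP; split=> [x []|x]; [|rewrite /= in_nil|left].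
  have [Dua'|Dua'] := pselect (acl (D `|` [set` u]) a).
    have [u1 [c' [u2 [-> c'D]]]] := IHu Dua'.
    exists u1, c', (rcons u2 c); split; first by rewrite rcons_cat.
    move: c'D; apply: acl_mono => x [Dx|xu]; [by left|right] => /=.
    by rewrite -rcons_cat mem_rcons inE xu orbT.
  exists u, c, [::]; split; first by rewrite cats1.
  rewrite cats0 -setUA [[set a] `|` _]setUC setUA; apply: acl_exchange Dua'.
  move: Dua; apply: acl_mono => x [Dx|]; first by do 2 left.
  by rewrite /= mem_rcons inE => /orP[/eqP->|]; [right|left; right].
have sDu' : [set` s] `<=` acl (D `|` [set a] `|` [set` u1 ++ u2]).
  move=> x xs; have /sDu : [set` a :: s] x by rewrite /= inE xs orbT.
  apply: acl_sub => y [Dy|]; first by apply: sub_acl; do 2 left.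
  rewrite /= uE mem_cat inE orbCA => /orP[/eqP->//|]; rewrite -mem_cat => yu.
  by apply: sub_acl; right.
have [le_s eq_s] := IHs _ _ Ds sDu'.
have su : size u = (size (u1 ++ u2)).+1 by rewrite uE !size_cat /= addnS.
split; first by rewrite su.
rewrite su => -[/eq_s us].
have u12 : [set` u1 ++ u2] `<=` acl (D `|` [set` a :: s]).
  by rewrite set_seq_cons setUA.
move=> x /=; rewrite uE mem_cat inE orbCA -mem_cat => /orP[/eqP->|/u12//].
move: cD; apply: acl_sub => y [|/u12//] Dy; apply: sub_acl.
by move: Dy => [|->]; [left|right; rewrite /= inE eqxx].
Qed.

End Exchange.

(** * Valuation rings and algebraic extensions *)

Section PolyImage.

Lemma horner_mx_eigen (F : fieldType) n (A : 'M[F]_n.+1) (u : 'rV_n.+1) a q :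
  u *m A = a *: u -> u *m horner_mx A q = q.[a] *: u.
Proof.
move=> uA; elim/poly_ind: q => [|q c IHq]; first by rewrite rmorph0 horner0 mulmx0 scale0r.
rewrite rmorphD rmorphM /= horner_mx_X horner_mx_C hornerMXaddC mulmxDr mulmxA IHq.
by rewrite -scalemxAl uA scalerA mul_mx_scalar scalerDl.
Qed.

(** Spectral mapping: the product of the factors A - a, over the roots a of q - c, kills u, so one
    factor is singular. If q is the constant c, any eigenvalue of A serves. *)
Lemma horner_mx_eigenvalue (F : closedFieldType) n (A : 'M[F]_n.+1) q c :
  eigenvalue (horner_mx A q) c -> exists2 a, eigenvalue A a & c = q.[a].
Proof.
move=> /eigenvalueP[u uA u0]; have [r qE] := closed_field_poly_normal (q - c%:P).
have {uA} : u *m horner_mx A (q - c%:P) = 0.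
  by rewrite rmorphB /= horner_mx_C mulmxBr uA mul_mx_scalar subrr.
have [/eqP|q0] := eqVneq (q - c%:P) 0.
  rewrite subr_eq0 => /eqP -> _.
  have /closed_rootP[a aA] : size (char_poly A) != 1%N by rewrite size_char_poly.
  by exists a; rewrite ?hornerC // eigenvalue_root_char.
rewrite qE linearZ /= -scalemxAr => /eqP; rewrite scaler_eq0 lead_coef_eq0 (negPf q0) /=.
move=> /eqP ur; suff [a ar aA] : exists2 a, a \in r & eigenvalue A a.
  exists a => //; apply/esym/eqP; rewrite -subr_eq0 -[c in _ - c](hornerC _ a) -hornerN -hornerD.
  by rewrite qE -/(root _ _) rootZ ?lead_coef_eq0 // root_prod_XsubC.
elim: r u u0 ur {qE} => [|a r IHr] u u0.
  by rewrite big_nil rmorph1 mulmx1 => /eqP; rewrite (negPf u0).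
rewrite big_cons rmorphM /= mulmxA rmorphB /= horner_mx_X horner_mx_C.
set w := u *m _; have [w0 _|w0 /(IHr w w0)[b br bA]] := eqVneq w 0; last first.
  by exists b; rewrite // inE br orbT.
exists a; first by rewrite inE eqxx.
apply/eigenvalueP; exists u => //.
by apply/eqP; rewrite -subr_eq0 -mul_mx_scalar -mulmxBr -/w w0.
Qed.

(* The witness is the characteristic polynomial of a(T) acting on E[T]/(p). *)
Lemma poly_image (E : fieldType) (p a : {poly E}) : p \is monic -> (1 < size p)%N ->
  exists2 q : {poly E}, q \is monic & forall (F : closedFieldType) (v : {rmorphism E -> F}),
    (forall x, root (map_poly v p) x -> root (map_poly v q) (eval1 v x a)) /\
    (forall y, root (map_poly v q) y -> exists2 x, root (map_poly v p) x & y = eval1 v x a).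
Proof.
move=> pm p1.
have [n [C CE]] : exists n (C : 'M[E]_n.+1), char_poly C = p.
  move: (companionmx p) (companionmxK pm); case: (size p).-1 => [|n] C CE.
    by move: p1; rewrite -CE size_char_poly.
  by exists n, C.
exists (char_poly (horner_mx C a)); first exact: char_poly_monic.
move=> F v; rewrite map_char_poly map_horner_mx -CE map_char_poly.
split=> [x|y]; rewrite -!eigenvalue_root_char; last first.
  by move=> /horner_mx_eigenvalue[x]; rewrite eigenvalue_root_char; exists x.
move=> /eigenvalueP[u uC u0]; apply/eigenvalueP; exists u => //.
exact: horner_mx_eigen.
Qed.

End PolyImage.

Section ValuationRing.
Variables (F : fieldType) (O : set F).
Hypothesis vO : valuation_ring O.

Lemma vr1 : O 1. Proof. by have [[+ _ _] _] := vO; rewrite inE. Qed.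
Lemma vrB x y : O x -> O y -> O (x - y).
Proof. by have [[_ + _] _] := vO => /(_ x y); rewrite !inE. Qed.
Lemma vrM x y : O x -> O y -> O (x * y).
Proof. by have [[_ _ +] _] := vO => /(_ x y); rewrite !inE. Qed.
Lemma vr0 : O 0. Proof. by rewrite -(subrr 1); apply: vrB; apply: vr1. Qed.
Lemma vrN x : O x -> O (- x).
Proof. by move=> Ox; rewrite -sub0r; apply: vrB => //; apply: vr0. Qed.
Lemma vrD x y : O x -> O y -> O (x + y).
Proof. by move=> Ox Oy; rewrite -(opprK y); apply: vrB => //; apply: vrN. Qed.
Lemma vrX x n : O x -> O (x ^+ n).
Proof.
move=> Ox; elim: n => [|n IHn]; first by rewrite expr0; apply: vr1.
by rewrite exprS; apply: vrM.
Qed.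
Lemma vr_sum I (r : seq I) (P : pred I) (G : I -> F) :
  (forall i, P i -> O (G i)) -> O (\sum_(i <- r | P i) G i).
Proof. by move=> OG; elim/big_rec: _ => [|i x Pi Ox]; [apply: vr0|apply/vrD/Ox/OG]. Qed.
Lemma vrV x : ~ O x -> O x^-1.
Proof.
move=> Ox; have x0 : x != 0 by apply: contra_notN Ox => /eqP->; apply: vr0.
by have [_ /(_ x x0)[]] := vO.
Qed.
Lemma vr_horner (p : {poly F}) x : (forall i, O p`_i) -> O x -> O p.[x].
Proof. by move=> Op Ox; rewrite horner_coef; apply: vr_sum => i _; apply/vrM/vrX/Ox/Op. Qed.

Lemma vr_neq0 x : ~ O x -> x != 0.
Proof. by move=> Ox; apply: contra_notN Ox => /eqP->; apply: vr0. Qed.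

(* The maximal ideal of O; the case x = 0 is separate because 0^-1 = 0. *)
Definition vmax : set F := [set x | x = 0 \/ ~ O x^-1].

Lemma vmaxW x : vmax x -> O x.
Proof. by move=> [->|/vrV]; [apply: vr0|rewrite invrK]. Qed.

Lemma vmax0 : vmax 0. Proof. by left. Qed.

Lemma vmaxV x : ~ O x -> vmax x^-1. Proof. by move=> Ox; right; rewrite invrK. Qed.

Lemma vmaxM x y : O x -> vmax y -> vmax (x * y).
Proof.
move=> Ox [->|Oy]; first by rewrite mulr0; left.
have [->|x0] := eqVneq x 0; first by rewrite mul0r; left.
right; apply: contra_not Oy; rewrite invfM => Oxy.
by rewrite -(mulVKf x0 y^-1); apply: vrM.
Qed.

Lemma vmax_unit x : x != 0 -> O x^-1 -> ~ vmax x.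
Proof. by move=> x0 Ox [x00|//]; rewrite x00 eqxx in x0. Qed.

Lemma vmax1 : ~ vmax 1.
Proof. by apply: vmax_unit; rewrite ?oner_eq0 ?invr1 //; apply: vr1. Qed.

Lemma vmax_notV x : O x -> ~ vmax x -> x != 0 /\ O x^-1.
Proof.
move=> Ox xm; split; first by apply: contra_notN xm => /eqP->; left.
by apply: contrapT => xm'; apply: xm; right.
Qed.

Lemma vmaxD x y : vmax x -> vmax y -> vmax (x + y).
Proof.
have aux a b : vmax a -> vmax b -> a != 0 -> O (b / a) -> vmax (a + b).
  move=> am bm a0 Oba; have -> : a + b = (1 + b / a) * a.
    by rewrite mulrDl mul1r divfK.
  by apply: vmaxM => //; apply/vrD/Oba/vr1.
move=> xm ym; have [->|x0] := eqVneq x 0; first by rewrite add0r.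
have [->|y0] := eqVneq y 0; first by rewrite addr0.
have [Oyx|/vrV] := pselect (O (y / x)); first exact: aux.
by rewrite invf_div addrC => Oxy; apply: aux.
Qed.

Lemma vmaxN x : vmax x -> vmax (- x).
Proof. by move=> xm; rewrite -mulN1r; apply: vmaxM => //; apply/vrN/vr1. Qed.

Lemma vmaxB x y : vmax x -> vmax y -> vmax (x - y).
Proof. by move=> xm ym; apply: vmaxD => //; apply: vmaxN. Qed.

Lemma vmax1D x : vmax x -> [/\ 1 + x != 0, O (1 + x) & O (1 + x)^-1].
Proof.
move=> xm; have Ox : O (1 + x) by apply/vrD/vmaxW/xm/vr1.
have [|//] := vmax_notV Ox.
by move=> xm'; apply: vmax1; rewrite -(addrK x 1); apply: vmaxB.
Qed.

Lemma vmax_sum I (r : seq I) (P : pred I) (G : I -> F) :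
  (forall i, P i -> vmax (G i)) -> vmax (\sum_(i <- r | P i) G i).
Proof. by move=> OG; elim/big_rec: _ => [|i x Pi Ox]; [apply: vmax0|apply/vmaxD/Ox/OG]. Qed.

(** If x were outside O, dividing the equation by x^n would write 1 as a sum of elements of the
    maximal ideal. *)
Lemma vr_integral x (p : {poly F}) : p \is monic -> (forall i, O p`_i) -> root p x -> O x.
Proof.
move=> pm Op /rootP px; apply: contrapT => Ox; have x0 := vr_neq0 Ox.
have := pm; rewrite monicE lead_coefE => /eqP p1.
have p_gt0 : (0 < size p)%N by rewrite size_poly_gt0 monic_neq0.
move: px; rewrite horner_coef -(prednK p_gt0) big_ord_recr /= p1 mul1r.
set n := (size p).-1 => /eqP; rewrite addr_eq0 => /eqP pxn.
set S := (X in X = _) in pxn; apply: vmax1.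
have -> : 1 = - S / x ^+ n by rewrite pxn opprK divff ?expf_neq0.
rewrite mulNr; apply/vmaxN; rewrite mulr_suml; apply: vmax_sum => i _.
rewrite -mulrA; apply: vmaxM => //.
have -> : x ^+ n = x ^+ i * x ^+ (n - i) by rewrite -exprD subnKC // ltnW.
rewrite invfM mulrA divff ?expf_neq0 // mul1r -exprVn.
have : (0 < n - i)%N by rewrite subn_gt0.
case: (n - i)%N => // m _; rewrite exprS mulrC; apply: vmaxM; last exact: vmaxV.
exact/vrX/vrV.
Qed.

Lemma vr_algebraic (S : set F) x : divring_closed [in S] -> S `<=` O ->
  algebraic_over S x -> O x.
Proof.
move=> /subfield_type[E [v <-]] SO /algebraic_rangeP/integral_algebraic[p pm px].
apply: vr_integral px; first by rewrite map_monic.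
by move=> i; rewrite coef_map; apply: SO; exists p`_i.
Qed.

(** Rank at most one without a value group: powers of an element with a pole dominate everything. It
    holds vacuously for the trivial valuation O = F. *)
Definition archimedean_val := forall x y, ~ O x -> exists N, O (y / x ^+ N).

Lemma arch_large x y : archimedean_val -> (~ O x \/ ~ O y) ->
  exists N, forall s, (N <= s)%N -> ~ O (x + y ^+ s).
Proof.
move=> aO xy; have [Oy|Oy] := pselect (O y).
  exists 0%N => s _ Oxy; case: xy => // -[].
  by rewrite -(addrK (y ^+ s) x); apply/vrB/vrX/Oy.
have [N xyN] := aO y x Oy; exists N.+1 => s Ns Oxy.
have y0 := vr_neq0 Oy.
have ys : vmax (y ^+ s)^-1.
  case: s Ns {Oxy} => // s _; rewrite exprS invfM mulrC -exprVn.
  by apply/vmaxM/vmaxV/Oy/vrX/vrV.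
apply: vmax1; have -> : 1 = (x + y ^+ s) / y ^+ s - x / y ^+ s.
  by rewrite mulrDl divff ?expf_neq0 // addrAC subrr add0r.
apply: vmaxB; first exact: vmaxM.
rewrite -(subnKC Ns) addSnnS exprD invfM mulrA; apply: vmaxM => //.
by rewrite exprS invfM mulrC -exprVn; apply/vmaxM/vmaxV/Oy/vrX/vrV.
Qed.

Lemma vr_prod_XsubC (r : seq F) : (forall x, x \in r -> x != 0 /\ (O x /\ O x^-1)) ->
  let p := \prod_(x <- r) ('X - x%:P) in
  [/\ forall i, O p`_i, p`_0 != 0 & O (p`_0)^-1].
Proof.
elim: r => [|x r IHr] rO /=.
  rewrite big_nil coef1 eqxx oner_eq0 invr1; split=> //; last exact: vr1.
  by move=> i; rewrite coef1; case: eqP; [move=> _; apply: vr1|move=> _; apply: vr0].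
have [|p1 p2 p3] := IHr; first by move=> y yr; apply: rO; rewrite inE yr orbT.
have [|x0 [Ox OxV]] := rO x; first by rewrite inE eqxx.
rewrite big_cons; set p := (\prod_(y <- r) _) in p1 p2 p3 *.
have pE i : (('X - x%:P) * p)`_i = (if i is i'.+1 then p`_i' else 0) - x * p`_i.
  by rewrite mulrBl coefB coefXM coefCM; case: i.
rewrite !pE /= sub0r oppr_eq0 mulf_neq0 // invrN invfM; split=> //.
  by move=> [|i]; rewrite pE; apply: vrB; rewrite ?sub0r //; try exact: vr0; apply: vrM.
by apply/vrN/vrM.
Qed.

End ValuationRing.

Lemma min_poly_exists (E F : fieldType) (v : {rmorphism E -> F}) x : algebraicOver v x ->
  exists p : {poly E}, [/\ p \is monic, (1 < size p)%N &
    forall q, eval1 v x q = 0 <-> p %| q].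
Proof.
move=> [p0 p00 p0x].
have ex : exists n, `[< exists q : {poly E}, [/\ q != 0, eval1 v x q = 0 & size q = n] >].
  by exists (size p0); apply/asboolP; exists p0; split=> //; apply/rootP.
case: (ex_minnP ex) => n /asboolP[p [pn0 px <-]] min_p {ex n p0 p00 p0x}.
have pP q : eval1 v x q = 0 <-> p %| q.
  split=> [qx|/dvdpP[r ->]]; last by rewrite rmorphM /= px mulr0.
  apply: contraT => npq; have /min_p : `[< exists r : {poly E},
      [/\ r != 0, eval1 v x r = 0 & size r = size (q %% p)] >].
    apply/asboolP; exists (q %% p); split=> //.
    by move: qx; rewrite {1}(divp_eq q p) rmorphD rmorphM /= px mulr0 add0r.
  by rewrite leqNgt ltn_modp pn0.
have l0 : (lead_coef p)^-1 != 0 by rewrite invr_eq0 lead_coef_eq0.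
exists ((lead_coef p)^-1 *: p); split.
- by rewrite monicE lead_coefZ mulVf // lead_coef_eq0.
- rewrite size_scale // ltnNge; apply/negP => /size1_polyC pE.
  move: px pn0; rewrite pE eval1C => /eqP; rewrite fmorph_eq0 => /eqP->.
  by rewrite polyC0 eqxx.
- by move=> q; rewrite pP dvdpZl.
Qed.

(** Bezout: a common factor d of p and q is non-zero at x, so the cofactor of d in p vanishes at x
    and is divisible by p; thus d is constant. The inverse u is a polynomial modulo p, so it inverts
    q at all roots of p simultaneously. *)
Lemma eval1_inv (E F : fieldType) (v : {rmorphism E -> F}) x (p : {poly E}) :
  p != 0 -> (forall q, eval1 v x q = 0 <-> p %| q) ->
  forall q, eval1 v x q != 0 -> exists u, p %| u * q - 1.
Proof.
move=> p0 pP q qx; suff : coprimep p q.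
  move=> /Bezout_eq1_coprimepP[[a b] /= ab]; exists b.
  by rewrite -ab opprD addrCA subrr addr0 -mulNr dvdp_mull.
have /dvdpP[r rE] := dvdp_gcdl p q; have /dvdpP[r' r'E] := dvdp_gcdr p q.
set d := gcdp p q in rE r'E.
have dx : eval1 v x d != 0.
  by apply: contraNneq qx => dx; rewrite r'E rmorphM /= dx mulr0.
have : eval1 v x p = 0 by apply/pP.
rewrite {1}rE rmorphM => /eqP; rewrite mulf_eq0 (negPf dx) orbF => /eqP/pP pr.
have /andP[r0 d0] : (r != 0) && (d != 0) by rewrite -negb_or -mulf_eq0 -rE.
have sp : size p = (size r + size d).-1 by rewrite {1}rE size_mul.
have := dvdp_leq r0 pr; rewrite sp /coprimep -/d.
move: r0 d0; rewrite -!size_poly_eq0; case: (size r) (size d) => [|n] [|[|m]] // _ _.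
by rewrite addSn /= !addnS ltnS ltnNge leq_addr.
Qed.

(* O1 and O2 are compared on the images of an algebraic extension of E, presented
   by e1 and e2. If e1 q were outside O1, then O2 would be everything by the
   Archimedean property of O1, hence so would the trace of O1 on E, over which
   e1 q is integral. *)
Lemma comparable_eq (E F : fieldType) (e1 e2 : {rmorphism {poly E} -> F}) (O1 O2 : set F) :
    valuation_ring O1 -> valuation_ring O2 -> archimedean_val O1 ->
    (forall q, e1 q != 0 -> exists u, e1 (u * q) = 1 /\ e2 (u * q) = 1) ->
    (forall c, O1 (e1 c%:P) <-> O2 (e2 c%:P)) ->
    (forall q, exists2 p : {poly E}, p \is monic &
       root (map_poly (e1 \o polyC) p) (e1 q)) ->
  (forall q, O1 (e1 q) -> O2 (e2 q)) -> forall q, O2 (e2 q) -> O1 (e1 q).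
Proof.
move=> v1 v2 a1 inv12 cst alg1 le12 q O2q; apply: contrapT => O1q.
have [u [u1 u2]] := inv12 q (vr_neq0 v1 O1q).
have all2 g : O2 (e2 g).
  have [N O1g] := a1 _ (e1 g) O1q.
  have : O2 (e2 (g * u ^+ N)).
    apply: le12; rewrite rmorphM rmorphXn.
    suff -> : e1 u = (e1 q)^-1 by rewrite exprVn.
    by apply: (mulIf (vr_neq0 v1 O1q)); rewrite mulVf ?(vr_neq0 v1) -?u1 ?rmorphM.
  move=> /(vrM v2)/(_ (vrX v2 N O2q)); rewrite -rmorphXn -rmorphM -mulrA -exprMn.
  by rewrite rmorphM rmorphXn /= u2 expr1n mulr1.
have [p pm pq] := alg1 q; apply: O1q; apply: (vr_integral v1 _ _ pq).
  exact: monic_map.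
by move=> i; rewrite coef_map; apply/cst/all2.
Qed.

Lemma eventually_all (T : eqType) (r : seq T) (P : T -> nat -> Prop) :
  (forall x, x \in r -> exists N, forall s, (N <= s)%N -> P x s) ->
  exists N, forall s, (N <= s)%N -> forall x, x \in r -> P x s.
Proof.
elim: r => [|x r IHr] rP; first by exists 0%N.
have [|N NP] := IHr; first by move=> y yr; apply: rP; rewrite inE yr orbT.
have [|M MP] := rP x; first by rewrite inE eqxx.
exists (maxn N M) => s; rewrite geq_max => /andP[Ns Ms] y.
by rewrite inE => /orP[/eqP->|/NP]; [apply: MP|apply].
Qed.

(* If no conjugate y of x suits, then x differs from each of them by an element
   that is in the maximal ideal of O1 at x but outside O2 at y. Combining these, some
   z is in the maximal ideal of O1 at x and outside O2 at all conjugates, so that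
   z / (1 + z) is in the maximal ideal at x and has a characteristic polynomial
   with integral coefficients and unit constant term. *)
Lemma extend_alg (F : closedFieldType) (E : fieldType) (v1 v2 : {rmorphism E -> F})
    (O1 O2 : set F) x :
    valuation_ring O1 -> valuation_ring O2 -> archimedean_val O1 -> archimedean_val O2 ->
    (forall e, O1 (v1 e) <-> O2 (v2 e)) -> algebraicOver v1 x ->
  exists y, [/\ algebraicOver v2 y, forall q, eval1 v1 x q = 0 <-> eval1 v2 y q = 0 &
    forall q, O1 (eval1 v1 x q) <-> O2 (eval1 v2 y q)].
Proof.
move=> V1 V2 A1 A2 O12 xalg.
have [p [pm p1 pP]] := min_poly_exists xalg.
have p0 := monic_neq0 pm.
have invx := eval1_inv p0 pP.
have [r rE] := closed_field_poly_normal (map_poly v2 p).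
have rP y : (y \in r) = root (map_poly v2 p) y.
  by rewrite rE rootZ ?root_prod_XsubC // lead_coef_eq0 map_poly_eq0.
have yP y : y \in r -> forall q, eval1 v2 y q = 0 <-> p %| q.
  rewrite rP => /rootP py q; split=> [qy|/dvdpP[u ->]]; last first.
    by rewrite rmorphM /= [eval1 v2 y p]py mulr0.
  apply/pP/eqP; apply: contraT => /invx[u /dvdpP[w uw]].
  have /eqP : eval1 v2 y (u * q - 1) = 0 by rewrite uw rmorphM /= [eval1 v2 y p]py mulr0.
  by rewrite rmorphB rmorphM /= qy mulr0 sub0r rmorph1 oppr_eq0 oner_eq0.
have [[y yr yO]|noy] := pselect (exists2 y, y \in r &
    forall q, O1 (eval1 v1 x q) <-> O2 (eval1 v2 y q)).
  exists y; split=> // [|q]; last by rewrite pP yP.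
  by exists p => //; rewrite -rP.
have inv y : y \in r -> forall q, eval1 v1 x q != 0 ->
    exists u, eval1 v1 x (u * q) = 1 /\ eval1 v2 y (u * q) = 1.
  move=> yr q /invx[u pu]; exists u; split; apply/eqP; rewrite -subr_eq0.
    by have /pP := pu; rewrite rmorphB rmorph1 => ->.
  by have /(yP _ yr _) := pu; rewrite rmorphB rmorph1 => ->.
have eq0 y : y \in r -> forall q, (eval1 v2 y q == 0) = (eval1 v1 x q == 0).
  move=> yr q; apply/eqP/eqP => h.
    by apply: (pP q).2; apply: (yP y yr q).1.
  by apply: (yP y yr q).2; apply: (pP q).1.
have cstE (v : {rmorphism E -> F}) a : eval1 v a \o polyC =1 v by move=> c; exact: eval1C.
have alg (v : {rmorphism E -> F}) a : root (map_poly v p) a -> forall q,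
    exists2 m : {poly E}, m \is monic & root (map_poly (eval1 v a \o polyC) m) (eval1 v a q).
  move=> pa q; have [m mm mP] := poly_image q pm p1.
  exists m => //; have [/(_ a pa) + _] := mP F v.
  by rewrite (eq_map_poly (cstE v a)).
have px : root (map_poly v1 p) x by apply/rootP/pP.
have sep y : y \in r -> exists c, vmax O1 (eval1 v1 x c) /\ ~ O2 (eval1 v2 y c).
  move=> yr; have [a [O1a O2a]] : exists a, O1 (eval1 v1 x a) /\ ~ O2 (eval1 v2 y a).
    apply: contrapT => na; apply: noy; exists y => // q.
    have le12 a : O1 (eval1 v1 x a) -> O2 (eval1 v2 y a).
      by move=> O1a; apply: contrapT => O2a; apply: na; exists a.
    split; first exact: le12.
    apply: (comparable_eq V1 V2 A1 (inv y yr) _ (alg _ _ px) le12).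
    by move=> c /=; rewrite !eval1C.
  have [b [O1b O2b]] : exists b, ~ O1 (eval1 v1 x b) /\ O2 (eval1 v2 y b).
    apply: contrapT => nb; apply: noy; exists y => // q.
    have le21 b : O2 (eval1 v2 y b) -> O1 (eval1 v1 x b).
      by move=> O2b; apply: contrapT => O1b; apply: nb; exists b.
    split; last exact: le21.
    have inv' g : eval1 v2 y g != 0 ->
        exists u, eval1 v2 y (u * g) = 1 /\ eval1 v1 x (u * g) = 1.
      by rewrite eq0 // => /(inv y yr)[u [u1 u2]]; exists u.
    have cst' c : O2 (eval1 v2 y c%:P) <-> O1 (eval1 v1 x c%:P).
      by rewrite !eval1C; apply: iff_sym.
    by apply: (comparable_eq V2 V1 A2 inv' cst' (alg _ _ _) le21); rewrite -rP.
  have bx0 := vr_neq0 V1 O1b; have [u [u1 u2]] := inv y yr b bx0.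
  exists (a * u); split.
    rewrite rmorphM /=; apply: vmaxM => //.
    have -> : eval1 v1 x u = (eval1 v1 x b)^-1; last exact: vmaxV.
    by apply: (mulIf bx0); rewrite mulVf // -rmorphM.
  apply: contra_not O2a => /(vrM V2)/(_ O2b).
  by rewrite -rmorphM -mulrA rmorphM /= u2 mulr1.
have [z [z1 z2]] : exists z, vmax O1 (eval1 v1 x z) /\
    forall y, y \in r -> ~ O2 (eval1 v2 y z).
  suff : forall l : seq F, {subset l <= r} -> exists z, vmax O1 (eval1 v1 x z) /\
    forall y, y \in l -> ~ O2 (eval1 v2 y z) by apply.
  elim=> [|y l IHl] lr; first by exists 0; split=> //; rewrite rmorph0; left.
  have [|z [z1 z2]] := IHl; first by move=> a al; apply: lr; rewrite inE al orbT.
  have [|c [c1 c2]] := sep y; first by apply: lr; rewrite inE eqxx.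
  (* The element c contributes a pole at y. For every sufficiently large exponent its power cancels
     no pole of z, at y or at the conjugates treated before. *)
  have [a|N NP] := @eventually_all F (y :: l)
    (fun a s => ~ O2 (eval1 v2 a z + eval1 v2 a c ^+ s)).
    rewrite inE => al; apply: (arch_large V2 A2).
    by case/orP: al => [/eqP->|/z2]; [right|left].
  exists (z + c ^+ N.+1); split.
    rewrite rmorphD rmorphXn exprS; apply: vmaxD => //; rewrite mulrC.
    by apply: vmaxM => //; apply: vrX => //; apply: vmaxW.
  by move=> a /(NP N.+1 (leqnSn N)); rewrite rmorphD rmorphXn.
have [z0 Oz OzV] := vmax1D V1 z1.
have [u pu] : exists u, p %| u * (1 + z) - 1 by apply: invx; rewrite rmorphD rmorph1.
have [q qm qP] := poly_image (z * u) pm p1.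
have [/(_ _ px) qx _] := qP F v1; have [_ qy] := qP F v2.
have ux : eval1 v1 x u = (1 + eval1 v1 x z)^-1.
  apply: (mulIf z0); rewrite mulVf // -(rmorph1 (eval1 v1 x)) -rmorphD -rmorphM.
  by apply/eqP; rewrite -subr_eq0 -rmorphB; apply/eqP/pP.
have ax : vmax O1 (eval1 v1 x (z * u)) by rewrite rmorphM /= ux mulrC; apply: vmaxM.
have ay y : y \in r -> let a := eval1 v2 y (z * u) in a != 0 /\ (O2 a /\ O2 a^-1).
  move=> yr a; have zy := z2 y yr; have zy0 := vr_neq0 V2 zy.
  have [w0 Ow OwV] := vmax1D V2 (vmaxV zy).
  suff -> : a = (1 + (eval1 v2 y z)^-1)^-1 by rewrite invr_eq0 invrK.
  have : eval1 v2 y (u * (1 + z) - 1) = 0 by apply/(yP _ yr _).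
  rewrite rmorphB rmorphM rmorphD rmorph1 => /eqP; rewrite subr_eq0 => /eqP uz.
  apply: (mulIf w0); rewrite mulVf // /a rmorphM /= mulrAC mulrDr mulr1 divff //.
  by rewrite addrC mulrC.
have [s sE] := closed_field_poly_normal (map_poly v2 q).
rewrite (eqP (monic_map v2 qm)) scale1r in sE.
have [] := vr_prod_XsubC V2 (r := s).
  move=> a as_; have : root (map_poly v2 q) a by rewrite sE root_prod_XsubC.
  by move=> /qy[y py ->]; apply: ay; rewrite rP.
rewrite -sE => O2q; rewrite coef_map fmorph_eq0 => q0 O2q0.
have {}O2q i : O1 (v1 q`_i) by apply/O12; rewrite -coef_map.
have {}O2q0 : O1 (v1 q`_0)^-1 by rewrite -fmorphV; apply/O12; rewrite fmorphV.
(* The constant term is a unit by its computation at O2. At O1 the equation q(a) = 0, with a in the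
   maximal ideal, makes it minus a multiple of a. *)
case: (@vmax_unit _ O1 (v1 q`_0)); rewrite ?fmorph_eq0 //.
move/rootP: qx; rewrite -[map_poly v1 q](poly_take_drop 1) hornerD hornerM expr1 hornerX.
rewrite [take_poly 1 _](_ : _ = (v1 q`_0)%:P); last first.
  by apply/polyP => -[|i]; rewrite coef_take_poly coefC coef_map.
rewrite hornerC => /eqP; rewrite addr_eq0 => /eqP ->.
apply: vmaxN => //; apply: vmaxM => //; apply: vr_horner => //; last exact: vmaxW.
by move=> i; rewrite coef_drop_poly coef_map; apply: O2q.
Qed.

(** * Extension of partial isomorphisms *)

Section MakeRMorphism.
Variables (R S : nzRingType) (f : R -> S).
Hypotheses (fB : zmod_morphism f) (fM : monoid_morphism f).

Definition rmorphism_fun : R -> S := let _ := fB in let _ := fM in f.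
HB.instance Definition _ := GRing.isZmodMorphism.Build R S rmorphism_fun fB.
HB.instance Definition _ := GRing.isMonoidMorphism.Build R S rmorphism_fun fM.

Lemma rmorphism_exists : exists g : {rmorphism R -> S}, g =1 f.
Proof. by exists rmorphism_fun. Qed.

End MakeRMorphism.

Lemma eval1_in (E F : fieldType) (v : {rmorphism E -> F}) (S : set F) x q :
  divring_closed [in S] -> (forall e, S (v e)) -> S x -> S (eval1 v x q).
Proof.
move=> /subfield_type[E' [v' <-]] vS [x' _ <-].
have /choice[f fP] e : exists e', v' e' = v e by have [e' _ ?] := vS e; exists e'.
exists (\sum_(i < size q) f q`_i * x' ^+ i) => //.
rewrite rmorph_sum eval1E horner_coef size_map_poly; apply: eq_bigr => i _.
by rewrite rmorphM rmorphXn coef_map /= fP.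
Qed.

Section AclMorphism.
Variables (k E F : fieldType) (j : k -> E) (i : k -> F) (v : {rmorphism E -> F}).
Hypothesis vj : forall a, v (j a) = i a.

Lemma field_gen_morph D : field_gen i (v @` D) = v @` field_gen j D.
Proof.
apply/seteqP; split.
  have [E' [v' vE']] := field_gen_type j D.
  apply: field_gen_min.
  - by rewrite -vE' image_comp; exact: (range_divring (v \o v')).
  - by move=> _ [a _ <-]; exists (j a) => //; apply: field_gen_base.
  - by move=> _ [d Dd <-]; exists d => //; apply: sub_field_gen.
move=> _ [e + <-]; move: e.
suff : field_gen j D `<=` v @^-1` field_gen i (v @` D) by [].
apply: field_gen_min.
- have /divring_closedP[f1 fB fV] := field_gen_closed i (v @` D).
  apply/divring_closedP; split=> [|x y|x y] /=; rewrite ?rmorph1 //.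
    by rewrite rmorphB; apply: fB.
  by rewrite fmorph_div; apply: fV.
- by move=> _ [a _ <-] /=; rewrite vj; apply: field_gen_base.
- by move=> d Dd; apply: sub_field_gen; exists d.
Qed.

Lemma acl_morph D e : acl i (v @` D) (v e) <-> acl j D e.
Proof.
have [E' [v' vE']] := field_gen_type j D.
have vvE' : range (v \o v' : {rmorphism E' -> F}) = field_gen i (v @` D).
  by rewrite field_gen_morph -vE' image_comp.
rewrite (aclP _ vE') (aclP _ vvE'); split=> -[p p0 px]; exists p => //.
  by move: px; rewrite map_poly_comp fmorph_root.
by rewrite map_poly_comp fmorph_root.
Qed.

Lemma indep_morph D s : indep i (v @` D) (map v s) <-> indep j D s.
Proof.
elim: s D => //= a s IHs D; rewrite acl_morph -IHs.
suff -> : v @` (D `|` [set a]) = v @` D `|` [set v a] by [].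
by rewrite image_setU image_set1.
Qed.

End AclMorphism.

Section PartialIso.
Variables (k : fieldType) (F : closedFieldType) (iota : {rmorphism k -> F}).
Implicit Types (O : set F) (G : set (F * F)).

Definition graph_field G := [/\ G (1, 1),
  forall x x' y y', G (x, x') -> G (y, y') -> G (x - y, x' - y') &
  forall x x' y y', G (x, x') -> G (y, y') -> G (x / y, x' / y')].

(* A k-isomorphism between two subfields of F, given by its graph, under which
   O1 and O2 correspond. *)
Definition piso O1 O2 G := [/\ graph_field G, forall a, G (iota a, iota a),
  forall x x', G (x, x') -> x = 0 <-> x' = 0 & forall x x', G (x, x') -> O1 x <-> O2 x'].

Definition graph_of (E : fieldType) (v1 v2 : {rmorphism E -> F}) : set (F * F) :=
  range (fun e => (v1 e, v2 e)).

Lemma piso_fun O1 O2 G x y y' : piso O1 O2 G -> G (x, y) -> G (x, y') -> y = y'.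
Proof.
move=> [[_ GB _] _ G0 _] xy xy'; have := GB _ _ _ _ xy xy'; rewrite subrr => /G0[/(_ erefl)].
by move/eqP; rewrite subr_eq0 => /eqP.
Qed.

Lemma graph_fieldM G x x' y y' : graph_field G -> G (x, x') -> G (y, y') ->
  G (x * y, x' * y').
Proof.
move=> [G1 _ GV] xG yG; rewrite -(invrK y) -(invrK y') -(div1r y) -(div1r y').
by apply: (GV) => //; apply: GV.
Qed.

Lemma graph_of_field (E : fieldType) (v1 v2 : {rmorphism E -> F}) : graph_field (graph_of v1 v2).
Proof.
split; first by exists 1; rewrite ?rmorph1.
  by move=> _ _ _ _ [e _ [<- <-]] [f _ [<- <-]]; exists (e - f); rewrite ?rmorphB.
by move=> _ _ _ _ [e _ [<- <-]] [f _ [<- <-]]; exists (e / f); rewrite ?fmorph_div.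
Qed.

(** Graphs suit Zorn's lemma, since unions of chains are again graphs; pairs of embeddings of one
    field E suit computations with polynomials. This passes from the first form to the second. *)
Lemma piso_type O1 O2 G : piso O1 O2 G ->
  exists (E : fieldType) (v1 v2 : {rmorphism E -> F}), G = graph_of v1 v2.
Proof.
move=> Giso; have [Gf Gk G0 GO] := Giso; have [G1 GB GV] := Gf.
have [|E [v1 v1E]] := @subfield_type F (fst @` G).
  apply/divring_closedP; split; first by exists (1, 1).
    by move=> _ _ [[x x'] xG <-] [[y y'] yG <-]; exists (x - y, x' - y'); rewrite //; apply: GB.
  by move=> _ _ [[x x'] xG <-] [[y y'] yG <-]; exists (x / y, x' / y'); rewrite //; apply: GV.
have /choice[f fP] e : exists y, G (v1 e, y).
  have [[x y] xyG] : (fst @` G) (v1 e) by rewrite -v1E; exists e.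
  by move=> /= <-; exists y.
have [||v2 v2E] := @rmorphism_exists E F f.
- move=> x y; apply: (piso_fun Giso (fP _)); rewrite rmorphB; exact: GB.
- split=> [|x y]; first by apply: (piso_fun Giso (fP _)); rewrite rmorph1.
  by apply: (piso_fun Giso (fP _)); rewrite rmorphM; apply: graph_fieldM.
exists E, v1, v2; apply/seteqP; split=> [[x y] xyG|_ [e _ <-]]; last by rewrite v2E.
have [e _ xE] : range v1 x by rewrite v1E; exists (x, y).
exists e => //; rewrite v2E -xE; congr (_, _).
by apply: (piso_fun Giso (fP e)); rewrite xE.
Qed.

Section Extend.
Variables (O1 O2 : set F) (G : set (F * F)) (E : fieldType) (v1 v2 : {rmorphism E -> F}).
Variables (x y : F).
Hypotheses (Giso : piso O1 O2 G) (GE : G = graph_of v1 v2).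
Hypothesis xy0 : forall q, eval1 v1 x q = 0 <-> eval1 v2 y q = 0.
Hypothesis xyO : forall a b, eval1 v1 x b != 0 ->
  O1 (eval1 v1 x a / eval1 v1 x b) <-> O2 (eval1 v2 y a / eval1 v2 y b).

Definition graph_ext : set (F * F) := [set z | exists a b, eval1 v1 x b != 0 /\
  z = (eval1 v1 x a / eval1 v1 x b, eval1 v2 y a / eval1 v2 y b)].

Let ev0 q : (eval1 v2 y q == 0) = (eval1 v1 x q == 0).
Proof. by apply/eqP/eqP => /xy0. Qed.

Lemma sub_graph_ext : G `<=` graph_ext.
Proof.
rewrite GE => _ [e _ <-]; exists e%:P, 1; rewrite !eval1C !rmorph1 !divr1.
by rewrite oner_neq0.
Qed.

Lemma mem_graph_ext : graph_ext (x, y).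
Proof. by exists 'X, 1; rewrite !eval1X !rmorph1 !divr1 oner_neq0. Qed.

Lemma piso_graph_ext : piso O1 O2 graph_ext.
Proof.
have [_ Gk _ _] := Giso; split.
- split; first by apply/sub_graph_ext; have [[]] := Giso.
  + move=> _ _ _ _ [a [b [b0 [-> ->]]]] [c [d [d0 [-> ->]]]].
    exists (a * d - c * b), (b * d).
    rewrite !rmorphB !rmorphM /= mulf_neq0 //; split=> //.
    by rewrite -!mulNr !addf_div ?ev0 // !mulNr.
  + move=> _ _ _ _ [a [b [b0 [-> ->]]]] [c [d [d0 [-> ->]]]].
    have [c0|c0] := eqVneq (eval1 v1 x c) 0.
      have -> : eval1 v2 y c = 0 by apply/xy0.
      exists 0, 1; rewrite !rmorph1 !rmorph0 oner_neq0 c0.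
      by rewrite !(mul0r, invr0, mulr0).
    exists (a * d), (b * c); rewrite !rmorphM /= mulf_neq0 //; split=> //.
    by rewrite !invf_div !mulf_div.
- by move=> a; apply/sub_graph_ext.
- move=> _ _ [a [b [b0 [-> ->]]]]; split=> /eqP.
    rewrite mulf_eq0 invr_eq0 (negPf b0) orbF => /eqP/xy0 ->.
    by rewrite mul0r.
  by rewrite mulf_eq0 invr_eq0 !ev0 (negPf b0) orbF => /eqP ->; rewrite mul0r.
- by move=> _ _ [a [b [b0 [-> ->]]]]; apply: xyO.
Qed.

Lemma graph_ext_fst (S : set F) : divring_closed [in S] -> (forall z, G z -> S z.1) -> S x ->
  forall z, graph_ext z -> S z.1.
Proof.
move=> Sf GS Sx _ [a [b [_ ->]]] /=; have /divring_closedP[_ _ SV] := Sf.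
by apply: SV; apply: eval1_in => // e; apply: (GS (v1 e, v2 e)); rewrite GE; exists e.
Qed.

Lemma graph_ext_snd (S : set F) : divring_closed [in S] -> (forall z, G z -> S z.2) -> S y ->
  forall z, graph_ext z -> S z.2.
Proof.
move=> Sf GS Sx _ [a [b [_ ->]]] /=; have /divring_closedP[_ _ SV] := Sf.
by apply: SV; apply: eval1_in => // e; apply: (GS (v1 e, v2 e)); rewrite GE; exists e.
Qed.

End Extend.

Definition swap_graph G : set (F * F) := [set z | G (z.2, z.1)].

Lemma piso_swap O1 O2 G : piso O1 O2 G -> piso O2 O1 (swap_graph G).
Proof.
move=> [[G1 GB GV] Gk G0 GO]; split=> //.
- by split=> // x x' y y'; [apply: GB|apply: GV].
- by move=> x x' h; apply: iff_sym; exact: G0 h.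
- by move=> x x' h; apply: iff_sym; exact: GO h.
Qed.

(** Zorn's lemma is applied to the sets A with [G0] joined to A a partial isomorphism; joining [G0]
    takes care of the empty chain. The bound S allows domain and codomain to be confined to a given
    subfield. *)
Lemma piso_max O1 O2 (S G0 : set (F * F)) : piso O1 O2 G0 -> G0 `<=` S ->
  exists G, [/\ piso O1 O2 G, G0 `<=` G, G `<=` S &
    forall G', piso O1 O2 G' -> G `<=` G' -> G' `<=` S -> G' `<=` G].
Proof.
move=> G0iso G0S.
have [|A [[Aiso AS] Amax]] := @Zorn_bigcup _ (fun A => piso O1 O2 (G0 `|` A) /\ A `<=` S).
  move=> C CP Ctot; split; last by move=> z [A /CP[_ AS] /AS].
  have [CA|CA] := pselect (exists A, C A); last first.
    suff -> : \bigcup_(X in C) X = set0 by rewrite setU0.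
    by apply/seteqP; split=> // z [A cA]; case: CA; exists A.
  have UE z : (G0 `|` \bigcup_(X in C) X) z -> exists2 A, C A & (G0 `|` A) z.
    case=> [zG|[A cA Az]]; last by exists A => //; right.
    by have [A cA] := CA; exists A => //; left.
  have U2 z z' : (G0 `|` \bigcup_(X in C) X) z -> (G0 `|` \bigcup_(X in C) X) z' ->
      exists A, [/\ C A, (G0 `|` A) z & (G0 `|` A) z'].
    move=> /UE[A cA Az] /UE[B cB Bz].
    have [AB|BA] := Ctot A B cA cB; [exists B|exists A]; split=> //.
      by case: Az => [|/AB]; [left|right].
    by case: Bz => [|/BA]; [left|right].
  have sub A : C A -> G0 `|` A `<=` G0 `|` \bigcup_(X in C) X.
    by move=> cA z [|Az]; [left|right; exists A].
  have [[G01 _ _] G0k _ _] := G0iso; split.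
  - split; first by left.
      move=> x x' y y' /U2 h /h[A [cA xA yA]]; have [[[_ AB _] _ _ _] _] := CP A cA.
      by apply: (sub A cA); apply: AB.
    move=> x x' y y' /U2 h /h[A [cA xA yA]]; have [[[_ _ AV] _ _ _] _] := CP A cA.
    by apply: (sub A cA); apply: AV.
  - by move=> a; left.
  - by move=> x x' /UE[A cA]; have [[_ _ + _] _] := CP A cA; apply.
  - by move=> x x' /UE[A cA]; have [[_ _ _ +] _] := CP A cA; apply.
exists (G0 `|` A); split=> //.
- by move=> z [/G0S|/AS].
move=> G' G'iso AG' G'S z zG'; apply: contrapT => zA.
apply: (Amax G'); last first.
  split=> //; suff -> : G0 `|` G' = G' by [].
  by apply/seteqP; split=> [y [yG|//]|y]; [apply: AG'; left|right].
by split; [move=> y Ay; apply: AG'; right|move=> /(_ _ zG') Az; apply: zA; right].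
Qed.

(** The last two clauses say that the extension stays in every field containing the old domain and
    x, or the old codomain and y. They are what contradicts maximality under a bound. *)
Lemma piso_step_alg O1 O2 G x : valuation_ring O1 -> valuation_ring O2 ->
  archimedean_val O1 -> archimedean_val O2 -> piso O1 O2 G ->
  algebraic_over (fst @` G) x ->
  exists y G', [/\ algebraic_over (snd @` G) y, piso O1 O2 G', G `<=` G', G' (x, y) &
    (forall S : set F, divring_closed [in S] -> (forall z, G z -> S z.1) -> S x ->
       forall z, G' z -> S z.1) /\
    (forall S : set F, divring_closed [in S] -> (forall z, G z -> S z.2) -> S y ->
       forall z, G' z -> S z.2)].
Proof.
move=> V1 V2 A1 A2 Giso xalg; have [E [v1 [v2 GE]]] := piso_type Giso.
have G1 : fst @` G = range v1.
  by rewrite GE /graph_of image_comp.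
have G2 : snd @` G = range v2.
  by rewrite GE /graph_of image_comp.
have v12 e : O1 (v1 e) <-> O2 (v2 e).
  by have [_ _ _ GO] := Giso; apply: GO; rewrite GE; exists e.
rewrite G1 in xalg; move/algebraic_rangeP: xalg => xalg.
have [y [yalg xy0 xyO]] := extend_alg V1 V2 A1 A2 v12 xalg.
(* As x is algebraic, 1/b(x) is the value of a polynomial u, and the same u inverts b at y;
   fractions thus reduce to polynomials. *)
have xyO' a b : eval1 v1 x b != 0 ->
    O1 (eval1 v1 x a / eval1 v1 x b) <-> O2 (eval1 v2 y a / eval1 v2 y b).
  have [p [pm p1 pP]] := min_poly_exists xalg => bx.
  have [u pu] := eval1_inv (monic_neq0 pm) pP bx.
  have ux : eval1 v1 x u * eval1 v1 x b = 1.
    rewrite -rmorphM -(rmorph1 (eval1 v1 x)); apply/eqP; rewrite -subr_eq0 -rmorphB.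
    exact/eqP/pP.
  have uy : eval1 v2 y u * eval1 v2 y b = 1.
    rewrite -rmorphM -(rmorph1 (eval1 v2 y)); apply/eqP; rewrite -subr_eq0 -rmorphB.
    by apply/eqP/xy0/pP.
  have inv_eq (s t : F) : s * t = 1 -> t^-1 = s.
    move=> st; have t0 : t != 0.
      by apply: contra_eq_neq st => ->; rewrite mulr0 eq_sym oner_neq0.
    by apply: (mulIf t0); rewrite mulVf.
  by rewrite (inv_eq _ _ ux) (inv_eq _ _ uy) -!rmorphM; apply: xyO.
exists y, (graph_ext v1 v2 x y); split.
- by rewrite G2; apply/algebraic_rangeP.
- exact: piso_graph_ext Giso GE xy0 xyO'.
- exact: sub_graph_ext.
- exact: mem_graph_ext.
- by split=> S Sf GS Sx; [apply: (graph_ext_fst GE Sf GS Sx)|apply: (graph_ext_snd GE Sf GS Sx)].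
Qed.

(** For trivial valuations only the vanishing of polynomials has to match, and by transcendence only
    the zero polynomial vanishes on either side. *)
Lemma piso_step_transc G x y : piso setT setT G ->
  ~ algebraic_over (fst @` G) x -> ~ algebraic_over (snd @` G) y ->
  exists G', [/\ piso setT setT G', G `<=` G', G' (x, y) &
    (forall S : set F, divring_closed [in S] -> (forall z, G z -> S z.1) -> S x ->
       forall z, G' z -> S z.1) /\
    (forall S : set F, divring_closed [in S] -> (forall z, G z -> S z.2) -> S y ->
       forall z, G' z -> S z.2)].
Proof.
move=> Giso xalg yalg; have [E [v1 [v2 GE]]] := piso_type Giso.
have G1 : fst @` G = range v1 by rewrite GE /graph_of image_comp.
have G2 : snd @` G = range v2 by rewrite GE /graph_of image_comp.
have transc (v : {rmorphism E -> F}) z q : ~ algebraic_over (range v) z ->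
    eval1 v z q = 0 -> q = 0.
  move=> zalg zq; apply/eqP; apply: contra_notT zalg => q0; apply/algebraic_rangeP.
  by exists q => //; apply/rootP.
rewrite G1 in xalg; rewrite G2 in yalg.
have xy0 q : eval1 v1 x q = 0 <-> eval1 v2 y q = 0.
  by split=> /transc -> //; rewrite rmorph0.
exists (graph_ext v1 v2 x y); split.
- exact: piso_graph_ext Giso GE xy0 _.
- exact: sub_graph_ext.
- exact: mem_graph_ext.
- by split=> S Sf GS Sx; [apply: (graph_ext_fst GE Sf GS Sx)|apply: (graph_ext_snd GE Sf GS Sx)].
Qed.

End PartialIso.

Lemma preimage_seq (A B : eqType) (f : A -> B) (s : seq B) : [set` s] `<=` range f ->
  exists t, s = map f t.
Proof.
elim: s => [|b s IHs] sf; first by exists [::].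
have [|a _ ab] := sf b; first by rewrite /= inE eqxx.
have [|t ->] := IHs; first by move=> c cs; apply: sf; rewrite /= inE cs orbT.
by exists (a :: t); rewrite /= ab.
Qed.

Section ExtendIso.
Variables (k : fieldType) (F : closedFieldType) (iota : {rmorphism k -> F}).
Implicit Types (O : set F) (G : set (F * F)).
Notation acl := (acl iota).
Notation indep := (indep iota).
Notation piso := (piso iota).

(** The trivial valuation: extending plain isomorphisms becomes an instance of extending valued
    ones. *)
Lemma valuation_ringT : valuation_ring [set: F].
Proof. by split=> [|x _]; [split=> *; rewrite ?inE|left]. Qed.

Lemma archimedean_valT : archimedean_val [set: F].
Proof. by move=> x y []. Qed.

Lemma piso_aut O1 O2 G : piso O1 O2 G -> (forall x, exists y, G (x, y)) ->
  (forall y, exists x, G (x, y)) ->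
  exists2 s : autgroup iota, (forall x y, G (x, y) -> s x = y) & forall x, O1 x <-> O2 (s x).
Proof.
move=> Giso /choice[f fP] /choice[g gP]; have [[G1 GB GV] Gk G0 GO] := Giso.
have fE x y : G (x, y) -> f x = y by apply: piso_fun Giso (fP x).
have gE x y : G (x, y) -> g y = x.
  by apply: (piso_fun (piso_swap Giso) (_ : swap_graph _ (y, g y))); apply: gP.
have faut : is_aut iota f.
  split.
  - by move=> x y; apply/fE/GB.
  - by split=> [|x y]; apply/fE => //; apply: graph_fieldM.
  - by exists g => [x|y]; [apply: gE|apply: fE].
  - by move=> a; apply: fE.
by exists (mk_aut faut) => // x; apply: GO; apply: fP.
Qed.

Lemma piso_extend_aut O1 O2 G0 : valuation_ring O1 -> valuation_ring O2 ->
    archimedean_val O1 -> archimedean_val O2 -> piso O1 O2 G0 ->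
    (forall x, algebraic_over (fst @` G0) x) -> (forall x, algebraic_over (snd @` G0) x) ->
  exists2 s : autgroup iota, (forall x y, G0 (x, y) -> s x = y) & forall x, O1 x <-> O2 (s x).
Proof.
move=> V1 V2 A1 A2 G0iso alg1 alg2.
have [G [Giso G0G _ Gmax]] := piso_max G0iso (@subsetT _ G0).
have [||s sG sO] := piso_aut Giso; last by exists s => // x y /G0G; apply: sG.
- move=> x; have [|y [G' [_ G'iso GG' xy _]]] := piso_step_alg V1 V2 A1 A2 Giso (x := x).
    by apply: algebraic_over_sub (alg1 x) => _ [z /G0G zG <-]; exists z.
  by exists y; apply: Gmax xy.
- move=> y; have [|x [G' [_ G'iso GG' yx _]]] :=
      piso_step_alg V2 V1 A2 A1 (piso_swap Giso) (x := y).
    apply: algebraic_over_sub (alg2 y) => _ [z /G0G zG <-].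
    by exists (z.2, z.1); rewrite /swap_graph //=; case: z zG.
  exists x; apply: (Gmax (swap_graph G')) => //; first exact: piso_swap.
  by move=> [a b] abG; apply: (GG' (b, a)).
Qed.

Lemma piso_dom_divring O1 O2 G : piso O1 O2 G -> divring_closed [in fst @` G].
Proof.
move=> /piso_type[E [v1 [v2 ->]]]; rewrite image_comp; exact: range_divring.
Qed.

Lemma piso_cod_divring O1 O2 G : piso O1 O2 G -> divring_closed [in snd @` G].
Proof.
move=> /piso_type[E [v1 [v2 ->]]]; rewrite image_comp; exact: range_divring.
Qed.

Lemma indep_piso O1 O2 (E : fieldType) (v1 v2 : {rmorphism E -> F}) s :
  piso O1 O2 (graph_of v1 v2) -> indep set0 (map v1 s) -> indep set0 (map v2 s).
Proof.
move=> [_ Gk _ _].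
have /choice[j jP] a : exists e, v1 e = iota a /\ v2 e = iota a.
  by have [e _ [e1 e2]] := Gk a; exists e.
have j1 a := (jP a).1; have j2 a := (jP a).2.
by rewrite -{1}(image_set0 v1) -(image_set0 v2) (indep_morph j1) (indep_morph j2).
Qed.

Lemma acl_sub_divring D (S : set F) : divring_closed [in S] -> range iota `<=` S -> D `<=` S ->
  (forall x, algebraic_over S x -> S x) -> acl D `<=` S.
Proof.
move=> Sf kS DS Salg x ax; apply: Salg; apply: algebraic_over_sub ax.
exact: field_gen_min.
Qed.

(* A maximal k-isomorphism G between subfields of C = acl s has algebraically
   closed domain and codomain, one of which is C; by the exchange property a
   k-embedding of C into C is onto. *)
Lemma extend_finite (s : seq F) G0 : indep set0 s -> piso setT setT G0 ->
    G0 `<=` acl [set` s] `*` acl [set` s] ->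
  exists G, [/\ piso setT setT G, G0 `<=` G, fst @` G = acl [set` s] & snd @` G = acl [set` s]].
Proof.
set C := acl [set` s] => s_ind G0iso G0C.
have VT := valuation_ringT; have AT := archimedean_valT.
have [G [Giso G0G GC Gmax]] := piso_max G0iso G0C; exists G.
have Cf : divring_closed [in C] by apply: acl_closed.
have Calg (S : set F) x : S `<=` C -> algebraic_over S x -> C x.
  by move=> SC /(algebraic_over_sub SC); apply: algebraic_over_acl.
have GC1 z : G z -> C z.1 by move=> /GC[].
have GC2 z : G z -> C z.2 by move=> /GC[].
have GC1' : fst @` G `<=` C by move=> _ [z /GC1 ? <-].
have GC2' : snd @` G `<=` C by move=> _ [z /GC2 ? <-].
have dom_alg x : algebraic_over (fst @` G) x -> (fst @` G) x.
  move=> xalg; have Cx := Calg _ _ GC1' xalg.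
  have [y [G' [yalg G'iso GG' xyG' [G'1 G'2]]]] := piso_step_alg VT VT AT AT Giso xalg.
  have Cy := Calg _ _ GC2' yalg.
  by exists (x, y) => //; apply: (Gmax G') => // z zG'; split;
    [exact: (G'1 C Cf GC1 Cx z)|exact: (G'2 C Cf GC2 Cy z)].
have cod_alg y : algebraic_over (snd @` G) y -> (snd @` G) y.
  move=> yalg; have Cy := Calg _ _ GC2' yalg.
  have yalg' : algebraic_over (fst @` swap_graph G) y.
    by apply: algebraic_over_sub yalg => _ [[a b] abG <-]; exists (b, a).
  have [x [G' [xalg G'iso GG' yxG' [G'1 G'2]]]] :=
    piso_step_alg VT VT AT AT (piso_swap Giso) yalg'.
  have Cx : C x.
    by apply: Calg xalg => _ [z zG <-]; apply: (GC1 (z.2, z.1)).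
  exists (x, y) => //; apply: (Gmax (swap_graph G')) => //; first exact: piso_swap.
    by move=> [a b] abG; apply: (GG' (b, a)).
  move=> z zG'; split.
    by apply: (G'2 C Cf _ Cx (z.2, z.1) zG') => w wG; apply: (GC1 (w.2, w.1)).
  by apply: (G'1 C Cf _ Cy (z.2, z.1) zG') => w wG; apply: (GC2 (w.2, w.1)).
have [E [v1 [v2 GE]]] := piso_type Giso.
have G1 : fst @` G = range v1 by rewrite GE /graph_of image_comp.
have G2 : snd @` G = range v2 by rewrite GE /graph_of image_comp.
have onto (u1 u2 : {rmorphism E -> F}) : piso setT setT (graph_of u1 u2) ->
    range u1 = C -> range u2 `<=` C -> (forall y, algebraic_over (range u2) y -> range u2 y) ->
    range u2 = C.
  move=> uiso u1C u2C u2alg; apply/seteqP; split=> //.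
  have [es esE] : exists es, s = map u1 es.
    by apply: preimage_seq; rewrite u1C; apply: sub_acl.
  have es2 : [set` s] `<=` acl (set0 `|` [set` map u2 es]).
    have [||_ h] := @steinitz _ _ iota set0 (map u2 es) s.
    - by apply: indep_piso uiso _; rewrite -esE.
    - rewrite set0U => _ /mapP[e _ ->]; apply: u2C; exact: imageT.
    - by apply: h; rewrite esE !size_map.
  rewrite set0U in es2.
  apply: subset_trans (acl_sub es2) _; apply: acl_sub_divring => //.
  - exact: range_divring.
  - move=> _ [a _ <-]; have [_ /(_ a) + _ _] := uiso.
    by move=> [e _ [_ <-]]; exists e.
  - by move=> _ /mapP[e _ ->]; exists e.
suff [C1|C2] : fst @` G = C \/ snd @` G = C.
- split=> //; rewrite G2; apply: (onto v1); rewrite -?GE -?G1 -?G2 //.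
- split=> //; rewrite G1; apply: (onto v2); rewrite -?G1 -?G2 //.
  rewrite (_ : graph_of v2 v1 = swap_graph G); first exact: piso_swap.
  rewrite GE; apply/seteqP; split=> [_ [e _ <-]|[a b] [e _ [<- <-]]]; exists e => //.
(* If both sides were proper, a missing x could be sent to a missing y: domain and codomain are
   algebraically closed, so both are transcendental over them. This contradicts maximality. *)
apply: contrapT => noC.
have [x Cx xG] : exists2 x, C x & ~ (fst @` G) x.
  apply: contrapT => nx; apply: noC; left; apply/seteqP; split=> // x Cx.
  by apply: contrapT => xG; apply: nx; exists x.
have [y Cy yG] : exists2 y, C y & ~ (snd @` G) y.
  apply: contrapT => nx; apply: noC; right; apply/seteqP; split=> // x' Cx'.
  by apply: contrapT => xG'; apply: nx; exists x'.
have [||G' [G'iso GG' xyG' [G'1 G'2]]] := @piso_step_transc _ _ _ G x y Giso.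
- by move=> /dom_alg.
- by move=> /cod_alg.
apply: xG; exists (x, y) => //; apply: (Gmax G') => // z zG'; split.
  exact: (G'1 C Cf GC1 Cx z).
exact: (G'2 C Cf GC2 Cy z).
Qed.

Lemma adjoin_pairs (ps : seq (F * F)) D D' G : piso setT setT G ->
    G `<=` acl D `*` acl D' -> indep D (map fst ps) -> indep D' (map snd ps) ->
  exists G', [/\ piso setT setT G', G `<=` G', [set` ps] `<=` G' &
    G' `<=` acl (D `|` [set` map fst ps]) `*` acl (D' `|` [set` map snd ps])].
Proof.
elim: ps D D' G => [|[a b] ps IHps] D D' G Giso GD /=.
  move=> _ _; exists G; split=> //; apply: subset_trans GD _ => z [z1 z2].
  by split; [apply: acl_mono z1|apply: acl_mono z2] => x; left.
move=> [Da Dps] [Db D'ps].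
have [||G1 [G1iso GG1 abG1 [G11 G12]]] := @piso_step_transc _ _ _ G a b Giso.
- move=> h; apply: Da; apply: algebraic_over_acl; apply: algebraic_over_sub h.
  by move=> _ [z /GD[] ? _ <-].
- move=> h; apply: Db; apply: algebraic_over_acl; apply: algebraic_over_sub h.
  by move=> _ [z /GD[] _ ? <-].
have DDa X x : acl X `<=` acl (X `|` [set x]) by apply: acl_mono => y; left.
have Daa X x : acl (X `|` [set x]) x by apply: sub_acl; right.
have [|G' [G'iso G1G' psG' G'sub]] := IHps (D `|` [set a]) (D' `|` [set b]) G1 G1iso _ Dps D'ps.
  move=> z zG; split.
    by apply: (G11 _ (@acl_closed _ _ _ _) _ _ z zG) => // w wG; apply: DDa; case: (GD w wG).
  by apply: (G12 _ (@acl_closed _ _ _ _) _ _ z zG) => // w wG; apply: DDa; case: (GD w wG).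
exists G'; split=> //; first by move=> z /GG1/G1G'.
  by move=> z /=; rewrite inE => /orP[/eqP->|/psG'//]; apply: G1G'.
by rewrite !set_seq_cons !setUA.
Qed.

(** Once G is an automorphism of [acl s], the identity on R is compatible with it, because R is
    independent over s and hence over domain and codomain alike. The remaining extension is
    algebraic. *)
Lemma extend_aut (s : seq F) (R : set F) G0 : indep set0 s ->
    (forall r : seq F, uniq r -> {subset r <= R} -> indep [set` s] r) ->
    acl ([set` s] `|` R) = setT -> piso setT setT G0 ->
    G0 `<=` acl [set` s] `*` acl [set` s] ->
  exists t : autgroup iota, [/\ forall x y, G0 (x, y) -> t x = y,
    forall x, R x -> t x = x & t @` acl [set` s] = acl [set` s]].
Proof.
move=> s_ind R_ind sRT G0iso G0s.
have [G [Giso G0G G1 G2]] := extend_finite s_ind G0iso G0s.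
(* G' is generated by G and the diagonal of R. It is a partial isomorphism
   because any finite part of R is independent over s. *)
pose G' : set (F * F) := [set z | exists r : seq F, {subset r <= R} /\
  forall H, graph_field H -> G `<=` H -> (forall a, a \in r -> H (a, a)) -> H z].
have GG' : G `<=` G' by move=> z zG; exists [::]; split=> // H _ GH _; apply: GH.
have RG' a : R a -> G' (a, a).
  move=> Ra; exists [:: a]; split; first by move=> b; rewrite inE => /eqP ->; apply/mem_set.
  by move=> H _ _; apply; rewrite inE.
have G'sub z : G' z -> exists2 H, piso setT setT H & H z.
  move=> [r [rR rz]]; pose ps := [seq (a, a) | a <- undup r].
  have [psr1 psr2] : map fst ps = undup r /\ map snd ps = undup r.
    by rewrite -!map_comp !map_id.
  have r_ind : indep [set` s] (undup r).
    by apply: R_ind; [apply: undup_uniq|move=> a; rewrite mem_undup; apply: rR].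
  have [|||H [Hiso GH psH _]] := @adjoin_pairs ps [set` s] [set` s] G Giso;
    rewrite ?psr1 ?psr2 //.
    by move=> w wG; split; [rewrite -G1|rewrite -G2]; exists w.
  exists H => //; have [Hf _ _ _] := Hiso; apply: rz => // a ar; apply: psH.
  by apply/mapP; exists a; rewrite ?mem_undup.
have [[GG1 _ _] Gk _ _] := Giso.
have subrU (r t : seq F) : {subset r <= R} -> {subset t <= R} -> {subset r ++ t <= R}.
  by move=> rR tR a; rewrite mem_cat => /orP[/rR|/tR].
have G'iso : piso setT setT G'.
  split=> //.
  - split; first exact: GG'.
      move=> x x' y y' [r [rR xr]] [t [tR yt]]; exists (r ++ t); split; first exact: subrU.
      move=> H Hf GH rtH; have [_ HB _] := Hf; apply: HB.
        by apply: xr => // a ar; apply: rtH; rewrite mem_cat ar.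
      by apply: yt => // a ar; apply: rtH; rewrite mem_cat ar orbT.
    move=> x x' y y' [r [rR xr]] [t [tR yt]]; exists (r ++ t); split; first exact: subrU.
    move=> H Hf GH rtH; have [_ _ HV] := Hf; apply: HV.
      by apply: xr => // a ar; apply: rtH; rewrite mem_cat ar.
    by apply: yt => // a ar; apply: rtH; rewrite mem_cat ar orbT.
  - by move=> a; apply/GG'/Gk.
  - by move=> x x' /G'sub[H [_ _ + _]]; apply.
have alg (S : set F) : divring_closed [in S] -> range iota `<=` S ->
    acl [set` s] `<=` S -> R `<=` S -> forall x, algebraic_over S x.
  move=> Sf kS sS RS x; have : acl ([set` s] `|` R) x by rewrite sRT.
  apply: algebraic_over_sub; apply: field_gen_min => // y [/(@sub_acl _ _ iota)/sS//|/RS//].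
have VT := valuation_ringT; have AT := archimedean_valT.
have [||t tG' _] := piso_extend_aut VT VT AT AT G'iso.
- apply: alg; first exact: piso_dom_divring G'iso.
  + by move=> _ [a _ <-]; exists (iota a, iota a) => //; apply: GG'.
  + by rewrite -G1 => _ [z zG <-]; exists z => //; apply: GG'.
  + by move=> a Ra; exists (a, a) => //; apply: RG'.
- apply: alg; first exact: piso_cod_divring G'iso.
  + by move=> _ [a _ <-]; exists (iota a, iota a) => //; apply: GG'.
  + by rewrite -G2 => _ [z zG <-]; exists z => //; apply: GG'.
  + by move=> a Ra; exists (a, a) => //; apply: RG'.
exists t; split.
- by move=> x y /G0G/GG'; apply: tG'.
- by move=> a /RG'; apply: tG'.
- have tG z : G z -> t z.1 = z.2 by case: z => x y /GG'; apply: tG'.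
  rewrite -[in LHS]G1 -G2; apply/seteqP; split=> [_ [_ [z zG <-] <-]|_ [z zG <-]].
    by exists z => //; rewrite tG.
  by exists z.1; rewrite ?tG //; exists z.
Qed.

End ExtendIso.

(** * Approximation and conjugacy *)

Lemma vmax_power (F : fieldType) (O : set F) u w : valuation_ring O -> archimedean_val O ->
  vmax O u -> exists N, vmax O (u ^+ N * w).
Proof.
move=> V A; have [-> _|u0 [/eqP|uO]] := eqVneq u 0.
- by exists 1%N; rewrite expr1 mul0r; left.
- by rewrite (negPf u0).
have [N wN] := A _ w uO; exists N.+1; rewrite exprSr mulrAC.
by move: wN; rewrite exprVn invrK mulrC => wN; apply: vmaxM => //; right.
Qed.

(** An Archimedean valuation ring is a maximal proper subring: any z outside O has powers that clear
    the denominator of every y, so O and z generate F. *)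
Lemma arch_incomparable (F : fieldType) (O O' : set F) : valuation_ring O ->
  valuation_ring O' -> archimedean_val O -> O' <> setT -> O <> O' -> exists2 a, O a & ~ O' a.
Proof.
move=> V V' A O'T OO'; apply: contrapT => na.
have sub : O `<=` O' by move=> x Ox; apply: contrapT => O'x; apply: na; exists x.
have [z O'z Oz] : exists2 z, O' z & ~ O z.
  apply: contrapT => nz; apply: OO'; apply/seteqP; split=> // x O'x.
  by apply: contrapT => Ox; apply: nz; exists x.
apply: O'T; apply/seteqP; split=> // y _; have [N /sub yN] := A _ y Oz.
by rewrite -(divfK (expf_neq0 N (vr_neq0 V Oz)) y); apply: vrM => //; apply: vrX.
Qed.

Section Approximation.
Variables (F : fieldType) (O O' : set F).
Hypotheses (V : valuation_ring O) (V' : valuation_ring O').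
Hypotheses (A : archimedean_val O) (A' : archimedean_val O').
Hypotheses (OT : O <> setT) (O'T : O' <> setT) (OO' : O <> O').

Lemma separating_element : exists c, [/\ c != 0, vmax O c & ~ O' c].
Proof.
have [a Oa O'a] := arch_incomparable V V' A O'T OO'.
have [b O'b Ob] := arch_incomparable V' V A' OT (nesym OO').
have a0 := vr_neq0 V' O'a; have b0 := vr_neq0 V Ob.
exists (a / b); split; first by rewrite mulf_neq0 // invr_eq0.
  by apply: vmaxM => //; apply: vmaxV.
by move=> /(vrM V')/(_ O'b); rewrite divfK.
Qed.

Lemma weak_approximation x x' : exists y, vmax O (y - x) /\ vmax O' (y - x').
Proof.
have [c [c0 cm cO']] := separating_element.
have [c10 Oc OcV] := vmax1D V cm.
have cO'1 : ~ O' (1 + c).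
  by move=> /(vrB V')/(_ (vr1 V')); rewrite addrAC subrr add0r.
pose e := (1 + c)^-1; have em' : vmax O' e by apply: vmaxV.
have em : vmax O (1 - e).
  have -> : 1 - e = e * c.
    by rewrite -[1 in LHS](mulVf c10) -/e mulrDr mulr1 addrAC subrr add0r.
  exact: vmaxM.
have [N wN] := vmax_power (x - x') V' A' em'.
have eN : vmax O (1 - e ^+ N).
  rewrite -opprB subrX1 -mulNr opprB mulrC; apply: vmaxM => //.
  by apply: vr_sum => // i _; apply: vrX.
have [M wM] := vmax_power (x' - x) V A eN.
(* At O, u is a power of the small element 1 - e^N; at O', 1 - u is a multiple of the small element
   e^N. The exponents N and M overcome the poles of x - x' at O' and at O. *)
pose u := (1 - e ^+ N) ^+ M; exists ((1 - u) * x + u * x'); split.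
  by have -> : (1 - u) * x + u * x' - x = u * (x' - x) by ring.
have -> : (1 - u) * x + u * x' - x' = (1 - u) * (x - x') by ring.
have -> : 1 - u = e ^+ N * \sum_(i < M) (1 - e ^+ N) ^+ i.
  by rewrite -opprB /u subrX1; ring.
rewrite mulrAC mulrC; apply: vmaxM => //; apply: (vr_sum V') => i _; apply: (vrX V').
by apply: (vrB V'); [apply: (vr1 V')|apply: (vrX V'); apply: vmaxW].
Qed.

End Approximation.

(** * Gauss valuations on simple transcendental extensions *)

Section Gauss.
Variables (k F : fieldType) (iota : {rmorphism k -> F}).

Lemma eval1_unit (E : fieldType) (v : {rmorphism E -> F}) O t q : valuation_ring O ->
    range v `<=` O -> vmax O t -> q.[0] != 0 ->
  [/\ eval1 v t q != 0, O (eval1 v t q) & O (eval1 v t q)^-1].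
Proof.
move=> V vO tm q0; have Ov e : O (v e) by apply: vO; exists e.
have v0 : v q.[0] != 0 by rewrite fmorph_eq0.
have qE : eval1 v t q = v q.[0] * (1 + v (q.[0])^-1 * (eval1 v t (drop_poly 1 q) * t)).
  rewrite mulrDr mulr1 mulrA -rmorphM divff // rmorph1 mul1r.
  rewrite -[in LHS](poly_take_drop 1 q) rmorphD rmorphM /= expr1 eval1X.
  congr (_ + _); rewrite -[RHS](eval1C _ t); congr (eval1 _ _ _).
  by apply/polyP => -[|i]; rewrite coef_take_poly coefC //= horner_coef0.
have [|u0 Ou OuV] := @vmax1D _ O V (v (q.[0])^-1 * (eval1 v t (drop_poly 1 q) * t)).
  apply: vmaxM => //; apply: vmaxM => //; apply: vr_horner => //; last exact: vmaxW.
  by move=> i; rewrite coef_map; apply: Ov.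
rewrite qE; split; first by rewrite mulf_neq0.
  exact: vrM.
by rewrite invfM; apply: vrM => //; rewrite -fmorphV.
Qed.

Lemma vr_uniformizer (O : set F) (t u s : F) i l : valuation_ring O -> vmax O t -> t != 0 ->
    [/\ u != 0, O u & O u^-1] -> [/\ s != 0, O s & O s^-1] ->
  O (u * t ^+ i / (s * t ^+ l)) <-> (l <= i)%N.
Proof.
move=> V tm t0 [u0 Ou OuV] [s0 Os OsV]; rewrite invfM mulrACA; split=> [Ox|li].
  rewrite leqNgt; apply/negP => il; have : O (t ^+ i / t ^+ l).
    rewrite -(mulKf (mulf_neq0 u0 (_ : s^-1 != 0)) (t ^+ i / t ^+ l)) ?invr_eq0 //.
    by apply: vrM => //; rewrite invf_div; apply: vrM.
  rewrite -(subnKC il) addSnnS exprD invfM mulrA divff ?expf_neq0 // mul1r exprS invfM mulrC.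
  move=> /(vrM V)/(_ (vrX V (l - i.+1) (vmaxW V tm))); rewrite mulrAC mulVf ?expf_neq0 // mul1r.
  by move=> Ot; exact: (vmax_unit t0 Ot tm).
apply: vrM => //; first exact: vrM.
rewrite -(subnK li) exprD mulfK ?expf_neq0 //; apply: vrX => //; exact: vmaxW.
Qed.

(** The exponents are the orders at t = 0 of numerator and denominator, whose remaining factors are
    units. They are quantified before O, so all valuations trivial on k(D) and positive at t agree
    on k(D, t). *)
Lemma gauss_value D t x : field_gen iota (D `|` [set t]) x -> x != 0 -> t != 0 ->
  exists i l : nat, forall O, valuation_ring O -> field_gen iota D `<=` O -> vmax O t ->
    O x <-> (l <= i)%N.
Proof.
have [E [v vE]] := field_gen_type iota D.
move=> /(field_gen_frac vE)[a [b [b0 ->]]] x0 t0.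
have a0 : eval1 v t a != 0 by move: x0; rewrite mulf_eq0 negb_or => /andP[].
have dec q : eval1 v t q != 0 -> exists i r, r.[0] != 0 /\
    eval1 v t q = eval1 v t r * t ^+ i.
  move=> q0; have qn0 : q != 0 by apply: contraNneq q0 => ->; rewrite rmorph0.
  have [i [r /implyP/(_ qn0) r0 ->]] := multiplicity_XsubC q 0.
  by exists i, r; split=> //; rewrite subr0 rmorphM rmorphXn /= eval1X.
have [i [r [r0 aE]]] := dec a a0; have [l [s [s0 bE]]] := dec b b0.
exists i, l => O V DO tm; rewrite -vE in DO.
rewrite -!eval1E aE bE; apply: vr_uniformizer => //; exact: eval1_unit.
Qed.

Lemma gauss_agree D t O1 O2 : valuation_ring O1 -> valuation_ring O2 ->
    field_gen iota D `<=` O1 -> field_gen iota D `<=` O2 -> vmax O1 t -> vmax O2 t -> t != 0 ->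
  forall x, field_gen iota (D `|` [set t]) x -> O1 x <-> O2 x.
Proof.
move=> V1 V2 DO1 DO2 t1 t2 t0 x Dx.
have [->|x0] := eqVneq x 0; first by split=> _; apply: vr0.
have [i [j ij]] := gauss_value Dx x0 t0.
by rewrite (ij O1) // (ij O2).
Qed.

End Gauss.

Section Automorphisms.
Variables (k : fieldType) (F : closedFieldType) (iota : {rmorphism k -> F}).
Implicit Types (O D : set F) (s t : autgroup iota).
Notation acl := (acl iota).

Lemma aut_rmorphism s : exists g : {rmorphism F -> F}, g =1 s.
Proof. by have [sB sM _ _] := autP s; apply: rmorphism_exists. Qed.

Definition autinv s : autgroup iota := (s^-1)%g.

Lemma autVK s : cancel s (autinv s).
Proof. by move=> x; have := mulVg s => /(congr1 (fun u : autgroup iota => u x)). Qed.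

Lemma autKV s : cancel (autinv s) s.
Proof. by move=> x; have := mulgV s => /(congr1 (fun u : autgroup iota => u x)). Qed.

Lemma aut_iota s a : s (iota a) = iota a.
Proof. by have [] := autP s. Qed.

Lemma field_gen_aut s D : field_gen iota (s @` D) = s @` field_gen iota D.
Proof.
have [g gs] := aut_rmorphism s.
have gi a : g (iota a) = iota a by rewrite gs aut_iota.
have gsE (X : set F) : s @` X = g @` X by apply: eq_imagel => x _; rewrite gs.
by rewrite !gsE (field_gen_morph gi).
Qed.

Lemma acl_aut s D x : acl (s @` D) (s x) <-> acl D x.
Proof.
have [g gs] := aut_rmorphism s.
have gi a : g (iota a) = iota a by rewrite gs aut_iota.
have gsE (X : set F) : s @` X = g @` X by apply: eq_imagel => y _; rewrite gs.
by rewrite !gsE -gs (acl_morph gi).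
Qed.

Lemma aut0 s : s 0 = 0. Proof. by have [g gs] := aut_rmorphism s; rewrite -gs rmorph0. Qed.
Lemma autV s x : s x^-1 = (s x)^-1.
Proof. by have [g gs] := aut_rmorphism s; rewrite -!gs fmorphV. Qed.
Lemma aut_neq0 s x : x != 0 -> s x != 0.
Proof. by have [g gs] := aut_rmorphism s; rewrite -!gs fmorph_eq0. Qed.
Lemma autB s x y : s (x - y) = s x - s y.
Proof. by have [g gs] := aut_rmorphism s; rewrite -!gs rmorphB. Qed.

Lemma preimage_valuation_ring s O : valuation_ring O -> valuation_ring (s @^-1` O).
Proof.
move=> V; have [g gs] := aut_rmorphism s; split; first split=> [|x y|x y]; rewrite ?inE /= -?gs.
- by rewrite rmorph1; apply: vr1.
- by rewrite rmorphB; apply: vrB.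
- by rewrite rmorphM; apply: vrM.
move=> x x0 /=; rewrite autV; have [_ VV] := V; apply: VV; exact: aut_neq0.
Qed.

Lemma preimage_archimedean s O : archimedean_val O -> archimedean_val (s @^-1` O).
Proof.
move=> A x y /= Ox; have [N yN] := A _ (s y) Ox; exists N.
by have [g gs] := aut_rmorphism s; rewrite /= -gs fmorph_div rmorphXn /= !gs.
Qed.

Lemma preimage_vmax s O x : vmax (s @^-1` O) x <-> vmax O (s x).
Proof.
rewrite /vmax /= autV; split=> -[h|h]; try by right.
  by left; rewrite h aut0.
by left; apply: (can_inj (autVK s)); rewrite h aut0.
Qed.

(** The identity of k(D) is a partial isomorphism matching O1 with O2, and F is algebraic over it,
    so [piso_extend_aut] applies. *)
Lemma valuation_conjugacy O1 O2 D : valuation_ring O1 -> valuation_ring O2 ->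
    archimedean_val O1 -> archimedean_val O2 ->
    (forall x, field_gen iota D x -> O1 x <-> O2 x) -> acl D = setT ->
  exists2 h : autgroup iota, (forall x, field_gen iota D x -> h x = x) &
    forall x, O1 x <-> O2 (h x).
Proof.
move=> V1 V2 A1 A2 O12 DT; set S := field_gen iota D in O12 *.
have [S1 SB SV] := (divring_closedP _).1 (field_gen_closed iota D : divring_closed [in S]).
have [|||h hS hO] := @piso_extend_aut _ _ iota O1 O2 [set z | S z.1 /\ z.2 = z.1] V1 V2 A1 A2.
- split.
  + split=> //= x x' y y' [xS ->] [yS ->]; first by split=> //; apply: SB.
    by split=> //; apply: SV.
  + by move=> a; split=> //; apply: field_gen_base.
  + by move=> x x' /= [_ ->].
  + by move=> x x' /= [xS ->]; apply: O12.
- move=> x; have : acl D x by rewrite DT.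
  by apply: algebraic_over_sub => y Sy; exists (y, y).
- move=> x; have : acl D x by rewrite DT.
  by apply: algebraic_over_sub => y Sy; exists (y, y).
by exists h => // x Sx; apply: hS.
Qed.

(* O and its preimage under t^-1 induce the same Gauss valuation on k(D, y). *)
Lemma correct_aut O t D y : valuation_ring O -> archimedean_val O ->
    field_gen iota D `<=` O -> field_gen iota D `<=` (autinv t) @^-1` O ->
    y != 0 -> vmax O y -> vmax O (autinv t y) -> acl (D `|` [set y]) = setT ->
  exists2 h : autgroup iota, (forall x, field_gen iota (D `|` [set y]) x -> h x = x) &
    forall x, O x <-> O (h (t x)).
Proof.
move=> V A DO DtO y0 yO ytO DT.
have V' := preimage_valuation_ring (autinv t) V.
have A' : archimedean_val (autinv t @^-1` O) by apply: preimage_archimedean.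
have [|h hD hO] := valuation_conjugacy V' V A' A _ DT.
  by apply: gauss_agree => //; apply/preimage_vmax.
by exists h => // x; rewrite -hO /= autVK.
Qed.

End Automorphisms.

(** * Residual independence *)

Section AlgIndep.
Import mpoly.
Variables (k K : fieldType) (j : {rmorphism k -> K}).

Lemma muni_mwiden n (p : {mpoly k[n]}) : muni (mwiden p) = p%:P.
Proof.
elim/mpolyind: p => [|c m p _ _ IHp]; first by rewrite mwiden0 muni0.
rewrite mwidenD muniD IHp polyCD; congr (_ + _).
rewrite mwidenZ muniZ mwidenX muniE msuppX big_seq1 mcoeffX eqxx scale1r.
rewrite mnmwiden_ordmax expr0 alg_polyC -mul_polyC -polyCM; congr (_%:P).
rewrite mul_mpolyC; congr (_ *: 'X_[_]); apply/mnmP => i.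
by rewrite mnmE mnmwiden_widen.
Qed.

Lemma muni_Xmax n : muni ('X_ord_max : {mpoly k[n.+1]}) = 'X.
Proof.
rewrite muniE msuppX big_seq1 mcoeffX eqxx scale1r mnm1E eqxx expr1.
rewrite (_ : [multinom _ | i < n] = 0%MM) ?mpolyX0 ?scale1r //.
by apply/mnmP => i; rewrite !mnmE eqE /= gtn_eqF.
Qed.

Definition seq_eval {s : seq K} : {rmorphism {mpoly k[size s]} -> K} :=
  mmap j (fun i : 'I_(size s) => s`_i).

Lemma field_gen_mfrac (s : seq K) x : field_gen j [set` s] x ->
  exists p q : {mpoly k[size s]}, seq_eval q != 0 /\ x = seq_eval p / seq_eval q.
Proof.
move: x; apply: field_gen_min.
- apply/divring_closedP; split.
  + by exists 1, 1; rewrite /= rmorph1 oner_neq0 divr1.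
  + move=> _ _ [a [b [b0 ->]]] [c [d [d0 ->]]]; exists (a * d - c * b), (b * d).
    rewrite rmorphB !rmorphM /= mulf_neq0 //; split=> //.
    by rewrite -[- (_ / _)]mulNr addf_div // mulNr.
  + move=> _ _ [a [b [b0 ->]]] [c [d [d0 ->]]].
    have [c0|c0] := eqVneq (seq_eval c) 0.
      by exists 0, 1; rewrite /= rmorph1 rmorph0 oner_neq0 c0 mul0r invr0 mulr0 mul0r.
    exists (a * d), (b * c).
    by rewrite /= !rmorphM /= mulf_neq0 // invf_div mulf_div.
- move=> _ [a _ <-]; exists a%:MP, 1; rewrite /= rmorph1 oner_neq0 divr1; split=> //.
  by rewrite /seq_eval mmapC.
- move=> x /= xs; have lt : (index x s < size s)%N by rewrite index_mem.
  exists 'X_(Ordinal lt), 1; rewrite /= rmorph1 oner_neq0 divr1; split=> //.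
  by rewrite /seq_eval mmapX mmap1U /= nth_index.
Qed.

Lemma mmap_widen n (h : 'I_n.+1 -> K) (p : {mpoly k[n]}) :
  mmap j h (mwiden p) = mmap j (fun i : 'I_n => h (widen_ord (leqnSn n) i)) p.
Proof.
elim/mpolyind: p => [|c m p _ _ IHp]; first by rewrite mwiden0 !mmap0.
rewrite mwidenD !mmapD IHp; congr (_ + _).
rewrite mwidenZ !mmapZ mwidenX !mmapX; congr (_ * _).
rewrite /mmap1 big_ord_recr /= mnmwiden_ordmax expr0 mulr1.
by apply: eq_bigr => i _; rewrite mnmwiden_widen.
Qed.

(** The link between independence in terms of multivariate polynomials and [acl]. An equation of b
    over k(s), cleared of denominators, is a polynomial Q in one more variable that vanishes at (s,
    b); so Q = 0, and [muni] reads off that all its coefficients vanish. *)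
Lemma alg_indep_acl (B : set K) b : alg_indep j B -> B b -> ~ acl j (B `\` [set b]) b.
Proof.
move=> Bind Bb /acl_finite[s0 s0B].
have {s0 s0B} [s [s_uniq sB ->]] : exists s : seq K,
    [/\ uniq s, {subset s <= B `\` [set b]} & [set` s0] = [set` s]].
  exists (undup s0); split; first exact: undup_uniq.
    by move=> x; rewrite mem_undup; apply: s0B.
  by apply/seteqP; split=> x; rewrite /= mem_undup.
move=> [P [/(polyOver_setP P (divring_closed0 (field_gen_closed _ _))) Ps P0 Pb]].
have /choice[ab abP] i : exists ab : {mpoly k[size s]} * {mpoly k[size s]},
    seq_eval ab.2 != 0 /\ P`_i = seq_eval ab.1 / seq_eval ab.2.
  by have [p [q pq]] := field_gen_mfrac (Ps i); exists (p, q).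
pose c i := (ab i).1 * \prod_(l < size P | l != i :> nat) (ab l).2.
pose d := \prod_(l < size P) (ab l).2.
have d0 : seq_eval d != 0 by rewrite rmorph_prod; apply/prodf_neq0 => i _; have [] := abP i.
have cE i : (i < size P)%N -> seq_eval (c i) = seq_eval d * P`_i.
  move=> lt; have [bi0 ->] := abP i; rewrite /d (bigD1 (Ordinal lt)) //= /c !rmorphM /=.
  by rewrite mulrAC [_ * (_ / _)]mulrC divfK.
(* The default value of [nth] matters: the last index lies beyond s and yields b. *)
pose h (i : 'I_(size s).+1) := nth b s i.
pose Q : {mpoly k[(size s).+1]} := \sum_(i < size P) mwiden (c i) * 'X_ord_max ^+ i.
have hE p : mmap j h (mwiden p) = seq_eval p.
  rewrite mmap_widen /seq_eval; apply: eq_bigr => m _; congr (_ * _).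
  by apply: mmap1_eq => i; rewrite /h /=; apply: set_nth_default.
have hX : mmap j h 'X_ord_max = b by rewrite mmapX mmap1U /h /= nth_default.
have Q0 : Q = 0.
  apply: (Bind _ h).
  - move=> i1 i2; rewrite /h => /eqP.
    have bs : uniq (rcons s b).
      by rewrite rcons_uniq s_uniq andbT; apply/negP => /sB /set_mem[_]; apply.
    have nE i : nth b s i = nth b (rcons s b) i.
      by rewrite nth_rcons; case: ltnP => // le; rewrite if_same nth_default.
    by rewrite !nE nth_uniq ?size_rcons // => /eqP/val_inj.
  - move=> i; rewrite /h; have [lt|le] := ltnP i (size s); last by rewrite nth_default.
    by have /sB/set_mem[] := mem_nth b lt.
  - rewrite rmorph_sum; move/rootP: Pb; rewrite horner_coef => Pb.
    transitivity (seq_eval d * \sum_(i < size P) P`_i * b ^+ i); last by rewrite Pb mulr0.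
    rewrite mulr_sumr; apply: eq_bigr => i _.
    by rewrite rmorphM rmorphXn /= hE hX cE // mulrA.
have c0 i : (i < size P)%N -> c i = 0.
  move=> lt; have /(congr1 (fun p => (muni p)`_i)) := Q0.
  rewrite muni0 coef0 rmorph_sum /= => <-.
  rewrite (eq_bigr (fun l : 'I__ => (c l)%:P * 'X^l)); last first.
    by move=> l _; rewrite rmorphM rmorphXn /= muni_mwiden muni_Xmax.
  rewrite coef_sum (bigD1 (Ordinal lt)) //= coefCM coefXn eqxx mulr1 big1 ?addr0 // => l.
  by rewrite -val_eqE /= => li; rewrite coefCM coefXn eq_sym (negPf li) mulr0.
move/eqP: P0; apply; apply/polyP => i; rewrite coef0.
have [lt|le] := ltnP i (size P); last by rewrite nth_default.
by apply: (mulfI d0); rewrite -cE // c0 // rmorph0 mulr0.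
Qed.

End AlgIndep.

Section Residue.
Variables (k F : fieldType) (iota : {rmorphism k -> F}) (O : set F).
Hypotheses (V : valuation_ring O) (kO : range iota `<=` O).
Variables (kappa : fieldType) (rho : F -> kappa).
Hypothesis res : residue_map O rho.

Lemma res1 : rho 1 = 1. Proof. by have [] := res. Qed.
Lemma resB x y : O x -> O y -> rho (x - y) = rho x - rho y.
Proof. by move=> Ox Oy; have [_ + _ _ _] := res; apply; apply/mem_set. Qed.
Lemma resM x y : O x -> O y -> rho (x * y) = rho x * rho y.
Proof. by move=> Ox Oy; have [_ _ + _ _] := res; apply; apply/mem_set. Qed.

Lemma res_eq0 x : O x -> rho x = 0 <-> vmax O x.
Proof.
move=> Ox; have [_ _ _ _ /(_ x Ox) ->] := res; split=> [nu|xm].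
  by apply: contrapT => /(vmax_notV Ox)[x0 OxV]; apply: nu; split.
by move=> [x0 _ OxV]; apply: (vmax_unit x0 OxV).
Qed.

Lemma res_eq x y : O x -> vmax O (y - x) -> O y /\ rho y = rho x.
Proof.
move=> Ox yx; have Oyx := vmaxW V yx.
have Oy : O y by rewrite -(subrK x y); apply: vrD.
by split=> //; apply/eqP; rewrite -subr_eq0 -resB //; apply/eqP/res_eq0.
Qed.

Lemma resV x : O x -> O x^-1 -> rho x^-1 = (rho x)^-1.
Proof.
have [->|x0] := eqVneq x 0; last move=> Ox OxV.
  by move=> O0 _; rewrite invr0 (_ : rho 0 = 0) ?invr0 //; apply/(res_eq0 O0); left.
have rx : rho x != 0.
  by apply/eqP => /(res_eq0 Ox); apply: vmax_unit.
by apply: (mulIf rx); rewrite mulVf // -resM // mulVf ?res1.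
Qed.

Lemma res_field_gen D : field_gen iota D `<=` O ->
  rho @` field_gen iota D `<=` field_gen (rho \o iota) (rho @` D).
Proof.
move=> DO; suff : field_gen iota D `<=`
    [set x | field_gen iota D x /\ field_gen (rho \o iota) (rho @` D) (rho x)].
  by move=> h _ [x /h[_ ?] <-].
have [f1 fB fV] := (divring_closedP _).1 (field_gen_closed iota D).
have [g1 gB gV] := (divring_closedP _).1 (field_gen_closed (rho \o iota) (rho @` D)).
apply: field_gen_min.
- apply/divring_closedP; split=> [|x y [xD xk] [yD yk]|x y [xD xk] [yD yk]] /=.
  + by rewrite res1.
  + by split; [apply: fB|rewrite resB; [apply: gB|exact: DO|exact: DO]].
  + have yVD : field_gen iota D y^-1 by rewrite -(div1r y); apply: fV.
    have [Ox Oy OyV] := And3 (DO _ xD) (DO _ yD) (DO _ yVD).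
    by split; [apply: fV|rewrite resM // resV //; apply: gV].
- by move=> _ [a _ <-]; split; [apply: field_gen_base|apply: (@field_gen_base _ _ (rho \o iota))].
- by move=> d Dd; split; apply: sub_field_gen => //; exists d.
Qed.

(** Reduction embeds k(D) into the residue field. A non-zero polynomial over k(D) therefore reduces
    to a non-zero one, does not vanish at the residue of a, and takes a unit value at a. *)
Lemma res_transcendental D a : field_gen iota D `<=` O -> O a ->
    ~ acl (rho \o iota) (rho @` D) (rho a) ->
  field_gen iota (D `|` [set a]) `<=` O /\ ~ acl iota D a.
Proof.
move=> DO Oa ra; have [E [v vE]] := field_gen_type iota D.
have Ov e : O (v e) by apply: DO; rewrite -vE; exists e.
have [||w wE] := @rmorphism_exists E kappa (rho \o v).
- by move=> x y /=; rewrite rmorphB resB.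
- by split=> [|x y] /=; rewrite ?rmorph1 ?res1 // rmorphM resM.
have Oev q : O (eval1 v a q) by apply: vr_horner => // i; rewrite coef_map; apply: Ov.
have r0 : rho 0 = 0 by apply/res_eq0; [apply: vr0|left].
have resD x y : O x -> O y -> rho (x + y) = rho x + rho y.
  move=> Ox Oy; rewrite -[X in rho (_ + X)]opprK resB //; last exact: vrN.
  have -> : rho (- y) = - rho y by rewrite -sub0r resB ?r0 ?sub0r //; apply: vr0.
  by rewrite opprK.
have rev q : rho (eval1 v a q) = eval1 w (rho a) q.
  elim/poly_ind: q => [|q c IHq]; first by rewrite !rmorph0.
  rewrite !rmorphD !rmorphM /= !eval1X !eval1C wE -IHq -resM //=.
  by apply: resD => //; apply: vrM.
have unit_ev q : q != 0 -> eval1 v a q != 0 /\ O (eval1 v a q)^-1.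
  move=> q0; apply: vmax_notV => //; apply: contra_not ra => /(res_eq0 (Oev q)).
  rewrite rev => rq; apply: (@algebraic_over_sub _ (range w)).
    move=> _ [e _ <-]; rewrite wE; apply: (res_field_gen DO).
    by exists (v e) => //; rewrite -vE; exists e.
  by apply/algebraic_rangeP; exists q => //; apply/rootP.
split.
  move=> x /(field_gen_frac vE)[p [q [q0 ->]]]; rewrite -!eval1E; apply: vrM => //.
  by apply: (unit_ev q _).2; apply: contraNneq q0 => ->; rewrite rmorph0 horner0.
move=> /(aclP _ vE)[q q0 /rootP qa].
by have [] := unit_ev q q0; rewrite eval1E qa eqxx.
Qed.

(* rho maps B injectively onto an algebraically independent set. *)
Definition res_free B := B `<=` O /\
  forall b, B b -> ~ acl (rho \o iota) (rho @` (B `\` [set b])) (rho b).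

(** The valuation is trivial on the generated field. The elements are adjoined one at a time by
    [res_transcendental], and a repeated element adds nothing. *)
Lemma res_free_gen_seq B (s : seq F) : res_free B -> [set` s] `<=` B ->
  field_gen iota [set` s] `<=` O.
Proof.
move=> [BO Bf]; elim: s => [|a s IHs] sB.
  apply: subset_trans kO; apply: field_gen_min => //; first exact: range_divring.
have {IHs} sO : field_gen iota [set` s] `<=` O.
  by apply: IHs => x xs; apply: sB; rewrite /= inE xs orbT.
have Ba : B a by apply: sB; rewrite /= inE eqxx.
have [as_|as_] := boolP (a \in s).
  apply: subset_trans sO; apply: field_gen_sub => x /=; rewrite inE => /orP[/eqP->|xs];
    exact: sub_field_gen.
rewrite set_seq_cons setUC; apply: (res_transcendental sO _ _).1; first exact: BO.
apply: contra_not (Bf a Ba); apply: acl_mono => _ [x xs <-]; exists x => //.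
split; first by apply: sB; rewrite /= inE xs orbT.
by move=> xa; move: as_; rewrite -xa xs.
Qed.

Lemma res_free_gen B : res_free B -> field_gen iota B `<=` O.
Proof.
move=> Bf x /field_gen_finite[s sB]; apply: (res_free_gen_seq Bf).
by move=> y /sB/set_mem.
Qed.

Lemma res_free_acl B b : res_free B -> B b -> ~ acl iota (B `\` [set b]) b.
Proof.
move=> Bf Bb /acl_finite[s sB]; apply: (res_transcendental _ _ _).2.
- by apply: res_free_gen_seq Bf _ => y /sB/set_mem[].
- by case: Bf => BO _; apply: BO.
- case: Bf => _ /(_ b Bb); apply: contra_not; apply: acl_mono => _ [x /sB/set_mem xs <-].
  by exists x.
Qed.

Lemma res_free_perturb B (f : F -> F) : res_free B -> (forall b, B b -> vmax O (f b - b)) ->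
  res_free (f @` B) /\ {in B &, injective f}.
Proof.
move=> [BO Bf] fm; have fr b : B b -> O (f b) /\ rho (f b) = rho b.
  by move=> Bb; apply: res_eq; [apply: BO|apply: fm].
have Bi b b' : B b -> B b' -> f b = f b' -> b = b'.
  move=> Bb Bb' ff; apply: contrapT => bb'; apply: (Bf b Bb); apply: sub_acl.
  exists b'; first by split=> // /esym.
  by rewrite -(fr b' Bb').2 -(fr b Bb).2 ff.
split; last by move=> b b' /set_mem Bb /set_mem Bb'; apply: Bi.
split=> [_ [b /fr[? _] <-] //|_ [b Bb <-]].
rewrite (fr b Bb).2; apply: contra_not (Bf b Bb); apply: acl_mono.
move=> _ [_ [[b' Bb' <-] bb'] <-]; exists b'; last by rewrite (fr b' Bb').2.
by split=> // b'b; apply: bb'; rewrite b'b.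
Qed.

End Residue.

(** * Valuations with a lifted residue basis *)

Section Adapted.
Variables (k : fieldType) (F : closedFieldType) (iota : {rmorphism k -> F}).
Implicit Types (O B : set F) (t : F).

(** The residue field is quantified away; what is used of it later is that O is trivial on [acl B],
    that B is independent, and that B may be changed within residue classes. *)
Definition vfree O B := exists (kappa : fieldType) (rho : F -> kappa),
  residue_map O rho /\ res_free iota O rho B.

Definition k_valuation O := [/\ valuation_ring O, range iota `<=` O & archimedean_val O].

(* B lifts a transcendence basis of the residue field of O, and F is algebraic over k(B, t). *)
Definition adapted O B t := [/\ k_valuation O, vfree O B, vmax O t, t != 0 &
  acl iota (B `|` [set t]) = setT].

Lemma vfree_gen O B : k_valuation O -> vfree O B -> field_gen iota B `<=` O.
Proof. by move=> [V kO _] [kappa [rho [res Bf]]]; apply: res_free_gen Bf. Qed.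

Lemma vfree_acl O B : k_valuation O -> vfree O B -> acl iota B `<=` O.
Proof.
move=> kV Bf x; apply: vr_algebraic; first by case: kV.
  exact: field_gen_closed.
exact: vfree_gen.
Qed.

Lemma vfree_perturb O B f : k_valuation O -> vfree O B -> (forall b, B b -> vmax O (f b - b)) ->
  vfree O (f @` B) /\ {in B &, injective f}.
Proof.
move=> [V kO _] [kappa [rho [res Bf]]] fm.
by have [Bf' fi] := res_free_perturb V res Bf fm; split=> //; exists kappa, rho.
Qed.

Lemma vfree_sub O B B' : B' `<=` B -> vfree O B -> vfree O B'.
Proof.
move=> BB [kappa [rho [res [BO Bf]]]]; exists kappa, rho; split=> //.
split=> [x /BB/BO//|b Bb]; apply: contra_not (Bf b (BB _ Bb)); apply: acl_mono.
by apply: image_subset => x [Bx xb]; split=> //; apply: BB.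
Qed.

Definition acl_free (S : set F) := forall x, S x -> ~ acl iota (S `\` [set x]) x.

Lemma vfree_vmax O B t : k_valuation O -> vfree O B -> vmax O t -> t != 0 -> ~ acl iota B t.
Proof.
move=> kV Bf tm t0 tB; have /divring_closedP[B1 _ BV] := acl_closed iota B.
apply: (vmax_unit t0) tm; apply: (vfree_acl kV Bf).
by rewrite -(div1r t); apply: BV.
Qed.

Lemma vfree_neq0 O B b : k_valuation O -> vfree O B -> B b -> b != 0.
Proof.
move=> [V kO _] [kappa [rho [res Bf]]] Bb.
apply: contra_notN (res_free_acl V kO res Bf Bb) => /eqP ->.
by apply: divring_closed0; apply: acl_closed.
Qed.

(** If some x in B depended on t and the rest of B, exchange would make t algebraic over B, where
    the valuation is trivial. *)
Lemma vfree_acl_free O B t : k_valuation O -> vfree O B -> vmax O t -> t != 0 ->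
  acl_free (B `|` [set t]) /\ ~ B t.
Proof.
move=> kV Bf tm t0; have tB := vfree_vmax kV Bf tm t0.
have tB' : ~ B t by move=> Bt; apply: tB; apply: sub_acl.
split=> // x [Bx|->].
  move=> xBt; apply: tB; have Bx' : ~ acl iota (B `\` [set x]) x.
    by case: kV Bf => V kO _ [kappa [rho [res Bf]]]; apply: res_free_acl Bf Bx.
  have : acl iota (B `\` [set x] `|` [set x]) t.
    apply: acl_exchange Bx'; apply: acl_mono xBt => y [[By|->] yx]; first by left.
    by right.
  by apply: acl_mono => y [[]//|->].
by apply: contra_not tB; apply: acl_mono => y [[]].
Qed.

Lemma acl_free_indep (S D : set F) r : acl_free S -> D `<=` S -> [set` r] `<=` S `\` D ->
  uniq r -> indep iota D r.
Proof.
move=> Sf; elim: r D => //= a r IHr D DS rS /andP[ar r_uniq].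
have [Sa Da] : (S `\` D) a by apply: rS; rewrite /= inE eqxx.
split.
  apply: contra_not (Sf a Sa); apply: acl_mono => x Dx.
  by split; [apply: DS|move=> xa; apply: Da; rewrite -xa].
apply: IHr => //; first by move=> x [/DS|->].
move=> x xr; have [Sx Dx] : (S `\` D) x by apply: rS; rewrite /= inE xr orbT.
by split=> // -[//|xa]; move: ar; rewrite -xa xr.
Qed.

End Adapted.

Section AdaptedExistence.
Variables (k : fieldType) (F : closedFieldType) (iota : {rmorphism k -> F}).
Implicit Types (O B : set F) (t : F).

Lemma vr_root O x n : valuation_ring O -> O (x ^+ n.+1) -> O x.
Proof.
move=> V Ox; apply: contrapT => nOx; apply: (vmax1 V).
rewrite -(mulfV (expf_neq0 n.+1 (vr_neq0 V nOx))).
apply: vmaxM => //; rewrite exprS invfM mulrC -exprVn; apply: vmaxM => //.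
  by apply: vrX => //; apply: vrV.
exact: vmaxV.
Qed.

(** One-dimensionality gives w(y) = a w(x) with a rational, so y^(d+1) is a unit times an integral
    power of x. A negative exponent would put y into O; otherwise the exponent serves as N, since O
    contains the roots of its elements. *)
Lemma value_map_arch O (Gamma : vectType rat) (w : F -> Gamma) : valuation_ring O ->
  value_map O w -> \dim {:Gamma} = 1%N -> archimedean_val O.
Proof.
move=> V [wM _ w0] dim1 x y Ox; have x0 := vr_neq0 V Ox.
have wX z n : z != 0 -> w (z ^+ n) = w z *+ n.
  move=> z0; elim: n => [|n IHn].
    have w1 : w 1 + w 1 = w 1 by rewrite -wM ?oner_neq0 // mulr1.
    by rewrite expr0 mulr0n; apply: (addrI (w 1)); rewrite w1 addr0.
  by rewrite exprS wM ?expf_neq0 // IHn mulrS.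
have wx0 : w x != 0 by apply/eqP => /(w0 x x0)[_ /Ox].
have [Oy|Oy] := pselect (O y); first by exists 0%N; rewrite expr0 divr1.
have y0 := vr_neq0 V Oy.
have : w y \in <[w x]>%VS.
  suff -> : <[w x]>%VS = fullv by apply: memvf.
  by apply/eqP; rewrite eqEdim subvf dim1 dim_vline wx0.
move=> /vlineP[a wy]; have [d dE] : exists d : nat, denq a = d.+1.
  by have := denq_gt0 a; case: (denq a) => // -[|d] // _; exists d.
have yE : w (y ^+ d.+1) = (numq a)%:~R *: w x.
  by rewrite wX // wy scalerMnl -mulr_natr numqE dE.
have [[n nE]|[n nE]] : (exists n : nat, numq a = n) \/ exists n : nat, numq a = - n%:Z.
- by case: (numq a) => n; [left; exists n|right; exists n.+1].
- exists n; apply: (@vr_root _ _ d) => //.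
  have [_ Oyx _] : val_units O (y ^+ d.+1 / x ^+ n).
    apply/w0; first by rewrite mulf_neq0 ?invr_eq0 ?expf_neq0.
    apply: (addIr (w (x ^+ n))); rewrite add0r -wM ?mulf_neq0 ?invr_eq0 ?expf_neq0 //.
    by rewrite divfK ?expf_neq0 // yE nE wX // -scaler_nat.
  case: n {nE} Oyx => [|n] Oyx.
    by rewrite expr0 divr1; rewrite expr0 divr1 in Oyx.
  rewrite expr_div_n -exprM mulnS exprD invfM mulrA; apply: vrM => //.
  by rewrite -exprVn; apply: vrX => //; apply: vrV.
- case: Oy; apply: (@vr_root _ _ d) => //.
  have [_ Oyx _] : val_units O (y ^+ d.+1 * x ^+ n).
    apply/w0; first by rewrite mulf_neq0 ?expf_neq0.
    by rewrite wM ?expf_neq0 // yE nE wX // rmorphN /= scaleNr scaler_nat addNr.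
  rewrite -(mulfK (expf_neq0 n x0) (y ^+ d.+1)); apply: vrM => //.
  by rewrite -exprVn; apply: vrX => //; apply: vrV.
Qed.

(** The value of t is a basis vector, hence non-zero, so t is no unit and either t or t^-1 lies in
    the maximal ideal. *)
Lemma P1_adapted O : P1 iota O -> exists B t, adapted iota O B t.
Proof.
move=> [V kO [kappa [rho [Gamma [w [res val dim1 [B [Bbar [t]]]]]]]]].
move=> [[BO [Bb Bi Bs]] [Bind _] [t0 wt] alg].
have [||j jE] := @rmorphism_exists k kappa (rho \o iota).
- by move=> x y /=; rewrite rmorphB (resB res) //; apply: kO; [exists x|exists y].
- split=> [|x y] /=; first by rewrite rmorph1 (res1 res).
  by rewrite rmorphM (resM res) //; apply: kO; [exists x|exists y].
have {}jE : rho \o iota = j by apply/funext => x; rewrite jE.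
have kV : k_valuation iota O by split=> //; apply: value_map_arch val dim1.
have Bf : vfree iota O B.
  exists kappa, rho; split=> //; split=> // b bB; rewrite jE in Bind *.
  apply: contra_not (alg_indep_acl Bind (Bb b bB)); apply: acl_mono => _ [x [Bx xb] <-].
  split; first exact: Bb.
  by move=> rxb; apply: xb; apply: Bi => //; apply/mem_set.
have algT : acl iota (B `|` [set t]) = setT by apply/seteqP; split=> // x _; apply: alg.
have tu : ~ val_units O t.
  have [_ _ /(_ t t0) <-] := val.
  by apply/eqP; have := basis_free wt; rewrite seq1_free.
have [Ot|Ot] := pselect (O t).
  exists B, t; split=> //; apply: contrapT => tm; apply: tu.
  by have [? ?] := vmax_notV Ot tm; split.
exists B, t^-1; split; rewrite ?invr_eq0 //; first exact: vmaxV.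
apply/seteqP; split=> // x _; have : acl iota (B `|` [set t]) x by rewrite algT.
apply: acl_sub => y [By|->]; first by apply: sub_acl; left.
have /divring_closedP[B1 _ BV] := acl_closed iota (B `|` [set t^-1]).
have := BV 1 t^-1 B1; rewrite div1r invrK; apply.
by apply: sub_acl; right.
Qed.

End AdaptedExistence.

Section Perturb.
Variables (k : fieldType) (F : closedFieldType) (iota : {rmorphism k -> F}).
Implicit Types (O B : set F) (t : F).
Notation acl := (acl iota).

Lemma acl_finite_seq D (l : seq F) : [set` l] `<=` acl D ->
  exists u : seq F, {subset u <= D} /\ [set` l] `<=` acl [set` u].
Proof.
elim: l => [|a l IHl] lD; first by exists [::].
have [|u [uD lu]] := IHl; first by move=> x xl; apply: lD; rewrite /= inE xl orbT.
have /acl_finite[w wD wa] : acl D a by apply: lD; rewrite /= inE eqxx.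
exists (w ++ u); split; first by move=> x; rewrite mem_cat => /orP[/wD|/uD].
move=> x /=; rewrite inE => /orP[/eqP->|xl].
  by apply: acl_mono wa => y /= yw; rewrite mem_cat yw.
by apply: acl_mono (lu x xl) => y /= yu; rewrite mem_cat yu orbT.
Qed.

Lemma diag_piso : piso iota setT setT (range (fun a => (iota a, iota a))).
Proof.
split=> //.
- split; first by exists 1; rewrite ?rmorph1.
    by move=> _ _ _ _ [a _ [<- <-]] [b _ [<- <-]]; exists (a - b); rewrite ?rmorphB.
  by move=> _ _ _ _ [a _ [<- <-]] [b _ [<- <-]]; exists (a / b); rewrite ?fmorph_div.
- by move=> _ _ [a _ [<- <-]].
Qed.

(** Some automorphism tau takes (B, t) to (f B, y0), since only finitely many elements of B are
    really moved. Because f preserves residues, O is trivial both on k(f B) and on its preimage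
    k(B), and both y0 and t lie in the maximal ideal. So [correct_aut] puts tau into G_v without
    changing these values. *)
Lemma perturb_move O B t (f : F -> F) (s0 : seq F) y0 : adapted iota O B t ->
    (forall b, B b -> vmax O (f b - b)) -> (forall b, B b -> b \notin s0 -> f b = b) ->
    vmax O y0 -> y0 != 0 ->
  exists p : autgroup iota, [/\ forall x, O x <-> O (p x), forall b, B b -> p b = f b & p t = y0].
Proof.
move=> [kV Bf tm t0 BtT] fm fs y0m y00; have [V kO A] := kV.
have [Bf' fi] := vfree_perturb kV Bf fm.
have [St tB] := vfree_acl_free kV Bf tm t0.
have [St' y0B] := vfree_acl_free kV Bf' y0m y00.
pose l0 := [seq b <- s0 | b \in B].
have [|u [uB lu]] := @acl_finite_seq (B `|` [set t]) (y0 :: map f l0).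
  by rewrite BtT.
(* The sequence s contains the moved elements of B, and enough further ones to make their images and
   y0 algebraic over t and s. So the isomorphism lives inside [acl] of t and s. *)
pose s := undup [seq b <- s0 ++ u | b \in B].
have sB : [set` s] `<=` B by move=> x; rewrite /= mem_undup mem_filter => /andP[/set_mem].
have s_uniq : uniq s by apply: undup_uniq.
have us : acl [set` u] `<=` acl [set` t :: s].
  apply: acl_mono => x /= xu; rewrite inE mem_undup mem_filter mem_cat xu orbT andbT.
  by have /set_mem[/mem_set ->|->] := uB x xu; rewrite ?orbT ?eqxx.
have fsT b : b \in s -> acl [set` t :: s] (f b).
  move=> bs; have Bb := sB b bs; have [b0|b0] := boolP (b \in s0).
    apply/us/lu; rewrite /= inE; apply/orP; right; apply/mapP; exists b => //.
    by rewrite mem_filter b0 andbT; apply/mem_set.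
  by rewrite fs //; apply: sub_acl; rewrite /= inE bs orbT.
have y0T : acl [set` t :: s] y0 by apply/us/lu; rewrite /= inE eqxx.
pose ps := (t, y0) :: [seq (b, f b) | b <- s].
have [ps1 ps2] : map fst ps = t :: s /\ map snd ps = y0 :: map f s.
  by rewrite /= -!map_comp map_id.
have ts_ind : indep iota set0 (t :: s).
  apply: acl_free_indep St _ _ _ => //.
    by rewrite setD0 set_seq_cons => x [->|/sB]; [right|left].
  by rewrite /= s_uniq andbT; apply/negP => /sB.
have [|||G [Giso _ psG Gsub]] :=
  @adjoin_pairs _ _ iota ps set0 set0 _ diag_piso; rewrite ?ps1 ?ps2 //.
- by move=> _ [a _ <-]; split; apply: acl_base.
- apply: acl_free_indep St' _ _ _ => //.
    rewrite setD0 set_seq_cons => x [->|/mapP[b bs ->]]; first by right.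
    by left; exists b => //; apply: sB.
  rewrite /= map_inj_in_uniq ?s_uniq ?andbT.
    by apply/negP => /mapP[b bs y0E]; apply: y0B; exists b => //; apply: sB.
  by move=> a b /sB Ba /sB Bb; apply: fi; apply/mem_set.
rewrite !ps1 !ps2 !set0U in Gsub.
have [||||tau [tauG tauR _]] := @extend_aut _ _ iota (t :: s) (B `\` [set` s]) G ts_ind.
- move=> r r_uniq rR; apply: acl_free_indep St _ _ r_uniq.
    by rewrite set_seq_cons => x [->|/sB]; [right|left].
  move=> x /rR/set_mem[Bx xs]; split; first by left.
  by rewrite set_seq_cons => -[xt|//]; apply: tB; rewrite -xt.
- apply/seteqP; split=> // x _; have : acl (B `|` [set t]) x by rewrite BtT.
  apply: acl_mono => y [By|->]; last by left; rewrite /= inE eqxx.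
  have [ys|ys] := boolP (y \in s); first by left; rewrite /= inE ys orbT.
  by right; split=> //; apply/negP.
- exact: Giso.
- move=> z /Gsub[z1 z2]; split=> //; move: z2; apply: acl_sub.
  by rewrite set_seq_cons => x [->//|/mapP[b bs ->]]; apply: fsT.
have taut : tau t = y0 by apply: tauG; apply: psG; rewrite /= inE eqxx.
have taub b : B b -> tau b = f b.
  move=> Bb; have [bs|bs] := boolP (b \in s).
    by apply: tauG; apply: psG; rewrite /= inE; apply/orP; right; apply/mapP; exists b.
  rewrite tauR; last by split=> //; apply/negP.
  rewrite fs //; apply: contra bs => bs0.
  by rewrite mem_undup mem_filter mem_cat bs0 andbT; apply/mem_set.
have tauB : f @` B = tau @` B.
  by apply/seteqP; split=> _ [b Bb <-]; exists b; rewrite ?taub.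
have tau_y0 : autinv tau y0 = t by rewrite -taut autVK.
have [||||h hD hO] := @correct_aut _ _ iota O tau (f @` B) y0 V A _ _ y00 y0m.
- exact: vfree_gen Bf'.
- rewrite tauB field_gen_aut => _ [x xB <-] /=; rewrite autVK.
  exact: (vfree_gen kV Bf).
- by rewrite tau_y0.
- apply/seteqP; split=> // x _; rewrite -(autKV tau x).
  have -> : f @` B `|` [set y0] = tau @` (B `|` [set t]).
    by rewrite image_setU image_set1 taut tauB.
  by apply/acl_aut; rewrite BtT.
exists (h * tau)%g; split=> [x|b Bb|] /=.
- exact: hO.
- by rewrite /aut_fun /= taub // hD //; apply: sub_field_gen; left; exists b.
- by rewrite /aut_fun /= taut hD //; apply: sub_field_gen; right.
Qed.

End Perturb.

(** * Functions with a single pole *)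

Section PlaneModel.
Variables (K F : fieldType) (j : {rmorphism K -> F}).
Hypothesis K_char0 : [pchar K] =i pred0.
Hypothesis K_closed : forall p : {poly K}, size p != 1%N -> exists x, root p x.
Hypothesis trdeg1 : forall y, ~ range j y -> forall x, algebraic_over (field_gen j [set y]) x.

Notation ev1 := (eval1 j).
Notation ev2 := (eval2 j).

Lemma closed_split (p : {poly K}) : p != 0 ->
  exists c (r : seq K), c != 0 /\ p = c *: \prod_(a <- r) ('X - a%:P).
Proof.
have [n] := ubnP (size p); elim: n p => // n IHn p pn p0.
have [/size_poly1P[c c0 ->]|/K_closed[a /factor_theorem[q pE]]] := boolP (size p == 1%N).
  by exists c, [::]; rewrite big_nil alg_polyC.
have q0 : q != 0 by apply: contraNneq p0 => q0; rewrite pE q0 mul0r.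
have [|c [r [c0 qE]]] := IHn q _ q0.
  by move: pn; rewrite pE size_Mmonic ?monicXsubC // size_XsubC addn2.
by exists c, (a :: r); rewrite big_cons pE {1}qE -scalerAl mulrC.
Qed.

(** For non-constant p a root of p - 1 serves. *)
Lemma closed_nonroot (p : {poly K}) : p != 0 -> exists a, p.[a] != 0.
Proof.
move=> p0; have [/size_poly1P[c c0 ->]|p1] := boolP (size p == 1%N).
  by exists 0; rewrite hornerC.
have [|a] := K_closed (p := p - 1).
  rewrite -(opprK (p - 1)) size_polyN opprB; apply: contra p1 => /size_poly1P[c c0 pE].
  rewrite (_ : p = (1 - c)%:P); last by rewrite polyCB -pE; ring.
  apply/size_poly1P; exists (1 - c) => //; apply: contraNneq p0 => c1.
  by rewrite -(subKr 1 p) pE -polyCB c1.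
by rewrite /root hornerD hornerN hornerC subr_eq0 => /eqP pa; exists a; rewrite pa oner_neq0.
Qed.

Lemma eval1_prod z c (r : seq K) :
  ev1 z (c *: \prod_(a <- r) ('X - a%:P)) = j c * \prod_(a <- r) (z - j a).
Proof.
rewrite -mul_polyC rmorphM /= eval1C rmorph_prod; congr (_ * _).
by apply: eq_bigr => a _; rewrite rmorphB /= eval1X eval1C.
Qed.

Lemma eval1_inj z p : ~ range j z -> ev1 z p = 0 -> p = 0.
Proof.
move=> zK pz; apply/eqP; apply: contra_notT zK => /closed_split[c [r [c0 pE]]].
move/eqP: pz; rewrite pE eval1_prod mulf_eq0 fmorph_eq0 (negPf c0) /=.
rewrite prodf_seq_eq0 => /hasP[a _ /= /eqP za]; exists a => //.
by apply/eqP; rewrite eq_sym -subr_eq0 za.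
Qed.

Lemma range_field_gen0 : range j = field_gen j set0.
Proof.
apply/seteqP; split=> [_ [a _ <-]|]; first exact: field_gen_base.
by apply: field_gen_min => //; exact: range_divring.
Qed.

(** If no constant were congruent to y, all y - c would be units, hence so would all non-zero
    polynomials in y, which split into linear factors. Then V would contain K(y), and with it F,
    which is algebraic over K(y). *)
Lemma residue_constant V y : valuation_ring V -> range j `<=` V -> V <> setT ->
  ~ range j y -> V y -> exists c, vmax V (y - j c).
Proof.
move=> vV KV VT yK Vy; apply: contrapT => nc; apply: VT; apply/seteqP; split=> // x _.
have unit_y p : p != 0 -> V (ev1 y p)^-1.
  move=> /closed_split[c [r [c0 ->]]]; rewrite eval1_prod invfM.
  apply: vrM => //; first by rewrite -fmorphV; apply: KV; exists c^-1.
  elim: r => [|a r IHr]; first by rewrite big_nil invr1; apply: vr1.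
  rewrite big_cons invfM; apply: vrM => //; have Vya : V (y - j a).
    by apply: vrB => //; apply: KV; exists a.
  by have [|//] := vmax_notV Vya; apply: contra_not nc => ya; exists a.
apply: (vr_algebraic vV (field_gen_closed j [set y]) _ (trdeg1 yK x)).
rewrite -[[set y]]set0U => t /(field_gen_frac range_field_gen0)[a [b [b0 ->]]].
rewrite -!eval1E; apply: vrM => //.
  by apply: vr_horner => // i; rewrite coef_map; apply: KV; exists a`_i.
by apply: unit_y; apply: contraNneq b0 => ->; rewrite rmorph0 horner0.
Qed.

(* This is the field K(z, y) when y is algebraic over K(z). *)
Definition gen_by z y : set F := [set x | exists g h, ev1 z h != 0 /\ x = ev2 z y g / ev1 z h].

Lemma primitive_element z (X : seq F) : ~ range j z ->
  exists y, [set` X] `<=` gen_by z y.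
Proof.
move=> zK; have [E [v vE]] := field_gen_type j [set z].
have E_char0 : [pchar E] =i pred0.
  by move=> p; rewrite -(fmorph_pchar v) (fmorph_pchar j) K_char0.
have alg x : exists2 q : {poly E}, q != 0 & root (map_poly v q) x.
  by have := trdeg1 zK x; rewrite -vE => /algebraic_rangeP.
have [y Xy] : exists y, forall x, x \in X -> exists q, eval1 v y q = x.
  elim: X => [|x X [y Xy]]; first by exists 0.
  have [q q0 qy] := alg y.
  have [qx0 qx00 qx0x] := alg x.
  have [n [[qx xE] [qy' yE]]] := pchar0_PET qx00 qx0x q0 qy E_char0.
  exists (y *+ n - x) => t; rewrite inE => /orP[/eqP->|/Xy[p <-]]; first by exists qx.
  by exists (p \Po qy'); rewrite eval1E map_comp_poly horner_comp yE.
exists y => x /Xy[q <-].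
have [|h [g [h0 hg]]] := @clear_denominators _ _ j _ j set0 z (map_poly v q) range_field_gen0.
  by rewrite set0U -vE; apply: map_polyOver_range.
exists g, h; split=> //; rewrite eval2E -hg hornerZ mulrAC divff // mul1r.
by rewrite eval1E.
Qed.

Definition plane_model z y (P : {poly {poly K}}) m := [/\ P \is monic, size P = m.+1,
  (0 < m)%N, ev2 z y P = 0 & forall r : {poly {poly K}}, (size r <= m)%N -> ev2 z y r = 0 -> r = 0].

Lemma eval2_sum z y n (g : {poly {poly K}}) : (size g <= n)%N ->
  ev2 z y g = \sum_(i < n) ev1 z g`_i * y ^+ i.
Proof.
move=> gn; rewrite eval2E (horner_coef_wide (n := n)).
  by apply: eq_bigr => i _; rewrite coef_map.
exact: leq_trans (size_poly _ _) gn.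
Qed.

Lemma plane_model_exists z y0 : ~ range j z ->
  exists y P m, plane_model z y P m /\ gen_by z y0 `<=` gen_by z y.
Proof.
move=> zK.
have ex : exists n, `[< exists g, [/\ g != 0, ev2 z y0 g = 0 & size g = n] >].
  have [p [pK p0 py]] := trdeg1 zK y0.
  have [|h [g [h0 hg]]] := @clear_denominators _ _ j _ j set0 z p range_field_gen0.
    by rewrite set0U.
  exists (size g); apply/asboolP; exists g; split=> //.
    apply: contraNneq p0 => g0; move/eqP: hg; rewrite g0 rmorph0 scaler_eq0.
    by rewrite (negPf h0).
  by rewrite eval2E -hg hornerZ (rootP py) mulr0.
case: (ex_minnP ex) => n /asboolP[G [G0 Gy <-]] minG {ex n}.
have {}minG (r : {poly {poly K}}) : (size r < size G)%N -> ev2 z y0 r = 0 -> r = 0.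
  move=> rG ry; apply/eqP; apply: contraTT rG => r0; rewrite -leqNgt; apply: minG.
  by apply/asboolP; exists r.
pose d := lead_coef G; have d0 : d != 0 by rewrite lead_coef_eq0.
have dz : ev1 z d != 0 by apply/eqP => /(eval1_inj zK)/eqP; rewrite (negPf d0).
have [m Gm] : exists m, size G = m.+2.
  have : (1 < size G)%N.
    rewrite ltnNge; apply/negP => /size1_polyC GE; move: Gy G0.
    by rewrite GE eval2C => /(eval1_inj zK) ->; rewrite polyC0 eqxx.
  by case: (size G) => [|[|m]] // _; exists m.
(* This is d^m G(Y/d): multiplying y0 by the leading coefficient d of its minimal relation makes it
   integral. *)
pose P : {poly {poly K}} := \poly_(i < m.+2) (if i == m.+1 then 1 else G`_i * d ^+ (m - i)).
pose y := ev1 z d * y0.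
have PE i : P`_i = if (i < m.+2)%N then if i == m.+1 then 1 else G`_i * d ^+ (m - i) else 0.
  by rewrite coef_poly.
have Pm : size P = m.+2 by rewrite size_poly_eq // eqxx oner_neq0.
have yP : ev2 z y P = 0.
  rewrite (eval2_sum _ _ (eq_leq Pm)).
  transitivity (ev1 z d ^+ m * ev2 z y0 G); last by rewrite Gy mulr0.
  rewrite (eval2_sum _ _ (eq_leq Gm)) mulr_sumr; apply: eq_bigr => i _.
  rewrite PE ltn_ord; case: eqVneq => [->|im].
    rewrite rmorph1 mul1r /y exprMn exprS mulrA; congr (_ * _); rewrite mulrC.
    by congr (_ * ev1 z _); rewrite /d lead_coefE Gm.
  have {}im : (i <= m)%N by have := ltn_ord i; rewrite ltnS leq_eqVlt (negPf im).
  rewrite rmorphM rmorphXn /= /y exprMn [LHS]mulrA [RHS]mulrA; congr (_ * _).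
  by rewrite -mulrA -exprD subnK // mulrC.
exists y, P, m.+1; split.
  split=> //; first by rewrite monicE lead_coefE Pm PE ltnSn eqxx.
  move=> r rm ry; pose r' : {poly {poly K}} := \poly_(i < m.+1) (r`_i * d ^+ i).
  have r'0 : r' = 0.
    apply: minG; first by rewrite Gm ltnS size_poly.
    transitivity (ev2 z y r) => //; rewrite (eval2_sum _ _ (size_poly _ _)) (eval2_sum _ _ rm).
    apply: eq_bigr => i _; rewrite coef_poly ltn_ord rmorphM rmorphXn /= /y exprMn.
    by rewrite mulrA.
  apply/polyP => i; rewrite coef0; have [im|im] := ltnP i m.+1; last first.
    by rewrite nth_default // (leq_trans rm).
  have /polyP/(_ i)/eqP := r'0; rewrite coef_poly im coef0 mulf_eq0 expf_eq0 (negPf d0) andbF orbF.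
  by move=> /eqP.
move=> _ [g [h [h0 ->]]]; pose N := size g.
exists (\poly_(i < N) (g`_i * d ^+ (N - i))), (d ^+ N * h).
rewrite !rmorphM rmorphXn /= mulf_neq0 ?expf_neq0 //; split=> //.
have -> : ev2 z y (\poly_(i < N) (g`_i * d ^+ (N - i))) = ev1 z d ^+ N * ev2 z y0 g.
  rewrite (eval2_sum _ _ (size_poly _ _)) (eval2_sum _ _ (leqnn _)) mulr_sumr.
  apply: eq_bigr => i _; rewrite coef_poly ltn_ord rmorphM rmorphXn /= /y exprMn.
  rewrite [LHS]mulrA -[X in X * _]mulrA -exprD subnK ?(ltnW (ltn_ord i)) //; ring.
by rewrite invfM mulrACA divff ?expf_neq0 // mul1r.
Qed.

End PlaneModel.

Section SimplePoint.
Variables (K F : fieldType) (j : {rmorphism K -> F}).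
Hypothesis K_char0 : [pchar K] =i pred0.
Hypothesis K_closed : forall p : {poly K}, size p != 1%N -> exists x, root p x.
Hypothesis trdeg1 : forall y, ~ range j y -> forall x, algebraic_over (field_gen j [set y]) x.

Notation ev1 := (eval1 j).
Notation ev2 := (eval2 j).
Definition point_eval : K -> K -> {poly {poly K}} -> K := eval2 (idfun : {rmorphism K -> K}).
HB.instance Definition _ a b := GRing.RMorphism.on (point_eval a b).
Notation pt := point_eval.

Lemma eval2B z y g h : ev2 z y (g - h) = ev2 z y g - ev2 z y h.
Proof. exact: raddfB. Qed.

Lemma pointE a b g : pt a b g = (map_poly (horner_eval a) g).[b].
Proof.
rewrite /point_eval eval2E; congr (_.[b]); apply: eq_map_poly => p.
by rewrite eval1E map_poly_id // => x.
Qed.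

Lemma pointC a b c : pt a b c%:P = c.[a].
Proof. by rewrite pointE map_polyC hornerC. Qed.

Lemma plane_model_dvd z y P m r : plane_model j z y P m -> ev2 z y r = 0 -> exists q, r = q * P.
Proof.
move=> [Pm Ps m0 Py Pmin] ry; exists (Pdiv.Ring.rdivp r P).
have rE := Pdiv.RingMonic.rdivp_eq Pm r.
rewrite {1}rE [Pdiv.Ring.rmodp r P]Pmin ?addr0 //.
  by rewrite -ltnS -Ps Pdiv.Ring.ltn_rmodpN0 // monic_neq0.
by move: ry; rewrite {1}rE rmorphD rmorphM /= Py mulr0 add0r.
Qed.

(** A substitute for the norm: after removing powers of the variable, an equation of x over K[z] has
    a constant term h that is not zero, and x divides the sum of the other terms. *)
Lemma gen_norm z y g : ~ range j z -> ev2 z y g != 0 ->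
  exists g' h, h != 0 /\ ev2 z y (g * g') = ev1 z h.
Proof.
move=> zK; set x := ev2 z y g => x0.
have [p [pK p0 px]] := trdeg1 zK x.
have [|d [q0 [d0 dq]]] :=
  @clear_denominators _ _ j _ j set0 z p (range_field_gen0 j); first by rewrite set0U.
have q00 : q0 != 0.
  apply: contraNneq p0 => g0; move/eqP: dq; rewrite g0 rmorph0 scaler_eq0.
  by rewrite (negPf d0).
have q0x : ev2 z x q0 = 0 by rewrite eval2E -dq hornerZ (rootP px) mulr0.
have [i [q /implyP/(_ q00) q1 qE]] := multiplicity_XsubC q0 0.
move: q0x; rewrite qE rmorphM rmorphXn /= subr0 eval2X => /eqP.
rewrite mulf_eq0 expf_eq0 (negPf x0) andbF orbF => /eqP qx.
exists (- (drop_poly 1 q \Po g)), q`_0; split; first by rewrite -horner_coef0.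
have comp r : ev2 z y (r \Po g) = ev2 z x r.
  by rewrite !eval2E map_comp_poly horner_comp.
rewrite rmorphM rmorphN /= comp -/x; apply/eqP; rewrite mulrN eqr_oppLR -addr_eq0 -qx.
rewrite -[X in _ == ev2 z x X](poly_take_drop 1 q) rmorphD rmorphM /= expr1 eval2X.
rewrite addrC [x * _]mulrC (_ : take_poly 1 q = (q`_0)%:P) ?eval2C //.
by apply/polyP => -[|l]; rewrite coef_take_poly coefC.
Qed.

Lemma eval1_shift z a p : ev1 (z - j a) (p \Po ('X + a%:P)) = ev1 z p.
Proof.
by rewrite !eval1E map_comp_poly horner_comp rmorphD /= map_polyX map_polyC !hornerE subrK.
Qed.

Lemma eval2_shift z a y g : ev2 (z - j a) y (map_poly (comp_poly ('X + a%:P)) g) = ev2 z y g.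
Proof.
rewrite !eval2E -map_poly_comp; congr (_.[y]); apply: eq_map_poly => p.
exact: eval1_shift.
Qed.

Lemma gen_by_shift z a y : gen_by j z y `<=` gen_by j (z - j a) y.
Proof.
move=> _ [g [h [h0 ->]]].
exists (map_poly (comp_poly ('X + a%:P)) g), (h \Po ('X + a%:P)).
by rewrite eval2_shift eval1_shift.
Qed.

(* The fibre z = 0 of the curve P(z, y) = 0 has a simple point y = b. *)
Definition good_model z y P m Q b := [/\ plane_model j z y P m,
  map_poly (horner_eval 0) P = ('X - b%:P) * Q & Q.[b] != 0].

(** The norm h of the derivative of P in y plays the role of a discriminant: over a point a with
    h(a) different from 0 the fibre has no multiple root. The excluded a1 and a2 will be the values
    of z at the two given places. *)
Lemma good_model_exists z y P m a1 a2 : ~ range j z -> plane_model j z y P m ->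
  exists a P' Q b, [/\ a != a1, a != a2 & good_model (z - j a) y P' m Q b].
Proof.
move=> zK Pmod; have [Pm Ps m0 Py Pmin] := Pmod.
have m_neq0 : (m%:R : {poly K}) != 0.
  by rewrite -polyC_natr polyC_eq0 (pcharf0P _).1 // -lt0n.
have P'0 : ev2 z y P^`() != 0.
  apply/eqP => /Pmin h; have /polyP/(_ m.-1) : P^`() = 0.
    by apply: h; rewrite -ltnS -Ps lt_size_deriv // monic_neq0.
  have := Pm; rewrite monicE lead_coefE Ps /= => /eqP P1.
  by rewrite coef_deriv prednK // P1 coef0; apply/eqP.
have [g' [h [h0 hE]]] := gen_norm zK P'0.
have [|q qE] := @plane_model_dvd z y P m (P^`() * g' - h%:P) Pmod.
  by rewrite eval2B hE eval2C subrr.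
have [|a] := closed_nonroot K_closed (p := h * (('X - a1%:P) * ('X - a2%:P))).
  by rewrite !mulf_neq0 // polyXsubC_eq0.
rewrite !hornerE !mulf_eq0 !negb_or !subr_eq0 => /andP[/andP[ha aa1] aa2].
pose Pa := map_poly (horner_eval a) P.
have Pas : size Pa = m.+1.
  rewrite size_map_poly_id0 // (eqP Pm) /horner_eval hornerC; exact: oner_neq0.
have [|b Pab] := K_closed (p := Pa).
  by rewrite Pas eqSS -lt0n.
have /factor_theorem[Q QE] := Pab.
pose P1 := map_poly (comp_poly ('X + a%:P)) P.
have P1a : map_poly (horner_eval 0) P1 = Pa.
  rewrite /P1 -map_poly_comp; apply: eq_map_poly => p /=.
  by rewrite /horner_eval /= horner_comp !hornerE.
exists a, P1, Q, b; split=> //; split.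
- split=> //.
  + exact: monic_map.
  + by rewrite size_map_poly_id0 // (eqP Pm) /= comp_polyC oner_neq0.
  + by rewrite eval2_shift.
  + move=> r rm ry; pose r' := map_poly (comp_poly ('X - a%:P)) r.
    have rE : r = map_poly (comp_poly ('X + a%:P)) r'.
      rewrite /r' -map_poly_comp map_poly_id // => p _ /=.
      by rewrite -comp_polyA comp_polyB comp_polyX comp_polyC addrK comp_polyXr.
    rewrite rE [r']Pmin ?rmorph0 //; first by apply: leq_trans rm; apply: size_poly.
    by rewrite -(eval2_shift _ a) -rE.
- by rewrite P1a QE mulrC.
have : pt a b (P^`() * g' - h%:P) = 0.
  by rewrite qE rmorphM /= [pt a b P]pointE (rootP Pab) mulr0.
rewrite rmorphB rmorphM /= pointC => /eqP; rewrite subr_eq0 => /eqP Pg.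
have : pt a b P^`() != 0.
  by apply: contraNneq ha => P'ab; rewrite /root -Pg P'ab mul0r.
rewrite pointE -deriv_map -/Pa QE derivM derivXsubC mulr1 hornerD hornerM.
by rewrite hornerXsubC subrr mulr0 add0r.
Qed.

End SimplePoint.

Lemma left_kernel_exists (K : fieldType) n (M : 'M[K]_(n.+1, n)) :
  exists2 u : 'rV_n.+1, u != 0 & u *m M = 0.
Proof.
have : kermx M != 0.
  by rewrite -mxrank_eq0 mxrank_ker -lt0n subn_gt0 ltnS rank_leq_col.
by move=> /rowV0Pn[u /sub_kermxP uM u0]; exists u.
Qed.

Section CurveFunctions.
Variables (K F : fieldType) (j : {rmorphism K -> F}).
Variables (z y : F) (P : {poly {poly K}}) (m : nat) (Q : {poly K}) (b : K).
Hypothesis zK : ~ range j z.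
Hypothesis model : good_model j z y P m Q b.

Notation ev1 := (eval1 j).
Notation ev2 := (eval2 j).
Notation pt := point_eval.

Let z0 : z != 0.
Proof. by apply: contra_notN zK => /eqP ->; exists 0; rewrite ?rmorph0. Qed.

Lemma poly_split0 (p : {poly K}) : p = (p.[0])%:P + 'X * drop_poly 1 p.
Proof.
by apply/polyP => -[|i]; rewrite coefD coefC coefXM /= ?addr0 ?add0r
  ?horner_coef0 // coef_drop_poly addn1.
Qed.

Definition drop_fibre (g : {poly {poly K}}) : {poly {poly K}} := map_poly (drop_poly 1) g.

Lemma fibre_split (g : {poly {poly K}}) :
  g = map_poly polyC (map_poly (horner_eval 0) g) + 'X%:P * drop_fibre g.
Proof.
apply/polyP => i; rewrite coefD coefCM !coef_map /=.
exact: poly_split0.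
Qed.

Lemma eval2_lift q : ev2 z y (map_poly polyC q) = ev1 y q.
Proof.
rewrite eval2E -map_poly_comp; congr (_.[y]); apply: eq_map_poly => c /=.
exact: eval1C.
Qed.

(** The expansion of P along z = 0. It shows that Q(y)/z is regular at the points of this fibre
    other than y = b, as one may divide by y - b. *)
Lemma curve_equation : (y - j b) * ev1 y Q = - (z * ev2 z y (drop_fibre P)).
Proof.
have [[_ _ _ Py _] PQ _] := model.
move: Py; rewrite {1}[P]fibre_split rmorphD rmorphM /= eval2_lift PQ eval2C eval1X.
rewrite (rmorphM (eval1 j y)) rmorphB /= eval1X eval1C.
by move/eqP; rewrite addr_eq0 => /eqP.
Qed.

Section Valuation.
Variable V : set F.
Hypotheses (vV : valuation_ring V) (KV : range j `<=` V).

Let Vj c : V (j c). Proof. by apply: KV; exists c. Qed.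

Lemma eval1_vr t p : V t -> V (ev1 t p).
Proof. by move=> Vt; apply: vr_horner => // i; rewrite coef_map; apply: Vj. Qed.

Lemma ordinate_integral : V z -> V y.
Proof.
have [[Pm _ _ Py _] _ _] := model => Vz.
apply: (vr_integral vV (p := map_poly (ev1 z) P)); first exact: monic_map.
  by move=> i; rewrite coef_map; apply: eval1_vr.
exact/rootP.
Qed.

Lemma eval2_vr g : V z -> V (ev2 z y g).
Proof.
move=> Vz; apply: vr_horner => //; last exact: ordinate_integral.
by move=> i; rewrite coef_map; apply: eval1_vr.
Qed.

Lemma cofactor_unit : vmax V (y - j b) ->
  [/\ ev1 y Q != 0, V (ev1 y Q) & V (ev1 y Q)^-1].
Proof.
have [_ _ Qb] := model => yb; rewrite -(eval1_shift j y b).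
by apply: eval1_unit => //; rewrite horner_comp !hornerE.
Qed.

Lemma eval1_point p : vmax V z -> vmax V (ev1 z p - j p.[0]).
Proof.
move=> zm; rewrite {1}[p]poly_split0 rmorphD rmorphM /= eval1C eval1X addrAC subrr add0r.
by rewrite mulrC; apply: vmaxM => //; apply: eval1_vr; apply: vmaxW.
Qed.

Lemma eval2_point g : vmax V z -> vmax V (y - j b) -> vmax V (ev2 z y g - j (pt 0 b g)).
Proof.
move=> zm ym; have Vz := vmaxW vV zm; have Vy := ordinate_integral Vz.
elim/poly_ind: g => [|g c IHg]; first by rewrite !rmorph0 subr0; left.
rewrite !rmorphD !rmorphM /= !eval2X !eval2C pointC.
rewrite (_ : pt 0 b 'X = b); last by rewrite pointE map_polyX hornerX.
set G := ev2 z y g in IHg *; set g0 := j (pt 0 b g) in IHg *.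
rewrite (_ : _ - _ = (y * (G - g0) + g0 * (y - j b)) + (ev1 z c - j c.[0])); last by ring.
apply: vmaxD => //; last exact: eval1_point.
by apply: vmaxD => //; apply: vmaxM => //; rewrite /g0.
Qed.

Lemma eval2_point_unit g : vmax V z -> vmax V (y - j b) -> pt 0 b g != 0 ->
  [/\ ev2 z y g != 0, V (ev2 z y g) & V (ev2 z y g)^-1].
Proof.
move=> zm ym g0; have gm := eval2_point g zm ym.
have [|u0 Vu VuV] := vmax1D vV (_ : vmax V (j (pt 0 b g)^-1 * (ev2 z y g - j (pt 0 b g)))).
  by apply: vmaxM.
have gE : ev2 z y g = j (pt 0 b g) * (1 + j (pt 0 b g)^-1 * (ev2 z y g - j (pt 0 b g))).
  by rewrite mulrDr mulr1 mulrA -rmorphM divff // rmorph1 mul1r addrC subrK.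
rewrite gE; split; first by rewrite mulf_neq0 ?fmorph_eq0.
  by apply: vrM.
by rewrite invfM -fmorphV; apply: vrM.
Qed.

End Valuation.

(* The powers of Q(y)/z have poles only where z = 0 or infinity. There are more of
   them than conditions for the part at infinity, a polynomial in z^-1, to
   vanish to order N, once the terms A0 regular for z finite are set aside. *)
Lemma one_pole_coefficients N : exists (L : {poly K}) (U : 'I_m -> {poly K}) A0,
  [/\ L != 0, L`_0 = 0 & ev1 (ev1 y Q / z) L =
    \sum_(l < m) y ^+ l * (ev1 z^-1 (U l) * z^-1 ^+ N) + ev2 z y A0].
Proof.
have [[Pm Ps m0 Py Pmin] _ _] := model.
pose H i := Pdiv.Ring.rmodp (map_poly polyC Q ^+ i.+1) P.
have Hs i : (size (H i) <= m)%N.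
  by rewrite -ltnS -Ps Pdiv.Ring.ltn_rmodpN0 // monic_neq0.
have HE i : ev2 z y (H i) = ev1 y Q ^+ i.+1.
  rewrite -eval2_lift -rmorphXn [X in _ = ev2 z y X](Pdiv.RingMonic.rdivp_eq Pm).
  by rewrite rmorphD rmorphM /= Py mulr0 add0r.
(* Here z^-(i+1) times the l-th coefficient of [H i] is split: the terms of degree at most i in z
   give a polynomial in z^-1 without constant term, the others go into A0. *)
pose U i l : {poly K} := \sum_(e < i.+1) (H i)`_l`_e *: 'X^(i.+1 - e).
have UE i l : ev1 z^-1 (U i l) = ev1 z (take_poly i.+1 (H i)`_l) * z^-1 ^+ i.+1.
  rewrite rmorph_sum eval1E (horner_coef_wide (n := i.+1)); last first.
    exact: leq_trans (size_poly _ _) (size_take_poly _ _).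
  rewrite mulr_suml; apply: eq_bigr => e _ /=.
  rewrite -mul_polyC rmorphM rmorphXn /= eval1C eval1X coef_map coef_take_poly ltn_ord.
  rewrite -mulrA; congr (_ * _).
  rewrite -[X in _ = _ * _ ^+ X](subnKC (ltnW (ltn_ord e))) exprD mulrA -exprMn.
  by rewrite divff // expr1n mul1r.
pose D := (N * m)%N.
pose M : 'M[K]_(D.+1, D) :=
  \matrix_(i < D.+1) mxvec (\matrix_(a < N, l < m) (U i l)`_a).
have [u u0 uM] := left_kernel_exists M.
have uU (a : 'I_N) (l : 'I_m) : \sum_i u 0 i * (U i l)`_a = 0.
  have := congr1 (fun v : 'rV_D => v 0 (mxvec_index a l)) uM.
  rewrite !mxE => uMal; rewrite -[RHS]uMal.
  by apply: eq_bigr => i _; rewrite !mxE mxvecE mxE.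
pose Us l : {poly K} := \sum_(i < D.+1) u 0 i *: U i l.
exists (\sum_(i < D.+1) u 0 i *: 'X^(i.+1)), (fun l => drop_poly N (Us l)),
  (\sum_(i < D.+1) (u 0 i)%:P%:P * \poly_(l < m) drop_poly i.+1 (H i)`_l).
split.
- apply: contraNneq u0 => L0; apply/eqP/rowP => i; rewrite mxE.
  have /polyP/(_ i.+1) := L0; rewrite coef_sum coef0 => <-.
  rewrite (bigD1 i) //= coefZ coefXn eqxx mulr1 big1 ?addr0 // => i' i'i.
  by rewrite coefZ coefXn eqSS val_eqE eq_sym (negPf i'i) mulr0.
- by rewrite coef_sum big1 // => i _; rewrite coefZ coefXn mulr0.
have UsE (l : 'I_m) : ev1 z^-1 (drop_poly N (Us l)) * z^-1 ^+ N = ev1 z^-1 (Us l).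
  rewrite -[in RHS](poly_take_drop N (Us l)) rmorphD rmorphM rmorphXn /= eval1X.
  rewrite (_ : take_poly N (Us l) = 0) ?rmorph0 ?add0r //.
  apply/polyP => a; rewrite coef_take_poly coef0; case: ltnP => // aN.
  rewrite coef_sum -[RHS](uU (Ordinal aN) l); apply: eq_bigr => i _.
  by rewrite coefZ.
rewrite (eq_bigr (fun l : 'I_m =>
    \sum_(i < D.+1) y ^+ l * (j (u 0 i) * ev1 z^-1 (U i l)))); last first.
  move=> l _; rewrite UsE rmorph_sum mulr_sumr; apply: eq_bigr => i _ /=.
  by rewrite -mul_polyC rmorphM /= eval1C.
rewrite exchange_big !rmorph_sum -big_split; apply: eq_bigr => i _ /=.
rewrite -mul_polyC rmorphM rmorphXn /= eval1C eval1X exprMn -HE.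
rewrite rmorphM /= !eval2C eval1C !(eval2_sum _ _ _ (size_poly _ _)) (eval2_sum _ _ _ (Hs i)).
rewrite mulr_suml [LHS]mulr_sumr [X in _ + X]mulr_sumr -big_split; apply: eq_bigr => l _ /=.
rewrite UE coef_poly ltn_ord -[in LHS](poly_take_drop i.+1 (H i)`_l).
rewrite rmorphD rmorphM rmorphXn /= eval1X.
have zz : z ^+ i.+1 * z^-1 ^+ i.+1 = 1 by rewrite -exprMn divff // expr1n.
rewrite -[ev1 z (drop_poly _ _) in RHS]mulr1 -[in RHS]zz.
by move: (z ^+ i.+1) (z^-1 ^+ i.+1) => Z W; ring.
Qed.

End CurveFunctions.

Section OnePoleFunction.
Variables (K F : fieldType) (j : {rmorphism K -> F}).
Hypothesis trdeg1 : forall y, ~ range j y -> forall x, algebraic_over (field_gen j [set y]) x.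
Variables (z y : F) (P : {poly {poly K}}) (m : nat) (Q : {poly K}) (b : K).
Hypothesis zK : ~ range j z.
Hypothesis model : good_model j z y P m Q b.

Notation ev1 := (eval1 j).
Notation ev2 := (eval2 j).
Notation pt := point_eval.

Let z0 : z != 0.
Proof. by apply: contra_notN zK => /eqP ->; exists 0; rewrite ?rmorph0. Qed.

Definition k_ring V := valuation_ring V /\ range j `<=` V.

(* If g vanishes at the point (0, b), then so does its norm h, and dividing g by z,
   up to the unit Q(y), lowers the degree of h. *)
Lemma local_expansion V g : k_ring V -> vmax V z -> vmax V (y - j b) -> ev2 z y g != 0 ->
  exists i c1 c2, [/\ pt 0 b c1 != 0, pt 0 b c2 != 0 &
    ev2 z y g * ev2 z y c2 = z ^+ i * ev2 z y c1].
Proof.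
move=> [vV KV] zm ym g0; have Vz := vmaxW vV zm.
have [_ _ Qb] := model.
have [Q0 VQ VQV] := cofactor_unit model vV KV ym.
have ptQ : pt 0 b (map_poly polyC Q) = Q.[b].
  rewrite pointE -map_poly_comp; congr (_.[b]); rewrite map_poly_id // => c _ /=.
  by rewrite /horner_eval hornerC.
have [g' [h [h0 gh]]] := gen_norm trdeg1 zK g0.
suff main n : forall (h : {poly K}) (g g' : {poly {poly K}}) e, (size h <= n)%N -> h != 0 ->
    ev2 z y g * ev2 z y g' = ev1 y Q ^+ e * ev1 z h ->
    exists i c1 c2, [/\ pt 0 b c1 != 0, pt 0 b c2 != 0 &
      ev2 z y g * ev2 z y c2 = z ^+ i * ev2 z y c1].
  by apply: (main (size h) h g g' 0%N) => //; rewrite expr0 mul1r -rmorphM.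
elim: n => [|n IHn] {h0 gh g0}h {}g {}g' e.
  by rewrite leqn0 size_poly_eq0 => ->.
move=> hn h0 gh.
have [g0|g0] := eqVneq (pt 0 b g) 0; last first.
  by exists 0%N, g, 1; rewrite !rmorph1 oner_neq0 mulr1 mul1r.
have /factor_theorem[r rE] : root (map_poly (horner_eval 0) g) b.
  by rewrite /root -pointE g0.
have gE : ev2 z y g = ev1 y r * (y - j b) + z * ev2 z y (drop_fibre g).
  rewrite {1}[g]fibre_split rmorphD rmorphM /= eval2_lift eval2C eval1X rE.
  by rewrite (rmorphM (eval1 j y)) rmorphB /= eval1X eval1C.
have h00 : root h 0.
  apply: contraT => /negP h00; have [] : ~ vmax V (ev2 z y g * ev2 z y g').
    have [|h1 Vh VhV] := eval1_unit vV KV zm (q := h); first exact/negP.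
    rewrite gh; apply: vmax_unit; first by rewrite mulf_neq0 ?expf_neq0.
    by rewrite invfM -exprVn; apply: vrM => //; apply: vrX.
  rewrite mulrC; apply: vmaxM => //; first exact: (eval2_vr model vV KV _ Vz).
  by have := eval2_point model vV KV g zm ym; rewrite g0 rmorph0 subr0.
have [h1 hE] := factor_theorem h 0 h00.
rewrite subr0 in hE.
have h10 : h1 != 0 by apply: contraNneq h0 => h10; rewrite hE h10 mul0r.
(* Since g vanishes at the point, it is r(y)(y - b) plus a multiple of z. After multiplication by
   Q(y) the curve equation makes the first term divisible by z too. *)
pose g1 := drop_fibre g * map_poly polyC Q - map_poly polyC r * drop_fibre P.
have g1E : z * ev2 z y g1 = ev2 z y g * ev1 y Q.
  rewrite gE /g1 eval2B !rmorphM /= !eval2_lift mulrDl -[ev1 y r * _ * _]mulrA.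
  by rewrite (curve_equation model); ring.
have [|||i [c1 [c2 [pc1 pc2 cE]]]] := IHn h1 g1 g' e.+1 => //.
- by move: hn; rewrite hE size_mulX.
- apply: (mulfI z0); rewrite mulrA g1E mulrAC gh hE rmorphM /= eval1X exprS; ring.
exists i.+1, c1, (map_poly polyC Q * c2); split=> //.
  by rewrite rmorphM /= ptQ mulf_neq0.
rewrite rmorphM /= eval2_lift mulrA -g1E -mulrA cE exprS; ring.
Qed.

(** At the simple point (0, b), z is a uniformizer: x is a unit times z^(i-l). The identities giving
    i and l hold in F, so they serve for every valuation centred there. *)
Lemma centered_agree V V' x : k_ring V -> k_ring V' -> vmax V z -> vmax V (y - j b) ->
  vmax V' z -> vmax V' (y - j b) -> gen_by j z y x -> V x <-> V' x.
Proof.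
move=> kV kV' zV yV zV' yV' [g [h [h0 xE]]].
have [x0|x0] := eqVneq x 0.
  by rewrite x0; split=> _; apply: vr0; [case: kV'|case: kV].
have g0 : ev2 z y g != 0 by move: x0; rewrite xE mulf_eq0 negb_or => /andP[].
have h0' : ev2 z y h%:P != 0 by rewrite eval2C.
have [i [c1 [c2 [pc1 pc2 cE]]]] := local_expansion kV zV yV g0.
have [l [d1 [d2 [pd1 pd2 dE]]]] := local_expansion kV zV yV h0'.
have val W : k_ring W -> vmax W z -> vmax W (y - j b) -> W x <-> (l <= i)%N.
  move=> [vW KW] zW yW.
  have u c : pt 0 b c != 0 -> [/\ ev2 z y c != 0, W (ev2 z y c) & W (ev2 z y c)^-1].
    exact: (eval2_point_unit model vW KW zW yW).
  have [c10 c1W c1V] := u _ pc1; have [c20 c2W c2V] := u _ pc2.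
  have [d10 d1W d1V] := u _ pd1; have [d20 d2W d2V] := u _ pd2.
  have -> : x = (ev2 z y c1 / ev2 z y c2) * z ^+ i / (ev2 z y d1 / ev2 z y d2 * z ^+ l).
    have -> : ev2 z y c1 / ev2 z y c2 * z ^+ i = ev2 z y g.
      by apply: (mulIf c20); rewrite cE mulrAC divfK // mulrC.
    have -> : ev2 z y d1 / ev2 z y d2 * z ^+ l = ev1 z h.
      by apply: (mulIf d20); rewrite -(eval2C j z y) dE mulrAC divfK // mulrC.
    exact: xE.
  by apply: vr_uniformizer => //; split; rewrite ?mulf_neq0 ?invr_eq0 ?invf_div //; apply: vrM.
by rewrite (val V) // (val V').
Qed.

Lemma ordinate_integral_infinity V : k_ring V -> V z^-1 -> V (y * z^-1 ^+ sizeY P).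
Proof.
move=> [vV KV] Vw; have [[Pm Ps m0 Py _] _ _] := model.
(* R(Y) is z^(-cm) P(z, z^c Y). As c bounds the degrees in z of the coefficients of P, those of R
   are polynomials in z^-1. *)
set c := sizeY P; pose R := \poly_(i < m.+1) (ev1 z P`_i * z^-1 ^+ (c * (m - i))).
have RE i : (i < m.+1)%N -> R`_i = ev1 z P`_i * z^-1 ^+ (c * (m - i)).
  by move=> im; rewrite coef_poly im.
have Pm1 : P`_m = 1 by have := Pm; rewrite monicE lead_coefE Ps => /eqP.
have Rm : R`_m = 1 by rewrite RE // subnn muln0 expr0 mulr1 Pm1 rmorph1.
have Rs : size R = m.+1 by rewrite size_poly_eq // -RE // Rm oner_neq0.
apply: (vr_integral vV (p := R)).
- by rewrite monicE lead_coefE Rs Rm.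
- move=> i; have [im|im] := ltnP i m.+1; last by rewrite nth_default ?Rs //; apply: vr0.
  have [->|im'] := eqVneq i m; first by rewrite Rm; apply: vr1.
  have {im'}im' : (i < m)%N by rewrite ltn_neqAle im'.
  rewrite RE // eval1E horner_coef mulr_suml; apply: vr_sum => // e _.
  rewrite coef_map -mulrA; apply: vrM => //; first by apply: KV; exists (P`_i)`_e.
  have ec : (e <= c * (m - i))%N.
    apply: leq_trans (ltnW (ltn_ord e)) _; apply: leq_trans (size_poly _ _) _.
    apply: leq_trans (max_size_coefXY P i) _.
    by rewrite leq_pmulr // subn_gt0.
  rewrite -(subnKC ec) exprD mulrA -exprMn divff // expr1n mul1r; exact: vrX.
- rewrite /root horner_coef Rs; apply/eqP.
  transitivity (z^-1 ^+ (c * m) * ev2 z y P); last by rewrite Py mulr0.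
  rewrite (eval2_sum _ _ _ (eq_leq Ps)) mulr_sumr; apply: eq_bigr => i _.
  rewrite RE // exprMn -exprM.
  have -> : (c * m = c * (m - i) + c * i)%N by rewrite -mulnDr subnK // -ltnS.
  by rewrite exprD; ring.
Qed.

(** One function has two expressions. Where z^-1 is regular, the sum with factors z^-N shows that f
    is regular; where z vanishes, f is a polynomial in Q(y)/z up to a regular term, and Q(y)/z is
    regular unless y - b vanishes as well. *)
Lemma one_pole_function : exists f, [/\ gen_by j z y f, ~ range j f,
  forall V, k_ring V -> V z^-1 -> V f &
  forall V, k_ring V -> ~ V f -> vmax V z /\ vmax V (y - j b)].
Proof.
have [[Pm Ps m0 Py Pmin] PQ Qb] := model.
(* This order of vanishing compensates the powers y^l with l < m, because y z^(-c) is regular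
   wherever z^-1 is, with c = [sizeY P]. *)
have [L [U [A0 [L0 L00 LE]]]] := one_pole_coefficients zK model (sizeY P * m).
set s := ev1 _ L in LE; pose f := s - ev2 z y A0.
have fE : f = \sum_(l < m) y ^+ l * (ev1 z^-1 (U l) * z^-1 ^+ (sizeY P * m)).
  by rewrite /f LE addrK.
have [d Ls] : exists d, size L = d.+2.
  have : (1 < size L)%N.
    rewrite ltnNge; apply/negP => /size1_polyC LC; move: L0.
    by rewrite LC L00 polyC0 eqxx.
  by case: (size L) => [|[|d]] // _; exists d.
(* B0 represents z^(d+1) L(Q(y)/z). At the point (0, b) only the leading term of L survives, with
   the non-zero factor Q(b)^(d+1), so f cannot be constant. *)
pose B0 := \sum_(i < d.+2) (L`_i)%:P%:P * map_poly polyC Q ^+ i * ('X ^+ (d.+1 - i))%:P.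
have B0E : ev2 z y B0 = z ^+ d.+1 * s.
  rewrite /s eval1E (horner_coef_wide (n := d.+2)); last by rewrite -Ls size_poly.
  rewrite rmorph_sum mulr_sumr; apply: eq_bigr => i _ /=.
  rewrite !rmorphM rmorphXn /= eval2_lift !eval2C eval1C rmorphXn /= eval1X coef_map.
  rewrite exprMn; have id : (i <= d.+1)%N by rewrite -ltnS.
  have -> : z ^+ d.+1 = z ^+ (d.+1 - i) * z ^+ i by rewrite -exprD subnK.
  have zi : z ^+ i * z^-1 ^+ i = 1 by rewrite -exprMn divff // expr1n.
  rewrite -[LHS]mulr1 -[in LHS]zi.
  by move: (z ^+ i) (z^-1 ^+ i) (z ^+ (d.+1 - i)) => Z W T; ring.
have fN c : ev2 z y (B0 - ('X ^+ d.+1)%:P * (A0 + c%:P%:P)) = z ^+ d.+1 * (f - j c).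
  rewrite eval2B B0E rmorphM rmorphD /= !eval2C eval1C rmorphXn /= eval1X /f.
  by move: (z ^+ _) => Z; ring.
have fw V : k_ring V -> V z^-1 -> V f.
  move=> kV Vw; have [vV KV] := kV; rewrite fE; apply: vr_sum => // l _.
  have Vyw := ordinate_integral_infinity kV Vw.
  have -> : (sizeY P * m = sizeY P * l + sizeY P * (m - l))%N.
    by rewrite -mulnDr subnKC // ltnW.
  rewrite exprD; set c := sizeY P in Vyw *.
  have -> : y ^+ l * (ev1 z^-1 (U l) * (z^-1 ^+ (c * l) * z^-1 ^+ (c * (m - l)))) =
      (y * z^-1 ^+ c) ^+ l * (ev1 z^-1 (U l) * z^-1 ^+ (c * (m - l))).
    by rewrite exprMn -exprM; ring.
  apply: vrM => //; first exact: vrX.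
  by apply: vrM => //; [apply: eval1_vr|apply: vrX].
exists f; split.
- exists (B0 - ('X ^+ d.+1)%:P * (A0 + 0%:P%:P)), ('X ^+ d.+1).
  by rewrite fN rmorphXn /= eval1X expf_neq0 // rmorph0 subr0 mulrAC divff ?expf_neq0 ?mul1r.
- move=> [c _ cf]; have [||q qE] := @plane_model_dvd _ _ j z y P m
    (B0 - ('X ^+ d.+1)%:P * (A0 + c%:P%:P)).
  + by have [] := model.
  + by rewrite fN cf subrr mulr0.
  have ptP : pt 0 b P = 0 by rewrite pointE PQ hornerM hornerXsubC subrr mul0r.
  have ptQ : pt 0 b (map_poly polyC Q) = Q.[b].
    rewrite pointE -map_poly_comp; congr (_.[b]); rewrite map_poly_id // => e _ /=.
    by rewrite /horner_eval hornerC.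
  have : pt 0 b B0 = 0.
    have := congr1 (pt 0 b) qE.
    rewrite [pt 0 b (q * P)]rmorphM /= ptP mulr0 rmorphD rmorphN rmorphM /=.
    by rewrite pointC hornerXn expr0n /= mul0r subr0.
  rewrite rmorph_sum big_ord_recr /= big1 => [|i _].
    rewrite add0r subnn expr0 mulr1 rmorphM rmorphXn /= ptQ pointC hornerC => /eqP.
    rewrite mulf_eq0 expf_eq0 (negPf Qb) andbF orbF => /eqP Ld.
    by move: L0; rewrite -lead_coef_eq0 lead_coefE Ls Ld eqxx.
  rewrite rmorphM /= pointC hornerXn expr0n subn_eq0 leqNgt ltnS /=.
  by rewrite -ltnS ltn_ord /= mulr0.
- exact: fw.
- move=> V kV Vf; have [vV KV] := kV.
  have zw : ~ V z^-1.
    by move=> /(fw _ kV).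
  have zm : vmax V z by right.
  have Vz := vmaxW vV zm; have Vy := ordinate_integral model vV KV Vz.
  split=> //; apply: contrapT => ym.
  have [|yb0 ybV] := vmax_notV (_ : V (y - j b)) ym.
    by apply: vrB => //; apply: KV; exists b.
  apply: Vf; apply: vrB => //; last exact: (eval2_vr model vV KV _ Vz).
  apply: eval1_vr => //.
  have -> : ev1 y Q / z = - (ev2 z y (drop_fibre P) / (y - j b)).
    apply: (mulIf z0); rewrite divfK //; apply: (mulfI yb0).
    by rewrite (curve_equation model); field.
  by apply: vrN => //; apply: vrM => //; apply: (eval2_vr model vV KV _ Vz).
Qed.

End OnePoleFunction.

Section UniquePole.
Variables (K F : fieldType) (j : {rmorphism K -> F}).
Hypothesis K_char0 : [pchar K] =i pred0.
Hypothesis K_closed : forall p : {poly K}, size p != 1%N -> exists x, root p x.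
Hypothesis trdeg1 : forall y, ~ range j y -> forall x, algebraic_over (field_gen j [set y]) x.

Lemma gen_by_closed z y : ~ range j z -> divring_closed [in gen_by j z y].
Proof.
move=> zK; apply/divring_closedP; split.
- by exists 1, 1; rewrite !rmorph1 oner_neq0 divr1.
- move=> _ _ [a [b [b0 ->]]] [c [d [d0 ->]]].
  exists (a * d%:P - c * b%:P), (b * d).
  rewrite eval2B !rmorphM /= !eval2C mulf_neq0 //; split=> //.
  by rewrite -[- (_ / _)]mulNr addf_div // mulNr.
- move=> _ _ [a [b [b0 ->]]] [c [d [d0 ->]]].
  have [c0|c0] := eqVneq (eval2 j z y c) 0.
    by exists 0, 1; rewrite rmorph0 rmorph1 oner_neq0 c0 !(mul0r, invr0, mulr0).
  have [c' [h [h0 ch]]] := gen_norm trdeg1 zK c0.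
  have hz : eval1 j z h != 0 by apply: contra_neq h0; apply: eval1_inj.
  exists (a * d%:P * c'), (b * h); rewrite !rmorphM /= eval2C mulf_neq0 //; split=> //.
  rewrite -ch rmorphM /= in hz *; have c'0 : eval2 j z y c' != 0.
    by move: hz; rewrite mulf_eq0 negb_or => /andP[].
  by field; rewrite b0 c0 c'0.
Qed.

Lemma gen_by_base z y a : gen_by j z y (j a).
Proof. by exists a%:P%:P, 1; rewrite rmorph1 oner_neq0 eval2C eval1C divr1. Qed.

(** The pole of f is placed over a value of z that z takes neither at V1 nor at V2. So f is regular
    there, and the values of f at V1 and V2 can be subtracted without creating new poles. L is the
    field K(z, y). *)
Lemma unique_pole (X : seq F) V1 V2 z : ~ range j z ->
    k_ring j V1 -> V1 <> setT -> k_ring j V2 -> V2 <> setT ->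
  exists (u : F) (L : set F),
    [/\ divring_closed [in L], range j `<=` L, [set` X] `<=` L & L u] /\
    [/\ ~ range j u, vmax V1 u, vmax V2 u & forall V V', k_ring j V -> k_ring j V' ->
      ~ V u -> ~ V' u -> forall x, L x -> V x <-> V' x].
Proof.
move=> zK kV1 V1T kV2 V2T.
have [y0 Xy0] := primitive_element K_char0 trdeg1 X zK.
have [y [P [m [Pmod y0y]]]] := plane_model_exists K_closed trdeg1 y0 zK.
(* If z has no value in K at V, the default 0 is merely one more excluded point. *)
have centre V : k_ring j V -> exists a, forall c, vmax V (z - j c) -> c = a.
  move=> [vV KV]; have [[a za]|na] := pselect (exists a, vmax V (z - j a)).
    exists a => c zc; apply/eqP; rewrite -subr_eq0; apply/negPn/negP => ca.
    have jca : j (c - a) != 0 by rewrite fmorph_eq0.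
    case: (@vmax_unit _ V _ jca).
    - by rewrite -fmorphV; apply: KV; exists (c - a)^-1.
    - by rewrite rmorphB (_ : _ - _ = (z - j a) - (z - j c)); [apply: vmaxB|ring].
  by exists 0 => c zc; case: na; exists c.
have [a1 a1P] := centre _ kV1; have [a2 a2P] := centre _ kV2.
have [a [P' [Q [b [aa1 aa2 mod']]]]] :=
  good_model_exists K_char0 K_closed trdeg1 a1 a2 zK Pmod.
have zaK : ~ range j (z - j a).
  by move=> [c _ cz]; apply: zK; exists (c + a) => //; rewrite rmorphD cz subrK.
have [f [fL fK fw fpole]] := one_pole_function zaK mod'.
have regular V a' : k_ring j V -> (forall c, vmax V (z - j c) -> c = a') -> a != a' ->
    V <> setT -> exists c, vmax V (f - j c).
  move=> kV a'P aa' VT; have [vV KV] := kV.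
  apply: (residue_constant K_closed trdeg1 vV KV VT fK); apply: fw => //.
  apply: contrapT => zV; case/eqP: aa'; apply: a'P.
  by right.
have [c1 fc1] := regular _ _ kV1 a1P aa1 V1T; have [c2 fc2] := regular _ _ kV2 a2P aa2 V2T.
(* f has values c1 at V1 and c2 at V2. *)
pose u := (f - j c1) * (f - j c2).
have Lf : divring_closed [in gen_by j (z - j a) y] by apply: gen_by_closed.
have Lj c : gen_by j (z - j a) y (j c) by apply: gen_by_base.
have f_regular V c : k_ring j V -> V f -> V (f - j c).
  by move=> [vV KV] Vf; apply: vrB => //; apply: KV; exists c.
exists u, (gen_by j (z - j a) y); split.
  split=> //; first by move=> _ [c _ <-].
    by move=> x /Xy0/y0y/gen_by_shift.
  have [E [v vE]] := subfield_type Lf; rewrite -vE in fL Lj *.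
  have [[e _ ef] [e1 _ e1E] [e2 _ e2E]] := And3 fL (Lj c1) (Lj c2).
  by exists ((e - e1) * (e - e2)) => //; rewrite rmorphM !rmorphB ef e1E e2E.
split.
- move=> [c _ cu]; pose p := ('X - c1%:P) * ('X - c2%:P) - c%:P.
  have p0 : p = 0.
    apply: (eval1_inj K_closed fK); rewrite /p rmorphB rmorphM !rmorphB /= eval1X !eval1C cu.
    by rewrite subrr.
  have /eqP := congr1 (fun q : {poly K} => size (q + c%:P)) p0.
  rewrite subrK add0r size_Mmonic ?monicXsubC ?polyXsubC_eq0 // !size_XsubC size_polyC.
  by case: (c != 0).
- have [vV1 KV1] := kV1; rewrite /u mulrC; apply: vmaxM => //; apply: f_regular => //.
  by apply: fw => //; apply: contrapT => zV; case/eqP: aa1; apply: a1P; right.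
- have [vV2 KV2] := kV2; rewrite /u; apply: vmaxM => //; apply: f_regular => //.
  by apply: fw => //; apply: contrapT => zV; case/eqP: aa2; apply: a2P; right.
have pole V : k_ring j V -> ~ V u -> vmax V (z - j a) /\ vmax V (y - j b).
  move=> kV Vu; apply: fpole => // Vf; apply: Vu.
  by have [vV _] := kV; apply: vrM => //; apply: f_regular.
move=> V V' kV kV' Vu V'u x Lx.
have [zV yV] := pole _ kV Vu; have [zV' yV'] := pole _ kV' V'u.
exact: (centered_agree trdeg1 zaK mod' kV kV' zV yV zV' yV' Lx).
Qed.

End UniquePole.

(** * Realization of partial isomorphisms *)

Section GeneratedSubgroup.
Variables (k F : fieldType) (iota : {rmorphism k -> F}).
Implicit Types (A : set (autgroup iota)) (s t : autgroup iota).

Lemma gen_subgroup_closed A : group_closed [in gen_subgroup A].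
Proof.
split=> [|s t /set_mem sH /set_mem tH]; apply/mem_set => S [[S1 SB] AS].
  exact: set_mem.
by apply/set_mem/SB; apply/mem_set; [apply: sH|apply: tH].
Qed.

Lemma sub_gen_subgroup A : A `<=` gen_subgroup A.
Proof. by move=> s As S [_]; apply. Qed.

Lemma gen_subgroupV A s : gen_subgroup A s -> gen_subgroup A (s^-1)%g.
Proof.
move=> /mem_set sH; apply/set_mem.
exact: (group_closedV (gen_subgroup_closed A) sH).
Qed.

Lemma gen_subgroupM A s t : gen_subgroup A s -> gen_subgroup A t -> gen_subgroup A (s * t)%g.
Proof.
move=> /mem_set sH /mem_set tH; apply/set_mem.
exact: (group_closedM (gen_subgroup_closed A) sH tH).
Qed.

Lemma gen_subgroupJ A s t u : gen_subgroup A s -> gen_subgroup A t -> gen_subgroup A u ->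
  gen_subgroup A (s^-1 * (u * t))%g.
Proof. by move=> sH tH uH; apply: gen_subgroupM; [apply: gen_subgroupV|apply: gen_subgroupM]. Qed.

End GeneratedSubgroup.

Section Moves.
Variables (k : fieldType) (F : closedFieldType) (iota : {rmorphism k -> F}).
Implicit Types (O B : set F) (t : F) (s : seq F).
Notation acl := (acl iota).

Lemma decomposition_groupI O (s : autgroup iota) : (forall x, O x <-> O (s x)) ->
  decomposition_group iota O s.
Proof.
move=> sO; apply/seteqP; split=> [_ [x Ox <-]|y Oy]; first exact: (sO x).1.
by exists (autinv s y); rewrite ?autKV //; apply/(sO _); rewrite autKV.
Qed.

Lemma adapted_neqT O B t : adapted iota O B t -> O <> setT.
Proof. by move=> [_ _ [->|tm] /eqP t0 _] OT //; apply: tm; rewrite OT. Qed.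

Lemma acl_codim1 s u y : indep iota set0 s -> ~ acl [set` s] y -> (size s).+1 = size u ->
  acl [set` u] = setT -> acl ([set` s] `|` [set y]) = setT.
Proof.
move=> s_ind ys su uT.
have -> : [set` s] `|` [set y] = [set` s ++ [:: y]].
  apply/seteqP; split=> x /=; rewrite mem_cat inE.
    by move=> [->//|->]; rewrite eqxx orbT.
  by move=> /orP[|/eqP]; [left|right].
have [||_ h] := @steinitz _ _ iota set0 (s ++ [:: y]) u.
- by apply/indep_cat; rewrite set0U; split.
- by rewrite set0U uT.
apply/seteqP; split=> // x _; have : acl [set` u] x by rewrite uT.
by apply: acl_sub; rewrite -[[set` s ++ _]]set0U; apply: h; rewrite size_cat addn1.
Qed.

(** By Steinitz B' cannot be smaller than s: t with s is independent, and t' with B' generates F up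
    to algebraic elements. *)
Lemma adapted_seq O B t O' B' t' s : adapted iota O B t -> adapted iota O' B' t' ->
  uniq s -> [set` s] `<=` B -> exists s', [/\ uniq s', [set` s'] `<=` B' & size s' = size s].
Proof.
move=> [kV Bf tm t0 _] [_ _ _ _ BtT'] s_uniq sB.
have [St tB] := vfree_acl_free kV Bf tm t0.
suff h n : (n <= size s)%N -> exists s', [/\ uniq s', [set` s'] `<=` B' & size s' = n].
  exact: h.
elim: n => [|n IHn] ns; first by exists [::].
have [s' [s'_uniq s'B' s'n]] := IHn (ltnW ns).
have [b' Bb' bs'] : exists2 b', B' b' & b' \notin s'.
  apply: contrapT => nb'; have B's' : B' `<=` [set` s'].
    by move=> b' Bb'; apply: contrapT => bs'; apply: nb'; exists b' => //; apply/negP.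
  have [||+ _] := @steinitz _ _ iota set0 (t :: s) (t' :: s').
  - apply: acl_free_indep St _ _ _ => //.
      by rewrite setD0 set_seq_cons => x [->|/sB]; [right|left].
    by rewrite /= s_uniq andbT; apply/negP => /sB.
  - rewrite set0U => x _; have : acl (B' `|` [set t']) x by rewrite BtT'.
    by apply: acl_mono => y; rewrite set_seq_cons => -[/B's'|->]; [right|left].
  by rewrite /= s'n ltnS leqNgt ns.
exists (b' :: s'); split=> /=; rewrite ?s'n ?bs' //.
by rewrite set_seq_cons => x [->|/s'B'].
Qed.

(** Weak approximation finds images close to b at O and close to the prescribed element at O';
    [perturb_move] realizes them inside G_v. *)
Lemma approx_move O O' B t s s' y0 : adapted iota O B t -> k_valuation iota O' ->
    O' <> setT -> O <> O' -> uniq s -> [set` s] `<=` B -> size s' = size s ->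
    vmax O y0 -> y0 != 0 ->
  exists p : autgroup iota, [/\ forall x, O x <-> O (p x), p t = y0 &
    forall i, (i < size s)%N -> vmax O' (p s`_i - s'`_i)].
Proof.
move=> BtO [V' kO' A'] O'T OO' s_uniq sB ss' y0m y00; have [[V kO A] _ _ _ _] := BtO.
have /choice[f fP] b : exists y, (vmax O (y - b)) /\
    (b \in s -> vmax O' (y - s'`_(index b s))) /\ (b \notin s -> y = b).
  have [bs|bs] := boolP (b \in s).
    have [y [yb ys']] := weak_approximation V V' A A' (adapted_neqT BtO) O'T OO' b
      s'`_(index b s).
    by exists y.
  by exists b; split=> //; rewrite subrr; left.
have [||p [pO pf pt]] := @perturb_move _ _ iota O B t f s y0 BtO _ _ y0m y00.
- by move=> b _; case: (fP b).
- by move=> b _ bs; case: (fP b) => _ [_ ->].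
exists p; split=> // i si; have si' := mem_nth 0 si.
rewrite pf; last exact: sB.
by have [_ [/(_ si') + _]] := fP s`_i; rewrite index_uniq.
Qed.

(** The image of u is chosen in the maximal ideal of O with a pole at O'. The images of s are
    congruent to s' at O', so they are residually independent and O' is trivial on the field they
    generate. *)
Lemma finite_move O O' s u s' : adapted iota O [set` s] u -> uniq s ->
    k_valuation iota O' -> vfree iota O' [set` s'] -> uniq s' -> size s' = size s ->
    O' <> setT -> O <> O' ->
  exists p : autgroup iota, [/\ forall x, O x <-> O (p x),
    forall x, acl [set` s] x -> O' (p x) & ~ O' (p u)].
Proof.
move=> suO s_uniq kV' s'f s'_uniq ss' O'T OO'.
have [[V _ A] _ _ _ _] := suO; have [V' _ A'] := kV'.
have [y0 [y00 y0m y0O']] := separating_element V V' A A' (adapted_neqT suO) O'T OO'.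
have [p [pO pu pss']] := approx_move suO kV' O'T OO' s_uniq (@subset_refl _ _) ss' y0m y00.
exists p; split=> [//|x xs|]; last by rewrite pu.
pose f' x := p s`_(index x s').
have [|s'f' _] := @vfree_perturb _ _ iota O' [set` s'] f' kV' s'f.
  move=> b bs'; rewrite -{2}(nth_index 0 bs'); apply: pss'.
  by rewrite -ss' index_mem.
apply: (vfree_acl kV' s'f'); suff -> : f' @` [set` s'] = p @` [set` s] by apply/acl_aut.
apply/seteqP; split=> [_ [b bs' <-]|_ [b bs <-]].
  by exists s`_(index b s') => //=; rewrite mem_nth // -ss' index_mem.
have bi : (index b s < size s')%N by rewrite ss' index_mem.
by exists s'`_(index b s); rewrite /f' /= ?mem_nth // index_uniq // nth_index.
Qed.

End Moves.

Lemma infinite_uniq_seq (T : eqType) (B : set T) n : infinite_set B ->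
  exists s, [/\ uniq s, [set` s] `<=` B & size s = n].
Proof.
move=> Binf; elim: n => [|n [s [s_uniq sB <-]]]; first by exists [::].
have [b Bb bs] : exists2 b, B b & b \notin s.
  apply: contrapT => nb; apply: Binf; apply: sub_finite_set (finite_seq s) => b Bb.
  by apply: contrapT => bs; apply: nb; exists b => //; apply/negP.
exists (b :: s); split; rewrite //= ?bs // => x.
by rewrite /= inE => /orP[/eqP->|/sB].
Qed.

(** * The case of infinite residual transcendence degree *)

Section Infinite.
Variables (k : fieldType) (F : closedFieldType) (iota : {rmorphism k -> F}).
Implicit Types (O B : set F) (t : F) (s : seq F).
Notation acl := (acl iota).

Lemma piso_conj (p : autgroup iota) G : piso iota setT setT G ->
  piso iota setT setT [set (p z.1, p z.2) | z in G].
Proof.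
have [g gp] := aut_rmorphism p.
have -> : [set (p z.1, p z.2) | z in G] = [set (g z.1, g z.2) | z in G].
  by apply: eq_imagel => z _; rewrite !gp.
move=> [[G1 GB GV] Gk G0 _]; split=> //.
- split; first by exists (1, 1) => //=; rewrite rmorph1.
    move=> _ _ _ _ [[x x'] xG [<- <-]] [[y y'] yG [<- <-]] /=.
    by exists (x - y, x' - y'); [apply: GB|rewrite /= !rmorphB].
  move=> _ _ _ _ [[x x'] xG [<- <-]] [[y y'] yG [<- <-]] /=.
  by exists (x / y, x' / y'); [apply: GV|rewrite /= !fmorph_div].
- by move=> a; exists (iota a, iota a) => //=; rewrite gp aut_iota.
- move=> _ _ [[x x'] /G0 xG [<- <-]] /=.
  by split=> /eqP; rewrite fmorph_eq0 => /eqP/xG ->; rewrite rmorph0.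
Qed.

(** First p makes the images of t and s congruent at O' to s', where the extra element of s' is the
    partner of t. Then q, a perturbation at O', carries s' exactly to these images. *)
Lemma adapted_move O O' B t B' t' s s' : adapted iota O B t -> adapted iota O' B' t' ->
    O <> O' -> uniq s -> [set` s] `<=` B -> uniq s' -> [set` s'] `<=` B' ->
    size s' = (size s).+1 ->
  exists p q : autgroup iota, [/\ forall x, O x <-> O (p x), forall x, O' x <-> O' (q x) &
    map q s' = map p (t :: s)].
Proof.
move=> BtO BtO' OO' s_uniq sB; case: s' => // b0 s' s'_uniq s'B' [ss'].
have [[V kO A] Bf tm t0 BtT] := BtO; have [[V' kO' A'] Bf' tm' t'0 BtT'] := BtO'.
have OT := adapted_neqT BtO; have OT' := adapted_neqT BtO'.
have [kV kV'] : k_valuation iota O /\ k_valuation iota O' by [].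
have [y0 [y0t y0b0]] := weak_approximation V V' A A' OT OT' OO' t b0.
have B'b0 : B' b0 by apply: s'B'; rewrite /= inE eqxx.
have y0m : vmax O y0 by rewrite -(subrK t y0); apply: vmaxD.
have y00 : y0 != 0.
  apply/eqP => y0E; rewrite y0E sub0r in y0b0.
  have b0m : vmax O' b0 by rewrite -(opprK b0); apply: vmaxN.
  by apply: (vfree_vmax kV' Bf' b0m (vfree_neq0 kV' Bf' B'b0)); apply: sub_acl.
have s'B'1 : [set` s'] `<=` B' by move=> x xs'; apply: s'B'; rewrite /= inE xs' orbT.
have [p [pO pt pss']] := approx_move BtO kV' OT' OO' s_uniq sB ss' y0m y00.
pose f x := if x \in b0 :: s' then (map p (t :: s))`_(index x (b0 :: s')) else x.
have [||q [qO qf _]] := @perturb_move _ _ iota O' B' t' f (b0 :: s') t' BtO' _ _ tm' t'0.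
- move=> b _; rewrite /f; case: ifP => bs; last by rewrite subrr; left.
  rewrite -{2}(nth_index 0 bs); have : (index b (b0 :: s') < (size s).+1)%N.
    by rewrite -ss' -[(size s').+1]/(size (b0 :: s')) index_mem.
  case: (index b _) => [|i] /=; first by rewrite pt.
  by rewrite ltnS => si; rewrite (nth_map 0) //; apply: pss'.
- by move=> b _ /negPf bs; rewrite /f bs.
exists p, q; split=> //; apply: (@eq_from_nth _ 0); first by rewrite !size_map /= ss'.
move=> i; rewrite size_map => si; have si' := mem_nth 0 si.
rewrite (nth_map 0) // qf; last exact: s'B'.
by rewrite /f si' index_uniq.
Qed.

Lemma realize_infinite O O' B t B' t' G (P : seq (F * F)) : infinite_set B ->
    adapted iota O B t -> adapted iota O' B' t' -> O <> O' -> piso iota setT setT G ->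
    G `<=` acl [set` map fst P] `*` acl [set` map snd P] ->
  exists2 h, gen_subgroup (decomposition_group iota O `|` decomposition_group iota O') h &
    forall z, G z -> h z.1 = z.2.
Proof.
move=> Binf BtO BtO' OO' Giso GP; set H := gen_subgroup _.
have [kV Bf tm t0 BtT] := BtO; have [kV' Bf' tm' t'0 BtT'] := BtO'.
have [V' _ A'] := kV'.
have [|u [uB lu]] := @acl_finite_seq _ _ iota (B `|` [set t]) (map fst P ++ map snd P).
  by rewrite BtT.
pose s := undup [seq b <- u | b \in B].
have s_uniq : uniq s by apply: undup_uniq.
have sB : [set` s] `<=` B by move=> x; rewrite /= mem_undup mem_filter => /andP[/set_mem].
have us : acl [set` u] `<=` acl [set` t :: s].
  apply: acl_mono => x /= xu; rewrite inE mem_undup mem_filter xu andbT.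
  by have /set_mem[/mem_set ->|->] := uB x xu; rewrite ?orbT ?eqxx.
have {}GP : G `<=` acl [set` t :: s] `*` acl [set` t :: s].
  move=> z /GP[z1 z2]; split; [move: z1|move: z2]; apply: acl_sub => x xP; apply/us/lu.
    by rewrite /= mem_cat [_ \in _]xP.
  by rewrite /= mem_cat [X in _ || X]xP orbT.
(* Infinitude of B supplies one element more than s has, so that t gets a partner too. *)
have [s2 [s2_uniq s2B s2s]] := infinite_uniq_seq (size s).+1 Binf.
have [s' [s'_uniq s'B' s's]] := adapted_seq BtO BtO' s2_uniq s2B.
rewrite s2s in s's.
have [p [q [pO qO' qp]]] := adapted_move BtO BtO' OO' s_uniq sB s'_uniq s'B' s's.
have pH : H p by apply: sub_gen_subgroup; left; apply: decomposition_groupI.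
have qH : H q by apply: sub_gen_subgroup; right; apply: decomposition_groupI.
pose r : autgroup iota := (q^-1 * p)%g.
have rH : H r by apply: gen_subgroupM => //; apply: gen_subgroupV.
have rE x : r x = autinv q (p x) by [].
have rs : r @` acl [set` t :: s] `<=` acl [set` s'].
  move=> _ [x xs <-]; have : acl (r @` [set` t :: s]) (r x) by apply/acl_aut.
  apply: acl_mono => _ [y ys <-]; rewrite rE.
  have : p y \in map q s' by rewrite qp map_f.
  by move=> /mapP[b bs' ->]; rewrite autVK.
have [St' tB'] := vfree_acl_free kV' Bf' tm' t'0.
set R := (B' `\` [set` s']) `|` [set t'].
have ts' : ~ [set` s'] t' by move=> /s'B'.
have RT : acl ([set` s'] `|` R) = setT.
  apply/seteqP; split=> // x _; have : acl (B' `|` [set t']) x by rewrite BtT'.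
  apply: acl_mono => y [By|->]; last by right; right.
  by have [ys|ys] := pselect ([set` s'] y); [left|right; left].
have [|||||tau [tauG tauR taus]] := @extend_aut _ _ iota s' R [set (r z.1, r z.2) | z in G].
- apply: acl_free_indep St' _ _ _ => //.
  by rewrite setD0 => x /s'B'; left.
- move=> l l_uniq lR; apply: acl_free_indep St' _ _ l_uniq; first by move=> x /s'B'; left.
  by move=> x /lR/set_mem[[Bx xs]|->]; split=> //; [left|right].
- exact: RT.
- exact: piso_conj.
- move=> _ [z /GP[z1 z2] <-].
  by split=> /=; apply: rs; [exists z.1|exists z.2].
(* O' is trivial on k(D), tau maps D onto itself and fixes t', so [correct_aut] applies. The
   correction fixes D, hence does not disturb the conjugated isomorphism. *)
pose D := acl [set` s'] `|` (B' `\` [set` s']).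
have DB' : D `<=` acl B'.
  by move=> x [|[Bx _]]; [apply: acl_mono|apply: sub_acl].
have DO' : field_gen iota D `<=` O'.
  apply: subset_trans (vfree_acl kV' Bf'); apply: field_gen_min DB'.
    exact: acl_closed.
  by move=> _ [a _ <-]; apply: acl_base.
have tauD : tau @` D = D.
  rewrite image_setU taus; congr (_ `|` _).
  by apply/seteqP; split=> [_ [b bB <-]|b bB]; [rewrite tauR //; left|
    exists b => //; rewrite tauR //; left].
have taut : autinv tau t' = t' by rewrite -{1}(tauR t') ?autVK //; right.
have [|||h hD hO'] := @correct_aut _ _ iota O' tau D t' V' A' DO' _ t'0 tm'.
- by rewrite -tauD field_gen_aut => _ [x xD <-] /=; rewrite autVK; apply: DO'.
- by rewrite taut.
- apply/seteqP; split=> // x _; have : acl ([set` s'] `|` R) x by rewrite RT.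
  apply: acl_mono => y [ys|[yB|yt]]; [left; left|left; right|right] => //.
  exact: sub_acl.
have htH : H (h * tau)%g.
  by apply: sub_gen_subgroup; right; apply: decomposition_groupI.
exists (r^-1 * ((h * tau) * r))%g; first exact: gen_subgroupJ.
move=> z Gz; apply: (can_inj (autVK r)); rewrite -[RHS]/(r z.2).
have -> : (r^-1 * ((h * tau) * r) : autgroup iota)%g z.1 = autinv r (h (tau (r z.1))) by [].
rewrite autKV (tauG _ (r z.2)); last by exists z.
rewrite hD //; apply: sub_field_gen; left; left; apply: rs; exists z.2 => //.
by have [] := GP z Gz.
Qed.

End Infinite.

(** * The case of finite residual transcendence degree *)

Section Finite.
Variables (k : fieldType) (F : closedFieldType) (iota : {rmorphism k -> F}).
Implicit Types (O B : set F) (t : F) (s : seq F).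
Notation acl := (acl iota).

Lemma acl_type_closed D (E : fieldType) (j : {rmorphism E -> F}) (p : {poly E}) :
  range j = acl D -> size p != 1%N -> exists x, root p x.
Proof.
move=> jD p1; have [->|p0] := eqVneq p 0; first by exists 0; rewrite root0.
have /closed_rootP[x px] : size (map_poly j p) != 1%N by rewrite size_map_poly.
have : acl D x.
  apply: algebraic_over_acl; rewrite -jD; exists (map_poly j p).
  by rewrite map_poly_eq0; split=> //; apply: map_polyOver_range.
by rewrite -jD => -[e _ ex]; exists e; rewrite -(fmorph_root j) ex.
Qed.

Lemma realize_finite O O' s t B' t' G (P : seq (F * F)) : [pchar F] =i pred0 -> uniq s ->
    adapted iota O [set` s] t -> adapted iota O' B' t' -> O <> O' ->
    piso iota setT setT G ->
  exists2 h, gen_subgroup (decomposition_group iota O `|` decomposition_group iota O') h &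
    forall z, G z -> z \in P -> h z.1 = z.2.
Proof.
move=> F0 s_uniq stO BtO' OO' Giso; set H := gen_subgroup _.
have [kV sf tm t0 stT] := stO; have [kV' Bf' _ _ _] := BtO'.
have [V kO A] := kV; have [V' kO' A'] := kV'.
have [St ts] := vfree_acl_free kV sf tm t0.
have [OT OT'] := (adapted_neqT stO, adapted_neqT BtO').
have tsT : acl [set` t :: s] = setT by rewrite set_seq_cons setUC.
(* Here t with s is a transcendence basis of F, so nothing is left to be fixed and R is empty. *)
have [|||||sig [sigG _ _]] := @extend_aut _ _ iota (t :: s) set0 G.
- apply: acl_free_indep St _ _ _ => //=; last by rewrite s_uniq andbT; apply/negP.
  by rewrite setD0 set_seq_cons => x [->|]; [right|left].
- by move=> [|a r] // _ r0; case: (set_mem (r0 a (mem_head a r))).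
- by rewrite setU0.
- exact: Giso.
- by rewrite tsT.
pose W := sig @^-1` O.
have [WO|WO] := pselect (O = W).
  exists sig; last by move=> z Gz _; apply: sigG; case: z Gz.
  by apply: sub_gen_subgroup; left; apply: decomposition_groupI => x; rewrite {1}WO.
have VW : valuation_ring W by apply: preimage_valuation_ring.
have AW : archimedean_val W by apply: preimage_archimedean.
have WT : W <> setT.
  move=> WT; apply: OT; apply/seteqP; split=> // x _; rewrite -(autKV sig x).
  by rewrite -[O _]/(W (autinv sig x)) WT.
(* Closeness to the preimage of b at W means that sigma(g b) is close to b at O. So g s and its
   image under sigma have the same residues at O as s. *)
have /choice[g gP] b := weak_approximation V VW A AW OT WT WO b (autinv sig b).
have gO b : vmax O (g b - b) by case: (gP b).
have gW b : vmax O (sig (g b) - b).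
  by case: (gP b) => _ /preimage_vmax; rewrite autB autKV.
have [//|Xf gi] := @vfree_perturb _ _ iota O [set` s] g kV sf.
have [|sXf _] := @vfree_perturb _ _ iota O [set` s] (sig \o g) kV sf.
  by move=> b _; apply: gW.
pose xs := map g s.
have xsE : [set` xs] = g @` [set` s].
  by apply/seteqP; split=> [x /mapP[b bs ->]|_ [b bs <-]]; [exists b|apply: map_f].
have sxsE : [set` map sig xs] = (sig \o g) @` [set` s].
  apply/seteqP; split=> [x /mapP[b /mapP[c cs ->] ->]|_ [b bs <-]]; first by exists c.
  by rewrite /= map_f // map_f.
have sxsE' : [set` map sig xs] = sig @` [set` xs] by rewrite sxsE xsE image_comp.
rewrite -xsE in Xf; rewrite -sxsE in sXf.
have xs_uniq : uniq xs by rewrite map_inj_in_uniq // => a b sa sb; apply: gi; apply/mem_set.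
have txs : ~ acl [set` xs] t by apply: vfree_vmax kV Xf tm t0.
have xs_ind : indep iota set0 xs.
  have [Sx _] := vfree_acl_free kV Xf tm t0.
  by apply: acl_free_indep Sx _ _ xs_uniq => //; rewrite setD0 => x; left.
have codim y : ~ acl [set` xs] y -> acl ([set` xs] `|` [set y]) = setT.
  by move=> ny; apply: (acl_codim1 xs_ind ny _ tsT); rewrite /= size_map.
have [E [j jX]] := subfield_type (acl_closed iota [set` xs]).
have kX a : acl [set` xs] (iota a) by apply: acl_base.
have XW : acl [set` xs] `<=` W.
  move=> x xX; apply: (vfree_acl kV sXf); rewrite sxsE'; exact/acl_aut.
have trd y : ~ range j y -> forall x, algebraic_over (field_gen j [set y]) x.
  rewrite jX => ny x; have : acl ([set` xs] `|` [set y]) x by rewrite codim.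
  apply: algebraic_over_sub; apply: field_gen_min; first exact: field_gen_closed.
    move=> _ [a _ <-]; have := kX a; rewrite -jX => -[e _ <-].
    exact: field_gen_base.
  move=> z [zX|->]; last exact: sub_field_gen.
  have := (@sub_acl _ _ iota [set` xs] z zX); rewrite -jX => -[e _ <-].
  exact: field_gen_base.
have E0 : [pchar E] =i pred0 by move=> q; rewrite -(fmorph_pchar j).
have kj (U : set F) : valuation_ring U -> acl [set` xs] `<=` U -> k_ring j U.
  by move=> VU XU; split=> //; rewrite jX.
have ntj : ~ range j t by rewrite jX.
have [|u [L [[Lf jL PL Lu] [uj uO uW agree]]]] :=
  unique_pole E0 (fun p => @acl_type_closed _ _ _ p jX) trd (map fst P) ntj
    (kj O V _) OT (kj W VW XW) WT.
  exact: vfree_acl.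
rewrite jX in jL uj.
have u0 : u != 0.
  by apply/eqP => u0; apply: uj; rewrite u0; apply: divring_closed0; apply: acl_closed.
(* Next to xs, u may replace t at O because it is not constant; since u lies in the maximal ideal of
   W, sigma(u) may do so next to sigma(xs). So [finite_move] applies to both. *)
have uxO : adapted iota O [set` xs] u by split=> //; apply: codim.
have uW' : vmax O (sig u) by apply/preimage_vmax.
have suxO : adapted iota O [set` map sig xs] (sig u).
  split=> //; first exact: aut_neq0.
  rewrite sxsE' -(image_set1 sig u) -image_setU; apply/seteqP; split=> // x _.
  by rewrite -(autKV sig x); apply/acl_aut; rewrite codim.
have [s' [s'_uniq s'B' ss']] := adapted_seq stO BtO' s_uniq (@subset_refl _ _).
have s'f := vfree_sub s'B' Bf'.
have [|p [pO pX pu]] := finite_move uxO xs_uniq kV' s'f s'_uniq _ OT' OO'.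
  by rewrite size_map.
have [||q [qO qX qu]] := finite_move suxO _ kV' s'f s'_uniq _ OT' OO'.
- by rewrite map_inj_uniq //; apply: can_inj (autVK sig).
- by rewrite !size_map.
pose qs : autgroup iota := (q * sig)%g.
have VU1 := preimage_valuation_ring p V'; have VU2 := preimage_valuation_ring qs V'.
(* Both preimages of O' contain [acl xs] and have a pole at u, hence agree on L; F is algebraic over
   L since L contains xs and u. *)
have [||h hL hU] := @valuation_conjugacy _ _ iota (p @^-1` O') (qs @^-1` O') L VU1 VU2
  (preimage_archimedean A') (preimage_archimedean A').
- move=> x xL; apply: agree => //; first exact: kj.
    apply: kj => // y yX; apply: qX; rewrite sxsE'; exact/acl_aut.
  move: x xL; apply: field_gen_min => //.
  by move=> _ [a _ <-]; apply: jL.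
- apply/seteqP; split=> // x _; have : acl ([set` xs] `|` [set u]) x by rewrite codim.
  by apply: acl_sub => y [yX|->]; apply: sub_acl => //; apply: jL; apply: sub_acl.
have pH : H p by apply: sub_gen_subgroup; left; apply: decomposition_groupI.
have qH : H q by apply: sub_gen_subgroup; left; apply: decomposition_groupI.
(* The automorphism h takes the preimage of O' under p to that under q sigma, so psi preserves O'.
   As a map, q^-1 psi p is sigma h, which is sigma on L. *)
pose psi : autgroup iota := (qs * (h * p^-1))%g.
have psiH : H psi.
  apply: sub_gen_subgroup; right; apply: decomposition_groupI => x.
  rewrite -{1}(autKV p x) -[O' (p _)]/((p @^-1` O') (autinv p x)); exact: hU.
exists (q^-1 * (psi * p))%g; first exact: gen_subgroupJ.
move=> z Gz zP; have zL : L z.1 by apply: PL; apply: map_f.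
have -> : (q^-1 * (psi * p) : autgroup iota)%g z.1 =
  autinv q (q (sig (h (autinv p (p z.1))))) by [].
rewrite !autVK hL; first by apply: sigG; case: z Gz {zP zL}.
exact: sub_field_gen.
Qed.

End Finite.

(** * From partial isomorphisms to embeddings and density *)

Section Transitivity.
Variables (k : fieldType) (F : closedFieldType) (iota : {rmorphism k -> F}).
Hypothesis k_char0 : [pchar k] =i pred0.
Variables (O O' : set F).
Hypotheses (PO : P1 iota O) (PO' : P1 iota O') (neqO : O <> O').
Let H := gen_subgroup (decomposition_group iota O `|` decomposition_group iota O').

Lemma realize (G : set (F * F)) (P : seq (F * F)) : piso iota setT setT G ->
    G `<=` acl iota [set` map fst P] `*` acl iota [set` map snd P] ->
  exists2 h, H h & forall z, G z -> z \in P -> h z.1 = z.2.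
Proof.
move=> Giso GP.
have [B [t BtO]] := P1_adapted PO; have [B' [t' BtO']] := P1_adapted PO'.
have [/finite_seqP[s sB]|Binf] := pselect (finite_set B).
  have {}sB : B = [set` undup s].
    by rewrite sB; apply/seteqP; split=> x /=; rewrite mem_undup.
  rewrite sB in BtO; apply: (realize_finite P _ (undup_uniq s) BtO BtO' neqO Giso).
  by move=> p; rewrite (fmorph_pchar iota).
have [h hH hG] := realize_infinite Binf BtO BtO' neqO Giso GP.
by exists h => // z /hG.
Qed.

(** The pairs (f x, g x) form a partial isomorphism, and two morphisms that agree on generators
    agree. *)
Lemma realize_embeddings (L : fieldType) (j : k -> L) (l : seq L) (f g : {rmorphism L -> F}) :
    (forall a, f (j a) = iota a) -> (forall a, g (j a) = iota a) ->
    field_gen j [set` l] = setT ->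
  exists2 h, H h & forall x, h (f x) = g x.
Proof.
move=> fj gj lT; pose P := [seq (f x, g x) | x <- l].
have seq_image (u : {rmorphism L -> F}) : [set` map u l] = u @` [set` l].
  by apply/seteqP; split=> [x /mapP[b bs ->]|_ [b bs <-]]; [exists b|apply: map_f].
have map_acl (u : {rmorphism L -> F}) e : (forall a, u (j a) = iota a) ->
    acl iota [set` map u l] (u e).
  move=> uj; apply: field_gen_acl; rewrite seq_image (field_gen_morph uj).
  by exists e; rewrite ?lT.
have [P1 P2] : map fst P = map f l /\ map snd P = map g l by rewrite -!map_comp.
have [||h hH hP] := @realize (graph_of f g) P.
- split=> //; first exact: graph_of_field.
    by move=> a; exists (j a); rewrite ?fj ?gj.
  move=> _ _ [e _ [<- <-]].
  by split=> /eqP; rewrite fmorph_eq0 => /eqP ->; rewrite rmorph0.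
- by move=> _ [e _ <-]; rewrite P1 P2; split; apply: map_acl.
exists h => // x; have [h' hh'] := aut_rmorphism h; rewrite -hh'.
suff : field_gen j [set` l] `<=` [set e | h' (f e) = g e] by apply; rewrite lT.
apply: field_gen_min.
- apply/divring_closedP; split=> [|e e' ee ee'|e e' ee ee'] /=.
  + by rewrite !rmorph1.
  + by rewrite !rmorphB ee ee'.
  + by rewrite !fmorph_div ee ee'.
- by move=> _ [a _ <-] /=; rewrite fj gj hh' aut_iota.
- move=> e le /=; rewrite hh'; apply: (hP (f e, g e)); first by exists e.
  by apply/mapP; exists e.
Qed.

End Transitivity.

Theorem proposition3p6 (k F : closedFieldType) (iota : {rmorphism k -> F})
    (n : option nat) (O O' : set F)
    (k_char0 : [pchar k] =i pred0)
    (n_gt0 : n <> Some 0%N) (trdegF : has_trdeg iota n)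
    (PO : P1 iota O) (PO' : P1 iota O') (neqO : O <> O') :
  let H := gen_subgroup
    (decomposition_group iota O `|` decomposition_group iota O') in
  (forall (L : fieldType) (j : {rmorphism k -> L}),
     finitely_generated j -> transitive_on_embeddings iota j H)
  /\ dense H.
Proof.
move=> H; split.
  move=> L j [X /finite_seqP[l ->] lT] f g fj gj.
  exact: (realize_embeddings k_char0 PO PO' neqO fj gj lT).
(* Density follows from transitivity: a neighbourhood of s is controlled by a finite list l, and the
   inclusion of k(l) and its composite with s are two embeddings of a finitely generated
   extension. *)
move=> U [s Us] /(_ s Us)[X /finite_seqP[l lX] XU].
have [E [v vl]] := field_gen_type iota [set` l].
have [s' ss'] := aut_rmorphism s.
have /choice[j vj] a : exists e, v e = iota a.
  by have := @field_gen_base _ _ iota [set` l] a; rewrite -vl => -[e _]; exists e.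
have [|l' l'E] := @preimage_seq _ _ v l; first by rewrite vl; apply: sub_field_gen.
have l'T : field_gen j [set` l'] = setT.
  apply/seteqP; split=> // e _; have : field_gen iota (v @` [set` l']) (v e).
    rewrite (_ : v @` _ = [set` l]); first by rewrite -vl; exists e.
    by rewrite l'E; apply/seteqP; split=> [_ [b bs <-]|x /mapP[b bs ->]];
      [apply: map_f|exists b].
  by rewrite (field_gen_morph vj) => -[e' e'l' /fmorph_inj <-].
have sj a : (s' \o v) (j a) = iota a by rewrite /= vj ss' aut_iota.
have [h hH hv] := realize_embeddings k_char0 PO PO' neqO vj sj l'T.
exists h; split=> //.
have -> : h = (s * (s^-1 * h))%g by rewrite mulgA mulgV mul1g.
apply: XU => x; rewrite lX l'E => /mapP[e _ ->].
have -> : (s^-1 * h : autgroup iota)%g (v e) = autinv s (h (v e)) by [].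
by rewrite hv /= ss' autVK.
Qed.
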